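(* Let $n$ be a fixed positive integer and let $\mathcal{G}_n$ be the space of groups marked by an ordered generating family of cardinality $n$. Let $\mathcal{BT}\subset\mathcal{G}_n$ be the set of marked groups $(\Gamma,S)$ such that $\Gamma$ has a free action on a Bruhat--Tits tree (where the valued field may vary with $\Gamma$). Then $\mathcal{BT}$ is closed in $\mathcal{G}_n$. Moreover, every group in $\mathcal{BT}$ acts freely on a $\Lambda$-tree for some totally ordered abelian group $\Lambda$ such that $\Lambda\otimes\mathbb{Q}$ has dimension at most $3n+1$ over $\mathbb{Q}$. In particular, every group in $\mathcal{BT}$ acts freely on an $\mathbb{R}^{3n+1}$-tree, where $\mathbb{R}^{3n+1}$ has the lexicographic ordering.
   Context: Marked groups: a marked group $(G,S)$ is a finitely generated group $G$ with an ordered generating family $S=(s_1,\dots,s_n)$ (repetitions and trivial elements allowed). A relation of $(G,S)$ is an element of the kernel of the morphism $F_n\to G$, $a_i\mapsto s_i$, where $F_n$ is free on $(a_1,\dots,a_n)$. Two marked groups are isomorphic if they have the same set of relations; $\mathcal{G}_n$ is the set of isomorphism classes, with the topology in which a neighbourhood basis of $(G,S)$ is given by the sets $N_R(G,S)$ ($R>0$) of marked groups having exactly the same relations of length at most $R$ as $(G,S)$. $\Lambda$-trees: a totally ordered abelian group $\Lambda$ is an abelian group with a total order such that $x\le y\Rightarrow x+z\le y+z$. $\mathbb{R}^m$ always carries the lexicographic order (leftmost coordinate most significant). A $\Lambda$-metric space is a set $E$ with $d:E\times E\to\Lambda_{\ge 0}$ satisfying separation, symmetry and the triangle inequality. A geodesic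 segment is an isometric map of a segment $[a,b]\subset\Lambda$ into $E$; $E$ is geodesic if any two points are joined by a geodesic segment. A $\Lambda$-tree is a geodesic $\Lambda$-metric space $T$ such that $d(x,y)+d(u,v)\le\max\{d(x,u)+d(y,v),d(x,v)+d(y,u)\}$ for all $x,y,u,v\in T$, and $d(x,y)+d(y,z)-d(x,z)\in 2\Lambda$ for all $x,y,z\in T$. Actions are by isometries; an action is free if no non-trivial element fixes a point. Bruhat--Tits trees: let $K$ be a field with a valuation $v:K\to\Lambda\cup\{\infty\}$, value group $\Lambda=v(K\setminus\{0\})$ and valuation ring $\mathcal{O}$. The Bruhat--Tits $\Lambda$-tree of $SL_2(K)$ is the set of homothety classes of $\mathcal{O}$-lattices (free rank $2$ $\mathcal{O}$-submodules spanning $K^2$) in $K^2$; the distance between the classes of $L'\subset L$ with $L/L'\simeq\mathcal{O}/a\mathcal{O}\oplus\mathcal{O}/b\mathcal{O}$ is $|v(a)-v(b)|$. $SL_2(K)$ acts on it without inversion (an inversion is an isometry $g$ without fixed point such that $g^2$ has a fixed point). An action of $\Gamma$ on a Bruhat--Tits tree is the action of $\Gamma$ on the Bruhat--Tits $\Lambda$-tree of $SL_2(K)$ induced by a morphism $j:\Gamma\to SL_2(K)$, for some valued field $K$ with values in $\Lambda$. *)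

(* Defs.v *)
From HB Require Import structures.
From mathcomp Require Import all_boot all_order all_algebra.
From mathcomp Require Import generic_quotient ring.
From mathcomp Require Import all_classical all_reals all_analysis.

Set Implicit Arguments.
Unset Strict Implicit.
Unset Printing Implicit Defensive.

Import Order.TTheory GRing.Theory Num.Theory.

Local Open Scope classical_set_scope.
Local Open Scope ring_scope.

(* The letter [(i, false)] stands for the generator a_i, and [(i, true)] for
   its inverse. *)
Definition letter (n : nat) : Type := ('I_n * bool)%type.
HB.instance Definition _ n := Finite.on (letter n).

Definition linv n (l : letter n) : letter n := (l.1, ~~ l.2).

Definition reduced n (w : seq (letter n)) : bool :=
  sorted [rel k l : letter n | l != linv k] w.

(* The free group F_n on (a_i)_(i < n), realised by the reduced words; its
   length function is the size of the reduced word. *)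
Record free_group (n : nat) : predArgType :=
  FreeGroup { fg_word :> seq (letter n); fg_reduced : reduced fg_word }.
HB.instance Definition _ n := [isSub for @fg_word n].
HB.instance Definition _ n := [Choice of free_group n by <:].

Section FreeGroup.
Variable n : nat.
Implicit Types (l : letter n) (w : seq (letter n)) (u v : free_group n).

Lemma linvK : involutive (@linv n).
Proof. by case=> i b; rewrite /linv /= negbK. Qed.

Definition push l w : seq (letter n) :=
  if w is k :: w' then if k == linv l then w' else l :: w else [:: l].

Lemma reduced_cons l w : reduced (l :: w) -> reduced w.
Proof. by case: w => //= k w /andP[]. Qed.

Lemma push_reduced l w : reduced w -> reduced (push l w).
Proof.
case: w => //= k w rw; case: eqP => [_|/eqP nk]; first exact: reduced_cons rw.
by rewrite /= nk.
Qed.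

Lemma push_cons l w : reduced (l :: w) -> push l w = l :: w.
Proof. by case: w => //= k w /andP[/negPf-> _]. Qed.

Lemma pushK l w : reduced w -> push l (push (linv l) w) = w.
Proof.
case: w => [_|k w rw] /=; first by rewrite eqxx.
case: (eqVneq k (linv (linv l))) => [kl|_] /=; last by rewrite eqxx.
by rewrite kl linvK in rw *; apply: push_cons.
Qed.

Definition cat_red w1 w2 := foldr push w2 w1.

Lemma cat_red_reduced w1 w2 : reduced w2 -> reduced (cat_red w1 w2).
Proof. by move=> r2; elim: w1 => //= l w1; apply: push_reduced. Qed.

Lemma cat_red_push l w1 w2 : reduced w1 -> reduced w2 ->
  cat_red (push l w1) w2 = push l (cat_red w1 w2).
Proof.
case: w1 => //= k w1 r1 r2; case: eqP => // ->.
by rewrite pushK //; apply: cat_red_reduced.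
Qed.

Lemma cat_redA w1 w2 w3 : reduced w2 -> reduced w3 ->
  cat_red w1 (cat_red w2 w3) = cat_red (cat_red w1 w2) w3.
Proof.
move=> r2 r3; elim: w1 => //= l w1 ->.
by rewrite cat_red_push //; apply: cat_red_reduced.
Qed.

Lemma cat_red0 w : reduced w -> cat_red w [::] = w.
Proof.
elim: w => //= l w IH rw; rewrite IH ?push_cons //; exact: reduced_cons rw.
Qed.

Definition inv_word w := rev (map (@linv n) w).

Lemma inv_word_reduced w : reduced w -> reduced (inv_word w).
Proof.
rewrite /inv_word /reduced rev_sorted sorted_map.
rewrite (@eq_sorted _ _ [rel k l : letter n | l != linv k]) //.
by move=> k l /=; rewrite linvK eq_sym.
Qed.

Lemma inv_wordK : involutive inv_word.
Proof.
by move=> w; rewrite /inv_word map_rev revK mapK //; apply: linvK.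
Qed.

Lemma cat_redV w : reduced w -> cat_red (inv_word w) w = [::].
Proof.
elim: w => //= l w IH rw.
rewrite /inv_word /= rev_cons /cat_red -cats1 foldr_cat /= linvK eqxx.
by apply: IH; apply: reduced_cons rw.
Qed.

Definition fg_one : free_group n := FreeGroup (isT : reduced [::]).
Definition fg_mul u v : free_group n :=
  FreeGroup (cat_red_reduced u (fg_reduced v)).
Definition fg_inv u : free_group n := FreeGroup (inv_word_reduced (fg_reduced u)).

Lemma fg_mulA : associative fg_mul.
Proof. by move=> u v w; apply/val_inj/cat_redA; apply: fg_reduced. Qed.
Lemma fg_mul1 : left_id fg_one fg_mul.
Proof. by move=> u; apply: val_inj. Qed.
Lemma fg_mulr1 : right_id fg_one fg_mul.
Proof. by move=> u; apply/val_inj/cat_red0/fg_reduced. Qed.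
Lemma fg_mulV : left_inverse fg_one fg_inv fg_mul.
Proof. by move=> u; apply/val_inj/cat_redV/fg_reduced. Qed.
Lemma fg_mulrV : right_inverse fg_one fg_inv fg_mul.
Proof.
move=> u; apply: val_inj => /=; rewrite -[X in cat_red X _]inv_wordK.
exact/cat_redV/inv_word_reduced/fg_reduced.
Qed.

HB.instance Definition _ := isGroup.Build (free_group n)
  fg_mulA fg_mul1 fg_mulr1 fg_mulV fg_mulrV.

Definition fg_gen (i : 'I_n) : free_group n :=
  FreeGroup (isT : reduced [:: (i, false) : letter n]).

Variables (G : groupType) (s : 'I_n -> G).

Definition letter_val l : G := (if l.2 then (s l.1)^-1 else s l.1)%g.

Definition fg_eval u : G := (\prod_(l <- fg_word u) letter_val l)%g.

Lemma fg_eval_gen i : fg_eval (fg_gen i) = s i.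
Proof. by rewrite /fg_eval big_seq1. Qed.

Lemma fg_eval_morph : {morph fg_eval : u v / (u * v)%g}.
Proof.
move=> u v; rewrite /fg_eval /=; elim: (fg_word u) => [|l w IH] /=.
  by rewrite big_nil mul1g.
rewrite big_cons -mulgA -IH; case: (cat_red w v) => [|k w'] /=.
  by rewrite big_seq1 big_nil mulg1.
rewrite -/(cat_red w v); case: eqP => [->|_]; last by rewrite !big_cons.
rewrite big_cons mulgA [X in (X * _)%g](_ : _ = 1%g) ?mul1g //.
by rewrite /letter_val /=; case: l.2; rewrite ?mulgV ?mulVg.
Qed.

HB.instance Definition _ :=
  isMultiplicative.Build (free_group n) G fg_eval fg_eval_morph.

End FreeGroup.

Record marked_group (n : nat) := MarkedGroup {
  mg_group :> groupType;
  mg_family : 'I_n -> mg_group;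
  mg_generate : forall g, exists u, fg_eval mg_family u = g
}.

Definition relations n (G : marked_group n) : set (free_group n) :=
  [set u | fg_eval (@mg_family n G) u = 1%g].

(* Two marked groups being isomorphic when they have the same relations, an
   isomorphism class is encoded by the common set of relations of its
   members. *)
Record mgspace (n : nat) := MgSpace {
  mg_rel :> set (free_group n);
  mg_relP : exists G : marked_group n, relations G = mg_rel
}.

Definition mg_class n (G : marked_group n) : mgspace n :=
  MgSpace (ex_intro _ G erefl).

(* As lengths are integers, integral radii suffice. *)
Definition mg_nbhd n (r : nat) (x : mgspace n) : set (mgspace n) :=
  [set y | forall u : free_group n, (size u <= r)%N -> mg_rel y u <-> mg_rel x u].

HB.instance Definition _ n := gen_eqMixin (mgspace n).
HB.instance Definition _ n := gen_choiceMixin (mgspace n).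

HB.instance Definition _ n := hasNbhs.Build (mgspace n)
  (fun x => filter_from [set r : nat | (0 < r)%N] (fun r => mg_nbhd r x)).

Section MarkedTopology.
Variable n : nat.

Lemma mg_nbhs_filter (x : mgspace n) : ProperFilter (nbhs x).
Proof.
apply: filter_from_proper; last by move=> r _; exists x.
apply: filter_from_filter; first by exists 1%N.
move=> r1 r2 /= r1_gt0 r2_gt0; exists (maxn r1 r2); first by rewrite /= leq_max r1_gt0.
by move=> y yx; split=> u ur; apply: yx; rewrite leq_max ur ?orbT.
Qed.

Lemma mg_nbhs_singleton (x : mgspace n) (A : set (mgspace n)) : nbhs x A -> A x.
Proof. by case=> r _; apply. Qed.

Lemma mg_nbhs_nbhs (x : mgspace n) (A : set (mgspace n)) :
  nbhs x A -> nbhs x (nbhs^~ A).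
Proof.
case=> r r_gt0 xA; exists r => // y yx; exists r => // z zy; apply: xA => u ur.
exact: iff_trans (zy u ur) (yx u ur).
Qed.

HB.instance Definition _ := Nbhs_isNbhsTopological.Build (mgspace n)
  mg_nbhs_filter mg_nbhs_singleton mg_nbhs_nbhs.

End MarkedTopology.

Record orderedAbGroup := OrderedAbGroup {
  oag_sort :> Num.POrderedZmodule.type;
  oag_total : total (<=%R : rel oag_sort);
  oag_leD : forall x y z : oag_sort, x <= y -> x + z <= y + z
}.

Definition lexR (R : realType) (m : nat) : Type := 'rV[R]_m.

Section LexR.
Variables (R : realType) (m : nat).
HB.instance Definition _ := GRing.Zmodule.on (lexR R m).
Implicit Types x y z : lexR R m.

Definition lex_lt x y : bool :=
  [exists i : 'I_m, [forall j : 'I_m, (j < i)%N ==> (x 0 j == y 0 j)]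
                    && (x 0 i < y 0 i)].

Lemma lex_ltP x y : reflect
  (exists2 i : 'I_m, forall j : 'I_m, (j < i)%N -> x 0 j = y 0 j & x 0 i < y 0 i)
  (lex_lt x y).
Proof.
apply: (iffP existsP) => [[i /andP[/forallP h lti]]|[i h lti]]; exists i => //.
  by move=> j ji; apply/eqP; move: (h j); rewrite ji.
by rewrite lti andbT; apply/forallP => j; apply/implyP => /h->.
Qed.

Lemma lex_lt_irr : irreflexive lex_lt.
Proof. by move=> x; apply/lex_ltP => -[i _]; rewrite ltxx. Qed.

Lemma lex_lt_trans : transitive lex_lt.
Proof.
move=> y x z /lex_ltP[i hi lti] /lex_ltP[k hk ltk]; apply/lex_ltP.
case: (ltngtP i k) => [ik|ki|/val_inj ik].
- exists i => [j ji|]; last by rewrite -hk.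
  by rewrite hi // hk //; apply: ltn_trans ik.
- exists k => [j jk|]; last by rewrite hi.
  by rewrite hi ?hk //; apply: ltn_trans ki.
- exists i => [j ji|]; first by rewrite hi // hk -?ik.
  by apply: lt_trans lti _; rewrite ik.
Qed.

Lemma lex_lt_total x y : x != y -> lex_lt x y || lex_lt y x.
Proof.
move=> nxy; have [i0 ni0] : exists i : 'I_m, x 0 i != y 0 i.
  apply/existsP; apply: contraNT nxy => /existsPn h; apply/eqP/rowP => i.
  by apply/eqP; move: (h i); rewrite negbK.
case: (@arg_minnP _ i0 (fun i : 'I_m => x 0 i != y 0 i) (@nat_of_ord m) ni0) => i ni hmin.
have hi (j : 'I_m) : (j < i)%N -> x 0 j = y 0 j.
  by apply: contraTeq => /hmin; rewrite leqNgt.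
case/orP: (lt_total ni) => lti; apply/orP; [left|right]; apply/lex_ltP; exists i => //.
by move=> j /hi.
Qed.

HB.instance Definition _ := Order.Lt_isPOrder.Build ring_display (lexR R m)
  lex_lt_irr lex_lt_trans.

Lemma lex_le_total : total (<=%R : rel (lexR R m)).
Proof.
move=> x y; rewrite !le_eqVlt; case: (eqVneq x y) => //=.
exact: lex_lt_total.
Qed.

Lemma lex_leD x y z : (x <= y -> x + z <= y + z)%R.
Proof.
rewrite !le_eqVlt => /predU1P[->|/lex_ltP[i hi lti]]; first by rewrite eqxx.
apply/orP; right; apply/lex_ltP; exists i => [j ji|]; first by rewrite !mxE hi.
by rewrite !mxE ltrD2r.
Qed.

Definition lexR_oag : orderedAbGroup := OrderedAbGroup lex_le_total lex_leD.

End LexR.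

Section TensorRat.
Variable A : zmodType.
Implicit Types x y : A.

(* The tensor product of A and Q over Z is constructed as a localization: the
   pair (x, k) represents the tensor of x and 1/(k+1). See [tens_universal] for
   its characterization as a tensor product. *)
Definition tq_rel (p q : A * nat) : bool :=
  `[< exists m, (p.1 *+ q.2.+1 - q.1 *+ p.2.+1) *+ m.+1 = 0 >].

Lemma tq_relP (p q : A * nat) : reflect
  (exists m, p.1 *+ (q.2.+1 * m.+1) = q.1 *+ (p.2.+1 * m.+1)) (tq_rel p q).
Proof.
have e m : (p.1 *+ q.2.+1 - q.1 *+ p.2.+1) *+ m.+1 =
    p.1 *+ (q.2.+1 * m.+1) - q.1 *+ (p.2.+1 * m.+1) by rewrite mulrnBl !mulrnA.
apply: (iffP (asboolP _)) => -[m em]; exists m.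
  by apply/eqP; rewrite -subr_eq0 -e em.
by rewrite e em subrr.
Qed.

Lemma tq_refl : reflexive tq_rel.
Proof. by move=> p; apply/tq_relP; exists 0%N. Qed.

Lemma tq_sym : symmetric tq_rel.
Proof. by move=> p q; apply/tq_relP/tq_relP => -[m e]; exists m. Qed.

Lemma tq_trans : transitive tq_rel.
Proof.
move=> q p r /tq_relP[m e] /tq_relP[m' e']; apply/tq_relP.
exists (m.+1 * m'.+1 * q.2.+1).-1; rewrite prednK //.
have -> : (r.2.+1 * (m.+1 * m'.+1 * q.2.+1) = q.2.+1 * m.+1 * (r.2.+1 * m'.+1))%N.
  by ring.
rewrite mulrnA e -mulrnA.
have -> : (p.2.+1 * m.+1 * (r.2.+1 * m'.+1) = r.2.+1 * m'.+1 * (p.2.+1 * m.+1))%N.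
  by ring.
rewrite mulrnA e' -mulrnA; congr (_ *+ _); ring.
Qed.

Definition tq_equiv := EquivRel tq_rel tq_refl tq_sym tq_trans.

Definition tensQ : Type := {eq_quot tq_equiv}%qT.
HB.instance Definition _ := Choice.on tensQ.
HB.instance Definition _ := EqQuotient.on tensQ.

Definition tq_frac x d : tensQ := \pi_tensQ%qT (x, d.-1).

Lemma tq_frac_eq x d y e : (0 < d)%N -> (0 < e)%N ->
  tq_frac x d = tq_frac y e <->
  exists2 m, (0 < m)%N & x *~ (e%:Z * m%:Z) = y *~ (d%:Z * m%:Z).
Proof.
move=> d_gt0 e_gt0; rewrite /tq_frac; split=> [/eqP|[m m_gt0 em]].
  rewrite eqmodE => /tq_relP[m] /=; rewrite !prednK // => em; exists m.+1 => //.
apply/eqP; rewrite eqmodE; apply/tq_relP; exists m.-1; rewrite /= !prednK //.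
Qed.

Lemma tq_frac_ind (P : tensQ -> Prop) :
  (forall x d, (0 < d)%N -> P (tq_frac x d)) -> forall u, P u.
Proof. by move=> Pf; elim/quotW => -[x k]; apply: (Pf x k.+1). Qed.

Lemma tq_frac_repr x d : (0 < d)%N -> exists2 m, (0 < m)%N &
  (repr (tq_frac x d)).1 *~ (d%:Z * m%:Z) =
  x *~ ((repr (tq_frac x d)).2.+1%:Z * m%:Z).
Proof.
move=> d_gt0; apply/tq_frac_eq => //.
by rewrite /tq_frac /= -surjective_pairing reprK.
Qed.

Definition tq_zero : tensQ := tq_frac 0 1.

Definition tq_opp (u : tensQ) : tensQ := tq_frac (- (repr u).1) (repr u).2.+1.

Definition tq_add (u v : tensQ) : tensQ :=
  tq_frac ((repr u).1 *~ (repr v).2.+1 + (repr v).1 *~ (repr u).2.+1)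
          ((repr u).2.+1 * (repr v).2.+1).

Definition tq_scale (q : rat) (u : tensQ) : tensQ :=
  tq_frac ((repr u).1 *~ numq q) ((repr u).2.+1 * `|denq q|).

Lemma tq_oppE x d : (0 < d)%N -> tq_opp (tq_frac x d) = tq_frac (- x) d.
Proof.
move=> d_gt0; have [m m_gt0 em] := tq_frac_repr x d_gt0.
by apply/tq_frac_eq => //; exists m => //; rewrite !mulNrz em.
Qed.

Lemma tq_addE x d y e : (0 < d)%N -> (0 < e)%N ->
  tq_add (tq_frac x d) (tq_frac y e) = tq_frac (x *~ e + y *~ d) (d * e).
Proof.
move=> d_gt0 e_gt0; rewrite /tq_add.
have := tq_frac_repr x d_gt0; have := tq_frac_repr y e_gt0.
move: (repr (tq_frac x d)) (repr (tq_frac y e)) => p q [k k_gt0 ek] [m m_gt0 em].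
apply/tq_frac_eq; rewrite ?muln_gt0 ?d_gt0 //; exists (m * k)%N.
  by rewrite muln_gt0 m_gt0.
rewrite !PoszM !mulrzDl -!mulrzA; congr (_ + _).
  rewrite (_ : _ * _ = (d%:Z * m%:Z) * (q.2.+1%:Z * e%:Z * k%:Z)); last by ring.
  by rewrite mulrzA em -mulrzA; congr (_ *~ _); ring.
rewrite (_ : _ * _ = (e%:Z * k%:Z) * (p.2.+1%:Z * d%:Z * m%:Z)); last by ring.
by rewrite mulrzA ek -mulrzA; congr (_ *~ _); ring.
Qed.

Lemma tq_scaleE (q : rat) x d (a : int) b : (0 < d)%N -> (0 < b)%N ->
  q * b%:R = a%:~R -> tq_scale q (tq_frac x d) = tq_frac (x *~ a) (d * b).
Proof.
move=> d_gt0 b_gt0 eq_q; rewrite /tq_scale.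
have := tq_frac_repr x d_gt0; move: (repr (tq_frac x d)) => p [m m_gt0 em].
have nd : q * (denq q)%:~R = (numq q)%:~R.
  by rewrite -{1}(divq_num_den q) divfK // intr_eq0 denq_neq0.
have eab : numq q * b%:Z = a * denq q.
  by apply: (@intr_inj rat); rewrite !rmorphM /= -nd -eq_q mulrAC pmulrn.
apply/tq_frac_eq; rewrite ?muln_gt0 ?d_gt0 ?absz_denq ?absz_gt0 ?denq_neq0 //.
exists m => //; rewrite !PoszM absz_denq -!mulrzA.
rewrite (_ : _ * _ = (d%:Z * m%:Z) * (numq q * b%:Z)); last by ring.
by rewrite mulrzA em -mulrzA eab; congr (_ *~ _); ring.
Qed.

Lemma tq_addA : associative tq_add.
Proof.
elim/tq_frac_ind => x d d0; elim/tq_frac_ind => y e e0.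
elim/tq_frac_ind => z f f0; rewrite !tq_addE ?muln_gt0 ?d0 ?e0 ?f0 //.
rewrite mulnA !mulrzDl -!mulrzA !PoszM addrA; congr (tq_frac (_ + _ + _) _).
- by congr (_ *~ _); ring.
- by congr (_ *~ _); ring.
Qed.

Lemma tq_addC : commutative tq_add.
Proof.
elim/tq_frac_ind => x d d0; elim/tq_frac_ind => y e e0.
by rewrite !tq_addE // addrC mulnC.
Qed.

Lemma tq_add0 : left_id tq_zero tq_add.
Proof.
elim/tq_frac_ind => x d d0.
by rewrite /tq_zero tq_addE // mul0rz add0r mul1n.
Qed.

Lemma tq_addN : left_inverse tq_zero tq_opp tq_add.
Proof.
elim/tq_frac_ind => x d d0; rewrite tq_oppE // tq_addE // mulNrz addNr.
by apply/tq_frac_eq; rewrite ?muln_gt0 ?d0 //; exists 1%N; rewrite // !mul0rz.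
Qed.

HB.instance Definition _ :=
  GRing.isZmodule.Build tensQ tq_addA tq_addC tq_add0 tq_addN.

Lemma rat_num_den (q : rat) : q * `|denq q|%:R = (numq q)%:~R.
Proof.
by rewrite pmulrn absz_denq -{1}(divq_num_den q) divfK // intr_eq0 denq_neq0.
Qed.

Lemma absz_den_gt0 (q : rat) : (0 < `|denq q|)%N.
Proof. by rewrite absz_gt0 denq_neq0. Qed.

Lemma tq_scaleA (p q : rat) u : tq_scale p (tq_scale q u) = tq_scale (p * q) u.
Proof.
elim/tq_frac_ind: u => x d d0.
rewrite (@tq_scaleE q x d (numq q) `|denq q|%N) ?absz_den_gt0 ?rat_num_den //.
rewrite (@tq_scaleE p _ _ (numq p) `|denq p|%N)
  ?muln_gt0 ?d0 ?absz_den_gt0 ?rat_num_den //.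
rewrite (@tq_scaleE (p * q) x d (numq q * numq p) (`|denq q| * `|denq p|)) //.
- by rewrite mulrzA mulnA.
- by rewrite muln_gt0 !absz_den_gt0.
- rewrite natrM rmorphM /= -!rat_num_den; ring.
Qed.

Lemma tq_scale1 : left_id 1 tq_scale.
Proof.
by elim/tq_frac_ind => x d d0; rewrite (@tq_scaleE 1 x d 1 1) // muln1.
Qed.

Lemma tq_scaleDr : right_distributive tq_scale +%R.
Proof.
move=> q; elim/tq_frac_ind => x d d0; elim/tq_frac_ind => y e e0.
have scaleE z f (f0 : (0 < f)%N) :=
  tq_scaleE z f0 (absz_den_gt0 q) (rat_num_den q).
have addE z f t g (f0 : (0 < f)%N) (g0 : (0 < g)%N) :
  tq_frac z f + tq_frac t g = _ := tq_addE z t f0 g0.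
have den0 := absz_den_gt0 q.
rewrite (scaleE x) // (scaleE y) // !addE ?muln_gt0 ?d0 ?e0 // scaleE ?muln_gt0 ?d0 //.
apply/tq_frac_eq; rewrite ?muln_gt0 ?d0 ?e0 ?den0 //; exists 1%N => //.
rewrite !mulrzDl -!mulrzA !PoszM.
by congr (_ + _); congr (_ *~ _); ring.
Qed.

Lemma tq_scaleDl u : {morph tq_scale^~ u : p q / p + q}.
Proof.
move=> p q; elim/tq_frac_ind: u => x d d0.
have addE z f t g (f0 : (0 < f)%N) (g0 : (0 < g)%N) :
  tq_frac z f + tq_frac t g = _ := tq_addE z t f0 g0.
have [p0 q0] := (absz_den_gt0 p, absz_den_gt0 q).
rewrite (tq_scaleE x d0 p0 (rat_num_den p)) (tq_scaleE x d0 q0 (rat_num_den q)).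
rewrite addE ?muln_gt0 ?d0 //.
rewrite (@tq_scaleE (p + q) x d (numq p * `|denq q|%:Z + numq q * `|denq p|%:Z)
           (`|denq p| * `|denq q|)) ?muln_gt0 ?d0 ?p0 //.
  apply/tq_frac_eq; rewrite ?muln_gt0 ?d0 ?p0 ?q0 //; exists 1%N => //.
  rewrite -!mulrzA -mulrzDr -!mulrzA !PoszM; congr (_ *~ _); ring.
by rewrite natrM rmorphD !rmorphM /= -!rat_num_den -!pmulrn; ring.
Qed.

HB.instance Definition _ := GRing.Zmodule_isLmodule.Build rat tensQ
  tq_scaleA tq_scale1 tq_scaleDr tq_scaleDl.

Definition tens x (q : rat) : tensQ := q *: tq_frac x 1.

Lemma tensE x (q : rat) (a : int) b : (0 < b)%N -> q * b%:R = a%:~R ->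
  tens x q = tq_frac (x *~ a) b.
Proof.
by move=> b0 e; rewrite -[b in RHS]mul1n; apply: tq_scaleE.
Qed.

Lemma tq_frac_tens x d : (0 < d)%N -> tq_frac x d = tens x d%:R^-1.
Proof.
move=> d0; rewrite (@tensE x d%:R^-1 1 d) //.
by rewrite mulVf // pnatr_eq0 -lt0n.
Qed.

Lemma tens_addl (q : rat) : {morph tens^~ q : x y / x + y}.
Proof.
move=> x y; rewrite /tens -scalerDr; congr (_ *: _).
by rewrite [RHS]tq_addE //.
Qed.

Lemma tens_addr x : {morph tens x : p q / p + q}.
Proof. by move=> p q; rewrite /tens scalerDl. Qed.

Lemma tens_scale x (p q : rat) : p *: tens x q = tens x (p * q).
Proof. by rewrite /tens scalerA. Qed.

Lemma tens_universal (W : zmodType) (b : A -> rat -> W) :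
  (forall q, {morph b^~ q : x y / x + y}) ->
  (forall x, {morph b x : p q / p + q}) ->
  exists! h : tensQ -> W,
    {morph h : u v / u + v} /\ (forall x q, h (tens x q) = b x q).
Proof.
move=> bDl bDr.
have bMl x q (a : int) : b (x *~ a) q = b x q *~ a.
  have b0 : b 0 q = 0 by apply: (addrI (b 0 q)); rewrite -bDl !addr0.
  have bN y : b (- y) q = - b y q.
    by apply: (addrI (b y q)); rewrite -bDl !subrr b0.
  have bn y n : b (y *+ n) q = b y q *+ n.
    by elim: n => [|n IH]; rewrite ?mulr0n // !mulrS bDl IH.
  by case: a => n; rewrite ?NegzE ?mulrNz ?bN -!pmulrn bn.
have bMr x q (a : int) : b x (q *~ a) = b x q *~ a.
  have b0 : b x 0 = 0 by apply: (addrI (b x 0)); rewrite -bDr !addr0.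
  have bN r : b x (- r) = - b x r.
    by apply: (addrI (b x r)); rewrite -bDr !subrr b0.
  have bn r n : b x (r *+ n) = b x r *+ n.
    by elim: n => [|n IH]; rewrite ?mulr0n // !mulrS bDr IH.
  by case: a => n; rewrite ?NegzE ?mulrNz ?bN -!pmulrn bn.
pose h (u : tensQ) := b (repr u).1 (repr u).2.+1%:R^-1.
have nz d : (0 < d)%N -> d%:R != 0 :> rat by rewrite pnatr_eq0 -lt0n.
have invE (p d m : nat) : (0 < d)%N -> (0 < m)%N ->
    p%:R^-1 = (p%:R * d%:R * m%:R)^-1 * (d%:Z * m%:Z)%:~R :> rat.
  move=> d0 m0; rewrite rmorphM /= -!pmulrn -mulrA invfM.
  by rewrite -mulrA mulVf ?mulr1 // mulf_neq0 // nz.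
have cancelr (d e : nat) : (0 < e)%N ->
    (d * e)%:R^-1 *~ e%:Z = d%:R^-1 :> rat.
  by move=> e0; rewrite -mulrzr -pmulrn natrM invfM mulfVK // nz.
have hE x d : (0 < d)%N -> h (tq_frac x d) = b x d%:R^-1.
  move=> d0; have [m m0 em] := tq_frac_repr x d0; rewrite /h.
  move: (repr _) em => p em.
  rewrite (invE p.2.+1 d m) // mulrzr bMr -bMl em bMl -bMr; congr b.
  by rewrite -mulrzr (mulrC p.2.+1%:R) -invE.
exists h; split; first split.
- elim/tq_frac_ind => x d d0; elim/tq_frac_ind => y e e0.
  rewrite [X in h X]tq_addE // !hE ?muln_gt0 ?d0 // bDl !bMl -!bMr.
  by rewrite cancelr // mulnC cancelr.
- move=> x q; rewrite (tensE x (absz_den_gt0 q) (rat_num_den q)) hE ?absz_den_gt0 //.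
  rewrite bMl -bMr; congr b; rewrite -mulrzr -rat_num_den.
  by rewrite mulrC mulfK // nz // absz_den_gt0.
- move=> h' [_ h'E]; apply/funext; elim/tq_frac_ind => x d d0.
  by rewrite hE // tq_frac_tens // h'E.
Qed.

End TensorRat.

Definition has_basis (V : lmodType rat) (m : nat) (e : 'I_m -> V) : Prop :=
  forall x, exists! c : {ffun 'I_m -> rat}, x = \sum_i c i *: e i.

Definition dimQ_le (V : lmodType rat) (d : nat) : Prop :=
  exists m (e : 'I_m -> V), (m <= d)%N /\ has_basis e.

Definition oag_abs (L : orderedAbGroup) (x : L) : L := Order.max x (- x).

Section LambdaTrees.
Variables (L : orderedAbGroup) (T : Type) (d : T -> T -> L).

Definition is_metric : Prop :=
  [/\ forall x y, 0 <= d x y,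
      forall x y, d x y = 0 <-> x = y,
      forall x y, d x y = d y x
    & forall x y z, d x z <= d x y + d y z].

Definition is_geodesic : Prop :=
  forall x y, exists (a b : L) (s : L -> T),
    [/\ a <= b,
        forall t t', a <= t <= b -> a <= t' <= b ->
          d (s t) (s t') = oag_abs (t - t'),
        s a = x & s b = y].

Definition is_tree : Prop :=
  [/\ is_metric, is_geodesic,
      forall x y u v,
        d x y + d u v <= Order.max (d x u + d y v) (d x v + d y u)
    & forall x y z, exists t, d x y + d y z - d x z = t *+ 2].

Record isometric_action (G : groupType) := Action {
  act :> G -> T -> T;
  act1 : forall x, act 1%g x = x;
  actM : forall g h x, act (g * h)%g x = act g (act h x);
  act_isometry : forall g x y, d (act g x) (act g y) = d x y
}.

Definition free_action (G : groupType) (a : isometric_action G) : Prop :=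
  forall g x, a g x = x -> g = 1%g.

End LambdaTrees.

(* As usual, trees are nonempty (every group acts freely on the empty set). *)
Record lambda_tree (L : orderedAbGroup) := LambdaTree {
  lt_point :> Type;
  lt_dist : lt_point -> lt_point -> L;
  lt_inhabited : inhabited lt_point;
  lt_tree : is_tree lt_dist
}.

Definition acts_freely_on (G : groupType) (L : orderedAbGroup)
    (T : lambda_tree L) : Prop :=
  exists a : isometric_action (@lt_dist L T) G, free_action a.

(* [None] stands for the value infinity. *)
Definition ole (L : orderedAbGroup) (a b : option L) : bool :=
  match a, b with
  | _, None => true
  | None, Some _ => false
  | Some a, Some b => a <= b
  end.

(* Valuations with value group equal to L. *)
Record valuation (K : fieldType) (L : orderedAbGroup) := Valuation {
  vval :> K -> option L;
  vval_eq0 : forall x, vval x = None <-> x = 0;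
  vvalM : forall x y a b,
    vval x = Some a -> vval y = Some b -> vval (x * y) = Some (a + b);
  vvalD : forall x y,
    ole (vval x) (vval (x + y)) || ole (vval y) (vval (x + y));
  vval_surj : forall a, exists x, vval x = Some a
}.

Record SL2 (K : fieldType) : predArgType :=
  MkSL2 { sl2_mx :> 'M[K]_2; sl2_det : \det sl2_mx == 1 }.
HB.instance Definition _ K := [isSub for @sl2_mx K].
HB.instance Definition _ K := [Choice of SL2 K by <:].

Section SL2Group.
Variable K : fieldType.
Implicit Types A B C : SL2 K.

Lemma sl2_one_subproof : \det (1%:M : 'M[K]_2) == 1.
Proof. by rewrite det1. Qed.
Lemma sl2_mul_subproof A B : \det ((A : 'M[K]_2) *m B) == 1.
Proof. by rewrite det_mulmx (eqP (sl2_det A)) (eqP (sl2_det B)) mulr1. Qed.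
Lemma sl2_inv_subproof A : \det (invmx A) == 1.
Proof. by rewrite det_inv (eqP (sl2_det A)) invr1. Qed.

Definition sl2_one := MkSL2 sl2_one_subproof.
Definition sl2_mul A B := MkSL2 (sl2_mul_subproof A B).
Definition sl2_inv A := MkSL2 (sl2_inv_subproof A).

Lemma sl2_unitmx A : (A : 'M[K]_2) \in unitmx.
Proof. by rewrite unitmxE (eqP (sl2_det A)) unitr1. Qed.

Lemma sl2_mulA : associative sl2_mul.
Proof. by move=> A B C; apply/val_inj/mulmxA. Qed.
Lemma sl2_mul1 : left_id sl2_one sl2_mul.
Proof. by move=> A; apply/val_inj/mul1mx. Qed.
Lemma sl2_mulr1 : right_id sl2_one sl2_mul.
Proof. by move=> A; apply/val_inj/mulmx1. Qed.
Lemma sl2_mulV : left_inverse sl2_one sl2_inv sl2_mul.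
Proof. by move=> A; apply/val_inj/mulVmx/sl2_unitmx. Qed.
Lemma sl2_mulrV : right_inverse sl2_one sl2_inv sl2_mul.
Proof. by move=> A; apply/val_inj/mulmxV/sl2_unitmx. Qed.

HB.instance Definition _ := isGroup.Build (SL2 K)
  sl2_mulA sl2_mul1 sl2_mulr1 sl2_mulV sl2_mulrV.

End SL2Group.

Section BruhatTits.
Variables (K : fieldType) (L : orderedAbGroup) (v : valuation K L).

Definition vring : set K := [set x | ole (Some 0) (v x)].

(* [e] is an O-basis of M, and spans K^2 over K. *)
Definition is_lattice (M : set 'cV[K]_2) : Prop :=
  exists e : 'I_2 -> 'cV[K]_2,
  [/\ M = [set x | exists2 c : 'I_2 -> K,
                     forall i, vring (c i) & x = \sum_i c i *: e i],
      forall c : 'I_2 -> K, (forall i, vring (c i)) ->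
        \sum_i c i *: e i = 0 -> forall i, c i = 0
    & forall x, exists c : 'I_2 -> K, x = \sum_i c i *: e i].

Definition homothety_class (M : set 'cV[K]_2) : set (set 'cV[K]_2) :=
  [set N | exists2 c : K, c != 0 & N = [set c *: x | x in M]].

Record bt_vertex := BTVertex {
  bt_class :> set (set 'cV[K]_2);
  bt_classP : exists2 M, is_lattice M & bt_class = homothety_class M
}.

(* M / N and M' / N' are isomorphic as O-modules, where N is contained in M
   and N' in M': the map f lifts an isomorphism from M / N to M' / N'. *)
Definition quot_iso (V V' : lmodType K) (M N : set V) (M' N' : set V') : Prop :=
  exists f : V -> V',
  [/\ forall x, M x -> M' (f x),
      forall x y, M x -> M y -> N' (f (x + y) - (f x + f y)),
      forall c x, vring c -> M x -> N' (f (c *: x) - c *: f x),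
      forall x, M x -> N' (f x) -> N x
    & (forall x, N x -> N' (f x)) /\
      (forall y, M' y -> exists2 x, M x & N' (f x - y))].

(* The O-submodule aO (+) bO of K (+) K. *)
Definition osum (a b : K) : set (K^o * K^o) :=
  [set x | (exists2 s, vring s & x.1 = a * s) /\
           (exists2 t, vring t & x.2 = b * t)].

(* O / aO (+) O / bO is identified with (O (+) O) / (aO (+) bO). *)
Definition bt_dist_rel (x y : bt_vertex) (delta : L) : Prop :=
  exists M N a b va vb,
  [/\ bt_class x M /\ bt_class y N, N `<=` M,
      quot_iso M N (osum 1 1) (osum a b),
      [/\ vring a, vring b, v a = Some va & v b = Some vb]
    & delta = oag_abs (va - vb)].

(* The value |v(a) - v(b)| does not depend on the choice of M and N in the two
   homothety classes, nor on that of a and b. *)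
Definition bt_dist (x y : bt_vertex) : L := xget 0 (bt_dist_rel x y).

Definition mx_image (A : 'M[K]_2) (M : set 'cV[K]_2) : set 'cV[K]_2 :=
  [set A *m x | x in M].

Lemma mx_image_homothety A M : A \in unitmx ->
  [set mx_image A N | N in homothety_class M] = homothety_class (mx_image A M).
Proof.
move=> uA; apply/seteqP; split=> [_ [_ [c c0 ->] <-]|_ [c c0 ->]].
  exists c => //; apply/seteqP; split=> [_ [_ [x Mx <-] <-]|_ [_ [x Mx <-] <-]].
    by exists (A *m x); [exists x|rewrite scalemxAr].
  by exists (c *: x); [exists x|rewrite scalemxAr].
exists [set c *: x | x in M]; first by exists c.
apply/seteqP; split=> [_ [_ [x Mx <-] <-]|_ [_ [x Mx <-] <-]].
  by exists (A *m x); [exists x|rewrite scalemxAr].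
by exists (c *: x); [exists x|rewrite scalemxAr].
Qed.

Lemma mx_image_lattice A M : A \in unitmx -> is_lattice M ->
  is_lattice (mx_image A M).
Proof.
move=> uA [e [-> efree espan]]; exists (fun i => A *m e i).
have sumE (c : 'I_2 -> K) : \sum_i c i *: (A *m e i) = A *m \sum_i c i *: e i.
  by rewrite mulmx_sumr; apply: eq_bigr => i _; rewrite scalemxAr.
split.
- apply/seteqP; split=> [_ [_ [c cO ->] <-]|_ [c cO ->]].
    by exists c => //; rewrite sumE.
  by rewrite sumE; eexists => //; exists c.
- move=> c cO; rewrite sumE => /(congr1 (mulmx (invmx A))).
  by rewrite mulKmx // mulmx0; apply: efree.
- move=> x; have [c ec] := espan (invmx A *m x); exists c.
  by rewrite sumE -ec mulKVmx.
Qed.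

Lemma bt_act_subproof (A : SL2 K) (x : bt_vertex) :
  exists2 M, is_lattice M &
    [set mx_image A N | N in bt_class x] = homothety_class M.
Proof.
have [M latM ->] := bt_classP x.
exists (mx_image A M); first exact: mx_image_lattice (sl2_unitmx A) latM.
exact: mx_image_homothety (sl2_unitmx A).
Qed.

Definition bt_act (A : SL2 K) (x : bt_vertex) : bt_vertex :=
  BTVertex (bt_act_subproof A x).

Lemma bt_vertex_eq (x y : bt_vertex) : bt_class x = bt_class y -> x = y.
Proof.
case: x y => [x xP] [y yP] /= exy; case: _ / exy yP => yP.
by congr BTVertex; apply: Prop_irrelevance.
Qed.

Lemma mx_image1 M : mx_image 1%:M M = M.
Proof.
by apply/seteqP; split=> [_ [x Mx <-]|x Mx]; [|exists x => //]; rewrite mul1mx.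
Qed.

Lemma mx_imageM A B M : mx_image (A *m B) M = mx_image A (mx_image B M).
Proof.
apply/seteqP; split=> [_ [x Mx <-]|_ [_ [x Mx <-] <-]].
  by exists (B *m x); [exists x|rewrite mulmxA].
by exists x; rewrite // mulmxA.
Qed.

Lemma bt_act1 x : bt_act 1%g x = x.
Proof.
apply: bt_vertex_eq => /=; rewrite (_ : mx_image _ = id) ?image_id //.
by apply/funext => M; apply: mx_image1.
Qed.

Lemma bt_actM A B x : bt_act (A * B)%g x = bt_act A (bt_act B x).
Proof.
apply: bt_vertex_eq => /=.
rewrite (_ : mx_image _ = mx_image A \o mx_image B) ?image_comp //.
by apply/funext => M; apply: mx_imageM.
Qed.

Lemma bt_dist_rel_act A x y delta :
  bt_dist_rel x y delta -> bt_dist_rel (bt_act A x) (bt_act A y) delta.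
Proof.
case=> M [N [a [b [va [vb [[xM yN] NM [f [f1 f2 f3 f4 [f5 f6]]] vab ->]]]]]].
exists (mx_image A M), (mx_image A N), a, b, va, vb.
have uA := sl2_unitmx A; have AK x' := mulKmx uA x'.
split=> //; first by split; [exists M|exists N].
  by move=> _ [z Nz <-]; exists z => //; apply: NM.
exists (fun z => f (invmx A *m z)); split.
- by move=> _ [z Mz <-]; rewrite AK; apply: f1.
- by move=> _ _ [z Mz <-] [t Mt <-]; rewrite -mulmxDr !AK; apply: f2.
- by move=> c _ cO [z Mz <-]; rewrite -scalemxAr !AK; apply: f3.
- by move=> _ [z Mz <-]; rewrite AK => /(f4 _ Mz) Nz; exists z.
- split; first by move=> _ [z Nz <-]; rewrite AK; apply: f5.
  move=> t /f6[z Mz Nz]; exists ((A : 'M[K]_2) *m z); first by exists z.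
  by rewrite AK.
Qed.

Lemma bt_act_isometry A x y : bt_dist (bt_act A x) (bt_act A y) = bt_dist x y.
Proof.
congr (xget 0 _); apply/seteqP; split=> delta; last exact: bt_dist_rel_act.
by move=> /(bt_dist_rel_act A^-1%g); rewrite -!bt_actM mulVg !bt_act1.
Qed.

Section InducedAction.
Variables (G : groupType) (j : {multiplicative G -> SL2 K}).

Lemma bt_induced1 x : bt_act (j 1%g) x = x.
Proof.
suff -> : j 1%g = 1%g by rewrite bt_act1.
by apply: (mulgI (j 1%g)); rewrite -gmulfM !mulg1.
Qed.

Lemma bt_inducedM g h x : bt_act (j (g * h)%g) x = bt_act (j g) (bt_act (j h) x).
Proof. by rewrite gmulfM bt_actM. Qed.

Definition bt_action : isometric_action bt_dist G :=
  Action bt_induced1 bt_inducedM (fun g => bt_act_isometry (j g)).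

End InducedAction.
End BruhatTits.

Definition acts_freely_on_BT (G : groupType) : Prop :=
  exists (L : orderedAbGroup) (K : fieldType) (v : valuation K L)
    (j : {multiplicative G -> SL2 K}), free_action (bt_action v j).

Definition BT (n : nat) : set (mgspace n) :=
  [set x | exists2 G : marked_group n, mg_class G = x & acts_freely_on_BT G].
Arguments BT n : clear implicits.

(* Main.v *)
Require Import Defs.
From HB Require Import structures.
From mathcomp Require Import all_boot all_order all_algebra.
From mathcomp Require Import all_classical all_reals all_analysis.
From mathcomp Require Import generic_quotient ring_quotient ring lra.

Set Implicit Arguments.
Unset Strict Implicit.
Unset Printing Implicit Defensive.

Import Order.TTheory GRing.Theory Num.Theory.

Local Open Scope classical_set_scope.
Local Open Scope ring_scope.

(** An element of SL_2(K) fixes a vertex of the Bruhat-Tits tree of a valued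
    field K if and only if its trace is integral. If it stabilises the class
    of a lattice, a conjugate of it is an integral matrix; conversely, a
    cyclic vector and its image span a stable lattice, and a diagonal matrix
    of integral trace is integral ([bt_fixed_trace], [bt_trace_fixed]).
    Hence a group acts freely on a Bruhat-Tits tree exactly when it has a
    representation in some SL_2(K) such that the traces of all its
    nontrivial elements lie outside a valuation ring of K
    ([acts_freely_on_BTP]).

    This condition passes to ultraproducts. If marked groups of [BT]
    converge to a marked group, each element of the free group is eventually
    a relation of all of them or of none, according to whether it is a
    relation of the limit; so the ultraproduct of the representations, over
    the ultraproduct of the fields, is a representation of the limit that
    satisfies the same trace condition ([BT_closed]).

    For the bound on the dimension, K may be replaced by the subfield
    generated by the entries of the images of the n generators. As the
    determinants are 1, it is generated by 3n elements, and Abhyankar's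
    inequality bounds the rational rank of its value group by 3n + 1, the
    additional 1 being contributed by the prime field
    ([gen_frac_rat_spanning]). The inequality is obtained by counting: too
    many monomials in 3n + 1 elements satisfy a linear relation with
    integral coefficients, which forces two of its terms to have the same
    value.

    The trees of the last two claims are built from the norms on K^2, up to
    homothety, that have a basis adapted to them. By the Iwasawa
    decomposition, these classes are also the balls of K; distances are
    easily computed on balls, while the action of SL_2(K) is obvious on
    norms ([norm_ball_iwasawa], [tree_distE], [set_act_norm_ball]). A matrix
    that fixes a norm has an integral trace ([tree_act_fixed]). Nothing
    requires the values of K to exhaust the ordered group, so the
    construction applies to the value group and also to a lexicographic
    power of the real numbers in which the value group is embedded. The
    embedding is Hahn's in finite rank: Hoelder's map to the real numbers
    gives the leading coordinate, and its kernel, of smaller rank, gives the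
    others ([oag_lex_embedding]). *)

(** * Identities in abelian groups *)

(** Formal sums: an identity between sums holds in every abelian group as soon
    as the coefficients of each variable agree, which [zmod] checks by
    computation. *)
Inductive zterm := ZVar of nat | ZZero | ZAdd of zterm & zterm | ZOpp of zterm.

Fixpoint zeval (A : zmodType) (env : seq A) (e : zterm) : A :=
  match e with
  | ZVar k => env`_k
  | ZZero => 0
  | ZAdd e1 e2 => zeval env e1 + zeval env e2
  | ZOpp e1 => - zeval env e1
  end.

Fixpoint zcoef (e : zterm) (k : nat) : int :=
  match e with
  | ZVar i => (i == k)%:Z
  | ZZero => 0
  | ZAdd e1 e2 => zcoef e1 k + zcoef e2 k
  | ZOpp e1 => - zcoef e1 k
  end.

Lemma zevalE (A : zmodType) (env : seq A) e :
  zeval env e = \sum_(k < size env) env`_k *~ zcoef e k.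
Proof.
elim: e => [i||e1 IH1 e2 IH2|e IH] /=.
- have [ik|ik] := ltnP i (size env); last first.
    rewrite nth_default // big1 // => k _.
    by rewrite gtn_eqF ?mulr0z // (leq_trans (ltn_ord k)).
  rewrite (bigD1 (Ordinal ik)) //= eqxx mulr1z big1 ?addr0 // => k /eqP nk.
  by case: eqP => // e; case: nk; apply: val_inj.
- by rewrite big1 // => k _; rewrite mulr0z.
- by rewrite IH1 IH2 -big_split /=; apply: eq_bigr => k _; rewrite mulrzDr.
- by rewrite IH -sumrN; apply: eq_bigr => k _; rewrite mulrNz.
Qed.

Lemma zeval_eq (A : zmodType) (env : seq A) n x y e1 e2 :
  size env = n -> x = zeval env e1 -> y = zeval env e2 ->
  all (fun k => zcoef e1 k == zcoef e2 k) (iota 0 n) -> x = y.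
Proof.
move=> <- -> -> /allP h; rewrite !zevalE; apply: eq_bigr => k _.
by rewrite (eqP (h k _)) // mem_iota /= add0n.
Qed.

Ltac zmod_env x env :=
  lazymatch x with
  | @GRing.zero _ => env
  | @GRing.add _ ?y ?z => let env' := zmod_env y env in zmod_env z env'
  | @GRing.opp _ ?y => zmod_env y env
  | _ =>
    let rec insert l := lazymatch l with
      | nil => constr:(cons x nil)
      | cons x _ => l
      | cons ?y ?l' => let l'' := insert l' in constr:(cons y l'')
      end in
    insert env
  end.

Ltac zmod_reify x env :=
  lazymatch x with
  | @GRing.zero _ => constr:(ZZero)
  | @GRing.add _ ?y ?z =>
    let e1 := zmod_reify y env in let e2 := zmod_reify z env in constr:(ZAdd e1 e2)
  | @GRing.opp _ ?y => let e := zmod_reify y env in constr:(ZOpp e)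
  | _ =>
    let rec index l := lazymatch l with
      | cons x _ => constr:(O)
      | cons _ ?l' => let k := index l' in constr:(S k)
      end in
    let k := index env in constr:(ZVar k)
  end.

Ltac zmod :=
  rewrite ?mulr2n;
  lazymatch goal with |- @eq ?T ?x ?y =>
    let env := zmod_env x (@nil T) in
    let env := zmod_env y env in
    let e1 := zmod_reify x env in
    let e2 := zmod_reify y env in
    let n := eval cbn in (size env) in
    refine (@zeval_eq _ env n x y e1 e2 (erefl n) (erefl x) (erefl y) _);
    vm_compute; reflexivity
  end.

Section OrderedGroups.
Variable L : orderedAbGroup.
Implicit Types x y z t : L.

(** Linear inequalities are proved by certificates: the difference of the two
    sides is that of one or two known inequalities. *)
Lemma oag_leW x y x1 y1 : x1 <= y1 -> y - x = y1 - x1 -> x <= y.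
Proof.
move=> h e; have := oag_leD (x - x1) h.
have -> : x1 + (x - x1) = x by zmod.
suff -> : y1 + (x - x1) = y by [].
by transitivity (y1 - x1 + x); [|rewrite -e]; zmod.
Qed.

Lemma oag_leD2 x y z t : x <= y -> z <= t -> x + z <= y + t.
Proof.
move=> xy zt; apply: (le_trans (oag_leD z xy)).
by apply: (oag_leW zt); zmod.
Qed.

Lemma oag_leW2 x y x1 y1 x2 y2 : x1 <= y1 -> x2 <= y2 ->
  y - x = (y1 + y2) - (x1 + x2) -> x <= y.
Proof. by move=> h1 h2; apply: oag_leW; apply: oag_leD2. Qed.

Lemma oag_le_or x y : {x <= y} + {y < x}.
Proof.
case: (boolP (x <= y)) => h; [by left|right].
have := oag_total x y; rewrite (negbTE h) /= lt_neqAle => ->; rewrite andbT.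
by apply: contraNneq h => ->.
Qed.

Lemma oag_ltNge x y : (x < y) = ~~ (y <= x).
Proof.
apply/idP/idP => [xy|]; first by apply/negP => yx; have := lt_le_trans xy yx; rewrite ltxx.
by case: (oag_le_or y x) => // ->.
Qed.

Lemma oag_ltW x y x1 y1 : x1 < y1 -> y - x = y1 - x1 -> x < y.
Proof.
rewrite !oag_ltNge => h e; apply: contra h => h; apply: (oag_leW h).
by apply: oppr_inj; rewrite !opprB.
Qed.

Lemma oag_ltD x y z t : x < y -> z <= t -> x + z < y + t.
Proof.
move=> xy zt; apply: (@lt_le_trans _ _ (y + z)).
  by apply: (oag_ltW xy); zmod.
by apply: (oag_leW zt); zmod.
Qed.

Lemma oag_ltW2 x y x1 y1 x2 y2 : x1 < y1 -> x2 <= y2 ->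
  y - x = (y1 + y2) - (x1 + x2) -> x < y.
Proof. by move=> h1 h2; apply: oag_ltW; apply: oag_ltD. Qed.

Lemma oag_le_double x y : (x + x <= y + y) = (x <= y).
Proof.
apply/idP/idP => [|h]; last exact: oag_leD2.
apply: contraTT; rewrite -!oag_ltNge => h; apply: oag_ltD => //.
exact: ltW.
Qed.

Lemma oag_muln_eq0 x k : x *+ k.+1 = 0 -> x = 0.
Proof.
have pos y : 0 < y -> 0 < y *+ k.+1.
  move=> y0; elim: k => [|k IH]; first by rewrite mulr1n.
  by rewrite mulrS -[X in X < _]addr0 oag_ltD // ltW.
move=> xk; case: (oag_le_or x 0); last by move=> /pos; rewrite xk ltxx.
rewrite le_eqVlt => /predU1P[//|x0].
have /pos : 0 < - x by apply: (oag_ltW x0); zmod.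
by rewrite mulNrn xk oppr0 ltxx.
Qed.

Lemma oag_mulz_eq0 x (k : int) : k != 0 -> x *~ k = 0 -> x = 0.
Proof.
case: k => [[|k]|k] // _; first exact: oag_muln_eq0.
by rewrite NegzE mulrNz => /eqP; rewrite oppr_eq0 => /eqP/oag_muln_eq0.
Qed.

End OrderedGroups.

Lemma multiplicative1 (G H : groupType) (j : {multiplicative G -> H}) : j 1%g = 1%g.
Proof. by apply: (mulgI (j 1%g)); rewrite -gmulfM !mulg1. Qed.

Lemma multiplicativeV (G H : groupType) (j : {multiplicative G -> H}) g :
  j (g^-1)%g = ((j g)^-1)%g.
Proof. by apply: (mulIg (j g)); rewrite -gmulfM !mulVg multiplicative1. Qed.

(** * Valuations *)

(** Unlike [valuation], values need not exhaust the ordered group: this allows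
    the values to be transported into a larger group. *)
Record prevaluation (K : fieldType) (L : orderedAbGroup) := Prevaluation {
  pval :> K -> option L;
  pval_eq0 : forall x, pval x = None <-> x = 0;
  pvalM : forall x y a b,
    pval x = Some a -> pval y = Some b -> pval (x * y) = Some (a + b);
  pvalD : forall x y,
    ole (pval x) (pval (x + y)) || ole (pval y) (pval (x + y))
}.

Section Prevaluation.
Variables (K : fieldType) (L : orderedAbGroup) (w : prevaluation K L).
Implicit Types (x y : K) (a b : L).

Definition vle a x : bool := ole (Some a) (w x).

Lemma pval0 : w 0 = None. Proof. exact/pval_eq0. Qed.

Lemma pvalP x : x != 0 -> exists a, w x = Some a.
Proof.
move=> x0; case e: (w x) => [a|]; first by exists a.
by move/pval_eq0: e x0 => ->; rewrite eqxx.
Qed.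

Lemma pval_neq0 x a : w x = Some a -> x != 0.
Proof. by move=> e; apply/eqP => x0; move: e; rewrite x0 pval0. Qed.

Lemma pval1 : w 1 = Some 0.
Proof.
have [a e] := pvalP (oner_neq0 K); have := pvalM e e.
rewrite mulr1 e => -[ea]; congr Some.
by apply: (addrI a); rewrite addr0 -ea.
Qed.

Lemma pvalN1 : w (-1) = Some 0.
Proof.
have N1 : (-1 : K) != 0 by rewrite oppr_eq0 oner_neq0.
have [a e] := pvalP N1; have := pvalM e e.
rewrite mulrNN mulr1 pval1 => -[ea]; rewrite e; congr Some.
by apply: (@oag_muln_eq0 _ _ 1); rewrite mulr2n -ea.
Qed.

Lemma pvalV x a : w x = Some a -> w x^-1 = Some (- a).
Proof.
move=> e; have x0 := pval_neq0 e; have xV : x^-1 != 0 by rewrite invr_eq0.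
have [b eb] := pvalP xV.
have := pvalM e eb; rewrite mulfV // pval1 => -[ab]; rewrite eb; congr Some.
by apply: (addrI a); rewrite -ab subrr.
Qed.

Lemma pvalN x : w (- x) = w x.
Proof.
case: (eqVneq x 0) => [->|x0]; first by rewrite oppr0.
have [a e] := pvalP x0; rewrite e -mulN1r.
by rewrite (pvalM pvalN1 e) add0r.
Qed.

Lemma vle0 a : vle a 0. Proof. by rewrite /vle pval0. Qed.

Lemma vle_val x a b : w x = Some b -> vle a x = (a <= b).
Proof. by rewrite /vle => ->. Qed.

Lemma vleN a x : vle a (- x) = vle a x.
Proof. by rewrite /vle pvalN. Qed.

Lemma vleW a b x : a <= b -> vle b x -> vle a x.
Proof. by rewrite /vle; case: (w x) => //= c; apply: le_trans. Qed.

Lemma vleD a x y : vle a x -> vle a y -> vle a (x + y).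
Proof.
rewrite /vle; have := pvalD w x y.
case: (w (x + y)) => [c|] //; case: (w x) => [b|]; case: (w y) => [b'|] //=.
- by case/orP=> h h1 h2; apply: le_trans h.
- by rewrite orbF => h h1 _; apply: le_trans h.
- by move=> h _ h1; apply: le_trans h.
Qed.

Lemma vleB a x y : vle a x -> vle a y -> vle a (x - y).
Proof. by move=> ax ay; rewrite vleD // vleN. Qed.

Lemma vleMr a b x y : w y = Some b -> vle (a + b) (x * y) = vle a x.
Proof.
move=> e; case: (eqVneq x 0) => [->|x0]; first by rewrite mul0r !vle0.
have [c ec] := pvalP x0; rewrite (vle_val _ ec) (vle_val _ (pvalM ec e)).
by apply/idP/idP => h; apply: (oag_leW h); zmod.
Qed.

Lemma vleM a b x y : vle a x -> vle b y -> vle (a + b) (x * y).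
Proof.
case: (eqVneq y 0) => [->|y0]; first by rewrite mulr0 !vle0.
have [c ec] := pvalP y0; rewrite (vle_val _ ec) => ax bc.
by apply: (@vleW _ (a + c)); [apply: oag_leD2|rewrite (vleMr _ _ ec)].
Qed.

End Prevaluation.

Section Transport.
Variables (K : fieldType) (L L' : orderedAbGroup) (w : prevaluation K L).
Variable phi : L -> L'.
Hypothesis phiD : {morph phi : x y / x + y}.
Hypothesis phi_gt0 : forall x, 0 < x -> 0 < phi x.

Lemma phi0 : phi 0 = 0.
Proof. by apply: (addrI (phi 0)); rewrite -phiD !addr0. Qed.

Lemma phi_le x y : x <= y -> phi x <= phi y.
Proof.
rewrite le_eqVlt => /predU1P[->//|xy]; apply: ltW.
have /phi_gt0 h : 0 < y - x by apply: (oag_ltW xy); zmod.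
apply: (oag_ltW h); have -> : phi y = phi (y - x) + phi x.
  by rewrite -phiD subrK.
zmod.
Qed.

Definition transport_val x := omap phi (w x).

Lemma transport_eq0 x : transport_val x = None <-> x = 0.
Proof.
rewrite /transport_val; case e: (w x) => [a|] /=.
  by split=> // x0; have := pval_neq0 e; rewrite x0 eqxx.
by split=> // _; apply/(pval_eq0 w).
Qed.

Lemma transportM x y a b : transport_val x = Some a ->
  transport_val y = Some b -> transport_val (x * y) = Some (a + b).
Proof.
rewrite /transport_val; case ex: (w x) => [a'|] //= [<-].
by case ey: (w y) => [b'|] //= [<-]; rewrite (pvalM ex ey) /= phiD.
Qed.

Lemma transportD x y : ole (transport_val x) (transport_val (x + y)) ||
  ole (transport_val y) (transport_val (x + y)).
Proof.
rewrite /transport_val; have := pvalD w x y.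
case: (w (x + y)) => [c|]; last by case: (w x) => [?|]; case: (w y).
case: (w x) => [a|]; case: (w y) => [b|] //=.
- by case/orP => /phi_le->; rewrite ?orbT.
- by rewrite !orbF => /phi_le.
- by move/phi_le.
Qed.

Definition transport : prevaluation K L' :=
  Prevaluation transport_eq0 transportM transportD.

Lemma transport_vle0 x : vle transport 0 x -> vle w 0 x.
Proof.
rewrite /vle /= /transport_val; case: (w x) => //= a; apply: contraLR.
rewrite -!oag_ltNge => a0; have /phi_gt0 h : 0 < - a by apply: (oag_ltW a0); zmod.
have -> : phi a = - phi (- a) by apply/eqP; rewrite -addr_eq0 -phiD subrr phi0.
by apply: (oag_ltW h); zmod.
Qed.

End Transport.

(** * Matrices of size two *)

Section Matrix2.
Variable K : fieldType.

Lemma sum2E (V : zmodType) (F : 'I_2 -> V) : \sum_i F i = F 0 + F 1.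
Proof.
rewrite !big_ord_recl big_ord0 addr0 (_ : lift ord0 ord0 = 1) //.
exact: val_inj.
Qed.

Lemma ord2P (i : 'I_2) : i = 0 \/ i = 1.
Proof. by case: i => -[|[|//]] lti; [left|right]; apply: val_inj. Qed.

Lemma mulmx2E m p (B : 'M[K]_(m, 2)) (C : 'M[K]_(2, p)) i k :
  (B *m C) i k = B i 0 * C 0 k + B i 1 * C 1 k.
Proof. by rewrite mxE sum2E. Qed.

Definition mx2 (a b c d : K) : 'M[K]_2 :=
  \matrix_(i, j) if i == 0 then if j == 0 then a else b
                 else if j == 0 then c else d.

Lemma mx2E (a b c d : K) : (mx2 a b c d 0 0 = a) * (mx2 a b c d 0 1 = b) *
  (mx2 a b c d 1 0 = c) * (mx2 a b c d 1 1 = d).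
Proof. by rewrite !mxE. Qed.

Lemma det_mx2E (B : 'M[K]_2) : \det B = B 0 0 * B 1 1 - B 0 1 * B 1 0.
Proof.
rewrite (expand_det_row _ 0) !big_ord_recl big_ord0 addr0 /cofactor !det_mx11 !mxE /=.
have -> : lift ord0 ord0 = 1 :> 'I_2 by apply: val_inj.
have -> : lift 1 0 = 0 :> 'I_2 by apply: val_inj.
by rewrite expr0 expr1 mul1r mulN1r mulrN.
Qed.

Lemma mx2P (B C : 'M[K]_2) : B 0 0 = C 0 0 -> B 0 1 = C 0 1 ->
  B 1 0 = C 1 0 -> B 1 1 = C 1 1 -> B = C.
Proof.
move=> h00 h01 h10 h11; apply/matrixP => i k.
by case: (ord2P i) => ->; case: (ord2P k) => ->.
Qed.

Lemma mxtrace2E (B : 'M[K]_2) : \tr B = B 0 0 + B 1 1.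
Proof. exact: sum2E. Qed.

Lemma sl2_det2E (A : SL2 K) : A 0 0 * A 1 1 - A 0 1 * A 1 0 = 1.
Proof. by rewrite -det_mx2E; apply/eqP/sl2_det. Qed.

(** Cayley-Hamilton in determinant one. *)
Lemma sl2_invE (A : SL2 K) : sl2_mx (A^-1)%g = (\tr A)%:M - sl2_mx A.
Proof.
have AK : (\tr A)%:M - sl2_mx A = mx2 (A 1 1) (- A 0 1) (- A 1 0) (A 0 0).
  by apply: mx2P; rewrite !mx2E !mxE /= mxtrace2E; ring.
have e : sl2_mx A *m ((\tr A)%:M - sl2_mx A) = 1%:M.
  have d := sl2_det2E A.
  by rewrite AK; apply: mx2P; rewrite mulmx2E !mx2E !mxE /= -?d; ring.
by rewrite -[LHS]mulmx1 -e mulmxA /= mulVmx ?mul1mx // sl2_unitmx.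
Qed.

End Matrix2.

(** * The tree of a valued field *)

Section Tree.
Variables (K : fieldType) (L : orderedAbGroup) (w : prevaluation K L).
Implicit Types (x y z : K) (t s r a b m : L) (u : 'cV[K]_2) (g A : SL2 K).

Lemma doubleD : {morph (fun t : L => t + t) : t s / t + s}.
Proof. by move=> t s; zmod. Qed.

Lemma double_gt0 t : 0 < t -> 0 < t + t.
Proof. by move=> t0; rewrite -[X in X < _]addr0 oag_ltD // ltW. Qed.

(** The doubling compensates for the normalisation of norms by their volume in
    [norm_ball], where halves would otherwise appear. *)
Definition val2 := transport w doubleD double_gt0.

Lemma val2_vle a x : vle w a x -> vle val2 (a + a) x.
Proof. by rewrite /vle /val2 /= /transport_val; case: (w x) => //= b; rewrite oag_le_double. Qed.

(** The points of the tree are the classes up to homothety of the norms N(u) =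
    min(w((gu)_0), w((gu)_1) + t) on K^2. Subtracting the volume from twice
    the norm gives the homothety invariant function F(u) = min(2w((gu)_0) - t,
    2w((gu)_1) + t); the point is encoded by the set of the (u, a) with a <=
    F(u), which avoids infinite values. *)
Definition norm_ball g t : set ('cV[K]_2 * L) :=
  [set p : 'cV[K]_2 * L | vle val2 (p.2 + t) ((sl2_mx g *m p.1) 0 0) &&
           vle val2 (p.2 - t) ((sl2_mx g *m p.1) 1 0)].

(** The ball of the y such that t <= w(y - x), as a point of the tree. *)
Definition ball_at x t : set ('cV[K]_2 * L) :=
  [set p : 'cV[K]_2 * L | vle val2 (p.2 + t) (p.1 0 0 - x * p.1 1 0) &&
           vle val2 (p.2 - t) (p.1 1 0)].

Lemma norm_ball_unipotent x t : exists g, norm_ball g t = ball_at x t.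
Proof.
have d1 : \det (mx2 1 (- x) 0 1) == 1.
  by rewrite det_mx2E !mx2E mulr1 mulr0 subr0.
exists (MkSL2 d1); apply/seteqP; split=> -[u a] /=;
  by rewrite /norm_ball /ball_at /= !mulmx2E !mx2E !mul1r mul0r add0r mulNr.
Qed.

(** Iwasawa decomposition: an upper triangular matrix absorbs [g] as soon as
    one entry of its first column dominates the other one; here it is the top
    entry. *)
Lemma norm_ball_top g t b : val2 (g 0 0) = Some b ->
  vle val2 (b - t - t) (g 1 0) ->
  norm_ball g t = ball_at (- (g 0 1 / g 0 0)) (t - b).
Proof.
move=> eb dom; have g0 := pval_neq0 eb.
have det1 : g 0 0 * g 1 1 - g 0 1 * g 1 0 = 1.
  by rewrite -det_mx2E; apply/eqP/sl2_det.
rewrite /norm_ball /ball_at; apply/funext => -[u a] /=; congr is_true.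
rewrite !mulmx2E; set f := (X in vle _ (a + t) X); set h := (X in vle _ (a - t) X).
have ef : f = (u 0 0 - - (g 0 1 / g 0 0) * u 1 0) * g 0 0.
  by rewrite /f; field.
have eh : u 1 0 = h * g 0 0 - g 1 0 * f.
  rewrite -[LHS]mul1r -det1 /h /f; ring.
have -> : vle val2 (a + t) f =
    vle val2 (a + (t - b)) (u 0 0 - - (g 0 1 / g 0 0) * u 1 0).
  have -> : a + t = a + (t - b) + b by zmod.
  by rewrite ef (vleMr _ _ eb).
rewrite -(vleMr _ (_ - _) eb) -ef; have -> : a + (t - b) + b = a + t by zmod.
case vf: (vle _ _ f) => //=.
have vgf : vle val2 (a - t + b) (g 1 0 * f).
  by have := vleM dom vf; congr vle; zmod.
rewrite -(vleMr _ h eb); have -> : a - (t - b) = a - t + b by zmod.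
apply/idP/idP => [vh|vu]; first by rewrite eh vleB.
by have := vleD vu vgf; rewrite eh subrK.
Qed.

(** Exchanging the rows up to sign exchanges the two conditions of
    [norm_ball], at the price of changing the sign of [t]: this reduces the
    other case of the Iwasawa decomposition to [norm_ball_top]. *)
Lemma sl2_flip g t : exists2 g', norm_ball g' (- t) = norm_ball g t &
  forall j, g' 0 j = g 1 j /\ g' 1 j = - g 0 j.
Proof.
have d1 : \det (mx2 (g 1 0) (g 1 1) (- g 0 0) (- g 0 1)) == 1.
  rewrite det_mx2E !mx2E; have /eqP := sl2_det g; rewrite det_mx2E => <-.
  by apply/eqP; ring.
exists (MkSL2 d1); last first.
  move=> j; rewrite /= !mxE; case: j => -[|[|//]] ltj /=; split; do ?congr (- _);
    by congr (sl2_mx g _ _); apply: val_inj.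
rewrite /norm_ball; apply/funext => -[u a] /=; congr is_true.
rewrite !mulmx2E /= !mx2E andbC opprK; congr (_ && _).
by rewrite !mulNr -opprD vleN.
Qed.

Lemma norm_ball_iwasawa g t : exists x s, norm_ball g t = ball_at x s.
Proof.
have top g' t' b : val2 (g' 0 0) = Some b ->
    vle val2 (b - t' - t') (g' 1 0) -> exists x s, norm_ball g' t' = ball_at x s.
  by move=> eb dom; rewrite (norm_ball_top eb dom); eexists; eexists.
have [g' eg' g'E] := sl2_flip g t.
case: (eqVneq (g 0 0) 0) => [g00|/(pvalP val2)[b eb]]; last first.
  case dom: (vle val2 (b - t - t) (g 1 0)); first exact: top eb dom.
  have g10 : g 1 0 != 0 by apply: contraFneq dom => ->; rewrite vle0.
  have [c ec] := pvalP val2 g10.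
  rewrite -eg'; have [g'0 g'1] := g'E 0.
  apply: (top _ _ c); first by rewrite g'0.
  rewrite g'1 vleN (vle_val _ eb).
  move: dom; rewrite (vle_val _ ec) => /negbT; rewrite -oag_ltNge => /ltW dom.
  by apply: (oag_leW dom); zmod.
have g10 : g 1 0 != 0.
  apply/eqP => g10; have /eqP := sl2_det g.
  by rewrite det_mx2E g00 g10 mul0r mulr0 subr0 => /esym/eqP; rewrite oner_eq0.
have [c ec] := pvalP val2 g10.
rewrite -eg'; have [g'0 g'1] := g'E 0.
by apply: (top _ _ c); [rewrite g'0|rewrite g'1 g00 oppr0 vle0].
Qed.

End Tree.

Section TreeMetric.
Variables (K : fieldType) (L : orderedAbGroup) (w : prevaluation K L).
Implicit Types (x y z : K) (t s r a b m : L) (u : 'cV[K]_2) (g A : SL2 K).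
Implicit Types P Q : set ('cV[K]_2 * L).

Definition shifted delta P Q := forall u a, P (u, a) -> Q (u, a - delta).

(** For two points encoded by functions F and F', this is the maximum of F -
    F'. Only the two sets are involved, so the invariance under SL_2(K) is
    immediate. *)
Definition ball_dist P Q : L :=
  xget 0 [set delta | shifted delta P Q /\
                      forall delta', shifted delta' P Q -> delta <= delta'].

(** [m] is the level at which the branches from the end at infinity down to
    the two balls separate. *)
Definition ball_meet x t y s m : Prop :=
  [/\ m <= t, m <= s, vle w m (x - y) & [\/ m = t, m = s | w (x - y) = Some m]].

Lemma ball_meet_ex x t y s : exists m, ball_meet x t y s m.
Proof.
have [m [mt ms em]] : exists m, [/\ m <= t, m <= s & m = t \/ m = s].
  case: (oag_le_or t s) => ts; first by exists t; split=> //; left.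
  by exists s; split=> //; [apply: ltW|right].
case h: (vle w m (x - y)).
  by exists m; split=> //; case: em => em; [apply: Or31|apply: Or32].
have d0 : x - y != 0 by apply: contraFneq h => ->; rewrite vle0.
have [c ec] := pvalP w d0; move: h; rewrite (vle_val _ ec) => /negbT.
rewrite -oag_ltNge => /ltW cm; exists c; split; last exact: Or33.
- exact: le_trans mt.
- exact: le_trans ms.
- by rewrite (vle_val _ ec).
Qed.

Lemma ball_meet_sym x t y s m : ball_meet x t y s m -> ball_meet y s x t m.
Proof.
case=> mt ms mv em; split=> //; first by rewrite -opprB vleN.
by case: em => em; [apply: Or32|apply: Or31|apply: Or33; rewrite -opprB pvalN].
Qed.

Lemma ball_meet_max x t y s m b : ball_meet x t y s m ->
  b <= t -> b <= s -> vle w b (x - y) -> b <= m.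
Proof. by case=> _ _ _ [->|->|em] // _ _; rewrite (vle_val _ em). Qed.

Lemma ball_meet_ultrametric x t y s z r m1 m2 m3 :
  ball_meet x t y s m1 -> ball_meet y s z r m2 -> ball_meet x t z r m3 ->
  m1 <= m3 \/ m2 <= m3.
Proof.
move=> [m1t m1s v1 _] [m2s m2r v2 _] meet3.
have exz : x - z = (x - y) + (y - z) by ring.
case: (oag_le_or m1 m2) => [m12|/ltW m21]; [left|right];
  apply: (ball_meet_max meet3); rewrite ?exz //.
- exact: le_trans m2r.
- by apply: vleD => //; apply: vleW v2.
- exact: le_trans m1t.
- by apply: vleD => //; apply: vleW v1.
Qed.

Lemma ball_at_shifted x t y s m : ball_meet x t y s m ->
  shifted (t + s - (m + m)) (ball_at w x t) (ball_at w y s).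
Proof.
move=> [mt ms mv _] u a /= /andP[/= v0 v1]; apply/andP; split => /=.
  have -> : u 0 0 - y * u 1 0 = (u 0 0 - x * u 1 0) + u 1 0 * (x - y) by ring.
  apply: vleD.
    by apply: vleW v0; apply: (oag_leW2 mt mt); zmod.
  by have := vleM v1 (val2_vle mv); congr vle; zmod.
by apply: vleW v1; apply: (oag_leW2 ms ms); zmod.
Qed.

(** The least bound is attained at the vector (1, 0) or at the vector (x, 1),
    according to which of the three quantities realises the meet. *)
Lemma ball_dist_ball x t y s m : ball_meet x t y s m ->
  ball_dist (ball_at w x t) (ball_at w y s) = t + s - (m + m).
Proof.
move=> meet; apply: xget_subset1; last first.
  move=> d d' [sd mind] [sd' mind']; apply: le_anti.
  by rewrite mind // mind'.
split; first exact: ball_at_shifted.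
move=> d sd; have [mt ms mv em] := meet.
have v1 : val2 w 1 = Some 0.
  by rewrite /= /transport_val pval1 /= addr0.
(* The vector (1, 0) belongs to the first point at level - t. *)
have e1P : s - t <= d.
  have := sd (\col_i (if i == 0 then 1 else 0)) (- t); rewrite /ball_at /= !mxE /=.
  rewrite !mulr0 !subr0 !vle0 !andbT !(vle_val _ v1) addNr lexx => /(_ isT) h.
  by apply: (oag_leW h); zmod.
(* The vector (x, 1) belongs to the first point at level t. *)
have := sd (\col_i (if i == 0 then x else 1)) t; rewrite /ball_at /= !mxE /=.
rewrite !mulr1 !subrr vle0 !(vle_val _ v1) lexx => /(_ isT)/andP[h0 h1].
case: em => [->|->|em].
- by apply: (oag_leW e1P); zmod.
- by apply: (oag_leW h1); zmod.
- have em2 : val2 w (x - y) = Some (m + m) by rewrite /= /transport_val em.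
  by rewrite (vle_val _ em2) in h0; apply: (oag_leW h0); zmod.
Qed.

Definition tree_point := {P : set ('cV[K]_2 * L) | exists g t, P = norm_ball w g t}.

Definition tree_dist (p q : tree_point) : L := ball_dist (sval p) (sval q).

Lemma tree_point_eq (p q : tree_point) : sval p = sval q -> p = q.
Proof. by apply: eq_sig_hprop => P; apply: Prop_irrelevance. Qed.

Lemma tree_ball_subproof x t : exists g s, ball_at w x t = norm_ball w g s.
Proof. by have [g eg] := norm_ball_unipotent w x t; exists g, t. Qed.

Definition tree_ball x t : tree_point := exist _ _ (tree_ball_subproof x t).

Lemma tree_ballP (p : tree_point) : exists x t, p = tree_ball x t.
Proof.
case: p => P [g [t eP]]; have [x [s e]] := norm_ball_iwasawa w g t.
by exists x, s; apply: tree_point_eq; rewrite /= eP.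
Qed.

Lemma tree_distE x t y s m : ball_meet x t y s m ->
  tree_dist (tree_ball x t) (tree_ball y s) = t + s - (m + m).
Proof. exact: ball_dist_ball. Qed.

Lemma tree_metric : is_metric tree_dist.
Proof.
split.
- move=> p q; have [x [t ->]] := tree_ballP p; have [y [s ->]] := tree_ballP q.
  have [m meet] := ball_meet_ex x t y s; rewrite (tree_distE meet).
  by case: meet => mt ms _ _; apply: (oag_leW2 mt ms); zmod.
- move=> p q; have [x [t ->]] := tree_ballP p; have [y [s ->]] := tree_ballP q.
  have [m meet] := ball_meet_ex x t y s; rewrite (tree_distE meet); split.
    move=> d0; apply: tree_point_eq => /=.
    have sub := ball_at_shifted meet; have sub' := ball_at_shifted (ball_meet_sym meet).
    rewrite addrC in sub'; rewrite [s + t]addrC [X in shifted X]addrC d0 in sub'.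
    rewrite d0 in sub.
    apply/seteqP; split=> -[u a] /=; first by move/sub; rewrite subr0.
    by move/sub'; rewrite subr0.
  move=> /(congr1 sval) /= e; rewrite -(ball_dist_ball meet) e.
  have meet' : ball_meet y s y s s by split=> //; [rewrite subrr vle0|apply: Or31].
  by rewrite (ball_dist_ball meet'); zmod.
- move=> p q; have [x [t ->]] := tree_ballP p; have [y [s ->]] := tree_ballP q.
  have [m meet] := ball_meet_ex x t y s.
  by rewrite (tree_distE meet) (tree_distE (ball_meet_sym meet)) [t + s]addrC.
- move=> p q o; have [x [t ->]] := tree_ballP p; have [y [s ->]] := tree_ballP q.
  have [z [r ->]] := tree_ballP o.
  have [m1 meet1] := ball_meet_ex x t y s; have [m2 meet2] := ball_meet_ex y s z r.
  have [m3 meet3] := ball_meet_ex x t z r.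
  rewrite (tree_distE meet1) (tree_distE meet2) (tree_distE meet3).
  have [_ m1s _ _] := meet1; have [m2s _ _ _] := meet2.
  case: (ball_meet_ultrametric meet1 meet2 meet3) => h.
    by apply: (oag_leW (oag_leD2 (oag_leD2 h h) (oag_leD2 m2s m2s))); zmod.
  by apply: (oag_leW (oag_leD2 (oag_leD2 h h) (oag_leD2 m1s m1s))); zmod.
Qed.

Lemma oag_le_maxP (c a b : L) : c <= a \/ c <= b -> c <= Order.max a b.
Proof.
rewrite /Order.max; case: ifP => [/ltW ab|/negbT]; first by case=> // /le_trans->.
rewrite oag_ltNge negbK => ba; by case=> // /le_trans->.
Qed.

(** The four point condition only concerns the six meets of the four balls; it
    follows from the ultrametric inequality applied to the four triples. *)
Lemma four_meets (p q a b c e : L) :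
  a <= p \/ e <= p -> c <= p \/ b <= p -> a <= q \/ c <= q -> e <= q \/ b <= q ->
  a + b <= p + q \/ c + e <= p + q.
Proof.
have swap (a1 b1 : L) : b1 <= p -> a1 <= q -> a1 + b1 <= p + q.
  by move=> b1p a1q; apply: (oag_leW2 b1p a1q); zmod.
have cross (a1 b1 c1 e1 : L) : a1 <= p -> b1 <= p -> c1 <= q -> e1 <= q ->
    a1 + b1 <= p + q \/ c1 + e1 <= p + q.
  move=> ap bp cq eq; case: (oag_le_or p q) => [pq|/ltW qp].
    by left; apply: (oag_leD2 ap); apply: le_trans pq.
  by right; apply: swap => //; apply: le_trans qp.
case=> [ap|ep]; case=> [cp|bp]; case=> [aq|cq]; case=> [eq|bq];
  try (by left; apply: swap); try (by left; apply: oag_leD2);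
  try (by right; apply: swap); try (by right; apply: oag_leD2).
  exact: cross.
by have [] := cross c e a b cp ep aq bq; [right|left].
Qed.

Lemma tree_four_point (p1 p2 p3 p4 : tree_point) :
  tree_dist p1 p2 + tree_dist p3 p4 <=
  Order.max (tree_dist p1 p3 + tree_dist p2 p4) (tree_dist p1 p4 + tree_dist p2 p3).
Proof.
have [x1 [t1 ->]] := tree_ballP p1; have [x2 [t2 ->]] := tree_ballP p2.
have [x3 [t3 ->]] := tree_ballP p3; have [x4 [t4 ->]] := tree_ballP p4.
have [m12 h12] := ball_meet_ex x1 t1 x2 t2; have [m34 h34] := ball_meet_ex x3 t3 x4 t4.
have [m13 h13] := ball_meet_ex x1 t1 x3 t3; have [m24 h24] := ball_meet_ex x2 t2 x4 t4.
have [m14 h14] := ball_meet_ex x1 t1 x4 t4; have [m23 h23] := ball_meet_ex x2 t2 x3 t3.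
rewrite (tree_distE h12) (tree_distE h34) (tree_distE h13) (tree_distE h24).
rewrite (tree_distE h14) (tree_distE h23); apply: oag_le_maxP.
have [] := @four_meets m12 m34 m13 m24 m14 m23.
- exact: ball_meet_ultrametric h13 (ball_meet_sym h23) h12.
- exact: ball_meet_ultrametric h14 (ball_meet_sym h24) h12.
- exact: ball_meet_ultrametric (ball_meet_sym h13) h14 h34.
- exact: ball_meet_ultrametric (ball_meet_sym h23) h24 h34.
- by move=> h; left; apply: (oag_leW2 h h); zmod.
- by move=> h; right; apply: (oag_leW2 h h); zmod.
Qed.

Lemma tree_even (p q o : tree_point) :
  exists t, tree_dist p q + tree_dist q o - tree_dist p o = t *+ 2.
Proof.
have [x [t ->]] := tree_ballP p; have [y [s ->]] := tree_ballP q.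
have [z [r ->]] := tree_ballP o.
have [m1 meet1] := ball_meet_ex x t y s; have [m2 meet2] := ball_meet_ex y s z r.
have [m3 meet3] := ball_meet_ex x t z r.
rewrite (tree_distE meet1) (tree_distE meet2) (tree_distE meet3).
by exists (s - m1 - m2 + m3); zmod.
Qed.

Lemma oag_absE (t : L) : oag_abs t = if 0 <= t then t else - t.
Proof.
rewrite /oag_abs /Order.max; case: ifP => h; case: ifP => // t0.
  case: (oag_le_or t 0) => [t0'|t1]; first by rewrite (@le_anti _ _ t 0) ?t0 ?t0' ?oppr0.
  have : t < t by apply: (lt_le_trans h); apply: (oag_leW2 (ltW t1) (ltW t1)); zmod.
  by rewrite ltxx.
case: notF; rewrite -h; move/negbT: t0; rewrite -oag_ltNge => t0.
by apply: (oag_ltW2 t0 (ltW t0)); zmod.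
Qed.

(** The geodesic descends from the first ball to the level of the meet, then
    climbs to the second one. *)
Lemma tree_geodesic : is_geodesic tree_dist.
Proof.
move=> p q; have [x [t ->]] := tree_ballP p; have [y [s ->]] := tree_ballP q.
have [m meet] := ball_meet_ex x t y s; have [mt ms mv em] := meet.
pose path r := if r <= t - m then tree_ball x (t - r) else tree_ball y (m + m - t + r).
have dist_vert z r1 r2 : r1 <= r2 -> tree_dist (tree_ball z r1) (tree_ball z r2) = r2 - r1.
  move=> r12; rewrite (@tree_distE _ _ _ _ r1); first by zmod.
  by split=> //; [rewrite subrr vle0|apply: Or31].
have dist_sym r1 r2 z1 z2 : tree_dist (tree_ball z1 r1) (tree_ball z2 r2) =
    tree_dist (tree_ball z2 r2) (tree_ball z1 r1).
  by have [_ _ sym _] := tree_metric; apply: sym.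
have dist_path r1 r2 : 0 <= r1 -> r1 <= r2 -> r2 <= t + s - (m + m) ->
    tree_dist (path r1) (path r2) = r2 - r1.
  move=> r10 r12 r2D; rewrite /path.
  case: (boolP (r2 <= t - m)) => [r2m|].
    rewrite (le_trans r12 r2m) dist_sym dist_vert; first by zmod.
    by apply: (oag_leW r12); zmod.
  rewrite -oag_ltNge => /ltW mr2; case: ifP => [r1m|].
    rewrite (@tree_distE _ _ _ _ m); first by zmod.
    split=> //.
    + by apply: (oag_leW r1m); zmod.
    + by apply: (oag_leW mr2); zmod.
    + have [m' meet'] := ball_meet_ex x (t - r1) y (m + m - t + r2).
      have m'm : m' <= m.
        have [h1 h2 h3 _] := meet'; apply: (ball_meet_max meet) => //.
          by apply: (le_trans h1); apply: (oag_leW r10); zmod.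
        by apply: (le_trans h2); apply: (oag_leW r2D); zmod.
      have em' : m' = m.
        apply: le_anti; rewrite m'm /=; apply: (ball_meet_max meet') => //.
          by apply: (oag_leW r1m); zmod.
        by apply: (oag_leW mr2); zmod.
      by have [_ _ _] := meet'; rewrite em'.
  move=> /negbT; rewrite -oag_ltNge => /ltW mr1; rewrite dist_vert; first by zmod.
  by apply: (oag_leW r12); zmod.
exists 0, (t + s - (m + m)), path; split.
- by apply: (oag_leW2 mt ms); zmod.
- move=> r1 r2 /andP[r10 r1D] /andP[r20 r2D]; rewrite oag_absE.
  case: ifP => [h|/negbT].
    have [_ _ -> _] := tree_metric; rewrite dist_path //.
    by apply: (oag_leW h); zmod.
  rewrite -oag_ltNge => /ltW h; rewrite dist_path //; first by zmod.
  by apply: (oag_leW h); zmod.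
- rewrite /path ifT ?subr0 //.
  by apply: (oag_leW mt); zmod.
- rewrite /path; case: ifP => [h|_]; last by congr tree_ball; zmod.
  have sm : s = m.
    by apply: le_anti; rewrite ms andbT; apply: (oag_leW h); zmod.
  have -> : t - (t + s - (m + m)) = s by rewrite sm; zmod.
  apply: tree_point_eq => /=.
  apply/seteqP; split.
    have /ball_at_shifted : ball_meet x s y s s.
      by split=> //; [rewrite sm|apply: Or31].
    have -> : s + s - (s + s) = 0 by zmod.
    by move=> sub [u a] /sub; rewrite subr0.
  have /ball_at_shifted : ball_meet y s x s s.
    by apply: ball_meet_sym; split=> //; [rewrite sm|apply: Or31].
  have -> : s + s - (s + s) = 0 by zmod.
  by move=> sub [u a] /sub; rewrite subr0.
Qed.

Lemma tree_is_tree : is_tree tree_dist.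
Proof.
split; [exact: tree_metric|exact: tree_geodesic|exact: tree_four_point|exact: tree_even].
Qed.

Definition val_tree : lambda_tree L :=
  LambdaTree (inhabits (tree_ball 0 0)) tree_is_tree.

Definition set_act A P : set ('cV[K]_2 * L) :=
  [set p : 'cV[K]_2 * L | P (sl2_mx (A^-1)%g *m p.1, p.2)].

Lemma set_act_norm_ball A g t :
  set_act A (norm_ball w g t) = norm_ball w (g * A^-1)%g t.
Proof. by apply/funext => -[u a]; rewrite /set_act /norm_ball /= !mulmxA. Qed.

Lemma tree_act_subproof A (p : tree_point) :
  exists g t, set_act A (sval p) = norm_ball w g t.
Proof.
by case: p => P eP /=; case: eP => g [t ->]; rewrite set_act_norm_ball; exists (g * A^-1)%g, t.
Qed.

Definition tree_act A (p : tree_point) : tree_point :=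
  exist _ _ (tree_act_subproof A p).

Lemma tree_act1 p : tree_act 1%g p = p.
Proof.
apply: tree_point_eq; apply/funext => -[u a]; transitivity (set_act 1%g (sval p) (u, a)) => //.
by rewrite /set_act invg1 /= mul1mx.
Qed.

Lemma tree_actM A B p : tree_act (A * B)%g p = tree_act A (tree_act B p).
Proof.
apply: tree_point_eq; apply/funext => -[u a].
transitivity (set_act (A * B)%g (sval p) (u, a)) => //.
by rewrite /set_act invgM /= -mulmxA.
Qed.

Lemma shifted_act A delta P Q :
  shifted delta P Q -> shifted delta (set_act A P) (set_act A Q).
Proof. by move=> sh u a; apply: sh. Qed.

Lemma tree_act_isometry A p q : tree_dist (tree_act A p) (tree_act A q) = tree_dist p q.
Proof.
have actK P : set_act (A^-1)%g (set_act A P) = P.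
  apply/funext => -[u a]; rewrite /set_act invgK /= mulmxA.
  by rewrite (_ : _ *m _ = 1%:M) ?mul1mx //; apply: (congr1 (@sl2_mx K) (mulVg A)).
have shiftE delta :
    shifted delta (set_act A (sval p)) (set_act A (sval q)) = shifted delta (sval p) (sval q).
  apply/propext; split; last exact: shifted_act.
  by move/(@shifted_act (A^-1)%g _ _ _); rewrite !actK.
rewrite /tree_dist /ball_dist; congr (xget 0 _).
have sval_act o : sval (tree_act A o) = set_act A (sval o) by [].
rewrite !sval_act; apply/funext => delta; rewrite /mkset shiftE; congr (_ /\ _); apply/propext.
by split=> h d' sd'; apply: h; move: sd'; rewrite shiftE.
Qed.

(** On the basis adapted to a fixed ball, both diagonal entries are integral. *)
Lemma tree_act_fixed A p : tree_act A p = p -> vle w 0 (\tr A).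
Proof.
case: p => P eP /(congr1 sval) /=; case: (eP) => g [t ->] fixA.
pose B : SL2 K := (g * A * g^-1)%g.
have BgE u : sl2_mx B *m (sl2_mx g *m u) = sl2_mx g *m (sl2_mx A *m u).
  have /(congr1 (@sl2_mx K)) /= e : (g * A = B * g)%g by rewrite /B -mulgA mulVg mulg1.
  by rewrite !mulmxA -e.
have v1 : val2 w 1 = Some 0 by rewrite /= /transport_val pval1 /= addr0.
have v2_int z : vle (val2 w) 0 z -> vle w 0 z.
  rewrite /vle /= /transport_val; case: (w z) => //= b h.
  by rewrite -oag_le_double addr0.
have fixed u a : norm_ball w g t (u, a) -> norm_ball w g t (sl2_mx A *m u, a).
  rewrite -{2}fixA /set_act /= mulmxA.
  rewrite (_ : _ *m _ = 1%:M) ?mul1mx //; exact: (congr1 (@sl2_mx K) (mulVg A)).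
have cofixed u : exists u', sl2_mx g *m u' = u.
  exists (sl2_mx (g^-1)%g *m u); rewrite mulmxA.
  rewrite (_ : _ *m _ = 1%:M) ?mul1mx //; exact: (congr1 (@sl2_mx K) (mulgV g)).
have trA : \tr A = B 0 0 + B 1 1.
  have -> : \tr A = \tr (sl2_mx B).
    rewrite /B /= mxtrace_mulC mulmxA.
    rewrite (_ : invmx g *m _ = 1%:M) ?mul1mx //; exact: (congr1 (@sl2_mx K) (mulVg g)).
  rewrite /mxtrace !big_ord_recl big_ord0 addr0.
  by congr (_ + sl2_mx B _ _); apply: val_inj.
rewrite trA; apply: vleD; apply: v2_int.
  have [u eu] := cofixed (\col_i (if i == 0 then 1 else 0)).
  have /fixed : norm_ball w g t (u, - t).
    by rewrite /norm_ball /= eu !mxE /= vle0 andbT (vle_val _ v1) addNr.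
  rewrite /norm_ball /= -BgE eu !mulmx2E !mxE /= !mulr1 !mulr0 !addr0 addNr.
  by case/andP.
have [u eu] := cofixed (\col_i (if i == 0 then 0 else 1)).
have /fixed : norm_ball w g t (u, t).
  by rewrite /norm_ball /= eu !mxE /= vle0 (vle_val _ v1) subrr /=.
rewrite /norm_ball /= -BgE eu !mulmx2E !mxE /= !mulr1 !mulr0 !add0r subrr.
by case/andP.
Qed.

Section Action.
Variables (G : groupType) (j : {multiplicative G -> SL2 K}).

Lemma tree_act_morph1 p : tree_act (j 1%g) p = p.
Proof. by rewrite multiplicative1 tree_act1. Qed.

Lemma tree_act_morphM (g h : G) p : tree_act (j (g * h)%g) p = tree_act (j g) (tree_act (j h) p).
Proof. by rewrite gmulfM tree_actM. Qed.

Definition tree_action : isometric_action tree_dist G :=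
  Action tree_act_morph1 tree_act_morphM (fun g : G => tree_act_isometry (j g)).

Lemma val_tree_free : (forall g : G, vle w 0 (\tr (j g)) -> g = 1%g) ->
  acts_freely_on G val_tree.
Proof.
by move=> hyp; exists tree_action => g p /= /tree_act_fixed/hyp.
Qed.

End Action.

End TreeMetric.

(** * Valuation rings *)

Record is_valring (K : fieldType) (O : set K) : Prop := IsValring {
  valring1 : O 1;
  valringB : forall x y, O x -> O y -> O (x - y);
  valringM : forall x y, O x -> O y -> O (x * y);
  valring_total : forall x, O x \/ O x^-1
}.

Section ValuationRing.
Variables (K : fieldType) (O : set K).
Hypothesis valO : is_valring O.
Implicit Types (x y a b : K) (S T : set K).

Lemma valring0 : O 0.
Proof. by rewrite -(subrr 1); apply: (valringB valO); apply: (valring1 valO). Qed.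

Lemma valringN x : O x -> O (- x).
Proof. by rewrite -sub0r; apply/(valringB valO)/valring0. Qed.

Lemma valringD x y : O x -> O y -> O (x + y).
Proof. by move=> Ox Oy; rewrite -[y]opprK; apply/(valringB valO)/valringN. Qed.

Definition principal a : set K := [set z | O (z / a)].

Lemma principal_self a : a != 0 -> principal a a.
Proof. by move=> a0; rewrite /principal /= mulfV //; apply: valring1. Qed.

Lemma principalM a b : a != 0 -> b != 0 ->
  [set x * y | x in principal a & y in principal b] = principal (a * b).
Proof.
move=> a0 b0; apply/seteqP; split=> [_ [x Ox [y Oy <-]]|z Oz].
  by rewrite /principal /= invfM mulrACA; apply: (valringM valO).
exists a; first exact: principal_self.
exists (z / a); last by rewrite mulrC divfK.
by rewrite /principal /= -mulrA -invfM.
Qed.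

Lemma principalV a : a != 0 ->
  [set z | forall s, principal a s -> O (z * s)] = principal a^-1.
Proof.
move=> a0; apply/seteqP; split=> z.
  by move/(_ a (principal_self a0)); rewrite /principal /= invrK.
rewrite /principal /= invrK => Oz s Os.
have -> : z * s = (z * a) * (s / a) by rewrite mulrA [RHS]mulrAC; field.
exact: (valringM valO).
Qed.

Lemma principal_subset a b : a != 0 -> b != 0 ->
  principal b `<=` principal a <-> O (b / a).
Proof.
move=> a0 b0; split=> [|Oba z Oz]; first by apply; apply: principal_self.
rewrite /principal /= (_ : z / a = z / b * (b / a)); first exact: (valringM valO).
by rewrite mulrA divfK.
Qed.

(** The value group, written additively, is realised by the nonzero principal
    fractional ideals, multiplied as sets and ordered by reverse inclusion. *)
Record fractional_ideal := FractionalIdeal {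
  fi_set :> set K;
  fi_principal : exists2 a, a != 0 & fi_set = principal a
}.

(** The proof is an argument so that the group structure can be attached to
    the type. *)
Definition value_group of is_valring O : Type := fractional_ideal.
Local Notation L := (value_group valO).

Lemma fi_eq (S T : L) : fi_set S = fi_set T -> S = T.
Proof.
case: S T => [S PS] [T PT] /= e; case: _ / e PT => PT.
by congr FractionalIdeal; apply: Prop_irrelevance.
Qed.

Definition fi_of a (a0 : a != 0) : L := FractionalIdeal (ex_intro2 _ _ a a0 erefl).

Lemma fiP (S : L) : exists a (a0 : a != 0), S = fi_of a0.
Proof. by case: (fi_principal S) => a a0 e; exists a, a0; apply: fi_eq. Qed.

Lemma fi_add_subproof (S T : L) :
  exists2 a, a != 0 & [set x * y | x in fi_set S & y in fi_set T] = principal a.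
Proof.
have [a [a0 ->]] := fiP S; have [b [b0 ->]] := fiP T; exists (a * b).
  by rewrite mulf_neq0.
exact: principalM.
Qed.

Lemma fi_opp_subproof (S : L) :
  exists2 a, a != 0 & [set z | forall s, fi_set S s -> O (z * s)] = principal a.
Proof.
have [a [a0 ->]] := fiP S; exists a^-1; first by rewrite invr_eq0.
exact: principalV.
Qed.

Definition fi_add (S T : L) : L := FractionalIdeal (fi_add_subproof S T).
Definition fi_opp (S : L) : L := FractionalIdeal (fi_opp_subproof S).
Definition fi_zero : L := fi_of (oner_neq0 K).

Lemma fi_addA : associative fi_add.
Proof.
move=> S T U; have [a [a0 ->]] := fiP S; have [b [b0 ->]] := fiP T.
have [c [c0 ->]] := fiP U; apply: fi_eq.
by rewrite /= !principalM ?mulf_neq0 // mulrA.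
Qed.

Lemma fi_addC : commutative fi_add.
Proof.
move=> S T; have [a [a0 ->]] := fiP S; have [b [b0 ->]] := fiP T; apply: fi_eq.
by rewrite /= !principalM // mulrC.
Qed.

Lemma fi_add0 : left_id fi_zero fi_add.
Proof.
move=> S; have [a [a0 ->]] := fiP S; apply: fi_eq.
by rewrite /= principalM ?oner_neq0 // mul1r.
Qed.

Lemma fi_addN : left_inverse fi_zero fi_opp fi_add.
Proof.
move=> S; have [a [a0 ->]] := fiP S; apply: fi_eq.
by rewrite /= principalV // principalM ?invr_eq0 // mulVf.
Qed.

HB.instance Definition _ := gen_eqMixin (value_group valO).
HB.instance Definition _ := gen_choiceMixin (value_group valO).
HB.instance Definition _ :=
  GRing.isZmodule.Build (value_group valO) fi_addA fi_addC fi_add0 fi_addN.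

Definition fi_le (S T : L) : bool := `[< fi_set T `<=` fi_set S >].

Lemma fi_le_refl : reflexive fi_le.
Proof. by move=> S; apply/asboolP. Qed.

Lemma fi_le_anti : antisymmetric fi_le.
Proof. by move=> S T /andP[/asboolP TS /asboolP ST]; apply/fi_eq/seteqP. Qed.

Lemma fi_le_trans : transitive fi_le.
Proof. by move=> T S U /asboolP TS /asboolP UT; apply/asboolP => x /UT/TS. Qed.

HB.instance Definition _ :=
  Order.Le_isPOrder.Build ring_display (value_group valO) fi_le_refl fi_le_anti fi_le_trans.

Lemma fi_leE a b (a0 : a != 0) (b0 : b != 0) : fi_of a0 <= fi_of b0 <-> O (b / a).
Proof.
rewrite -principal_subset //; split=> [/asboolP//|h].
exact/asboolP.
Qed.

Lemma fi_le_total : total (<=%R : rel L).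
Proof.
move=> S T; have [a [a0 ->]] := fiP S; have [b [b0 ->]] := fiP T.
apply/orP; case: (valring_total valO (b / a)) => h; [left|right]; apply/fi_leE => //.
by rewrite invf_div in h.
Qed.

Lemma fi_leD (S T U : L) : S <= T -> S + U <= T + U.
Proof.
move=> /asboolP ST; apply/asboolP => _ [x Tx [y Uy <-]].
by exists x; [apply: ST|exists y].
Qed.

Definition value_oag : orderedAbGroup := OrderedAbGroup fi_le_total fi_leD.

Definition fi_val x : option value_oag :=
  if pselect (x != 0) is left x0 then Some (fi_of x0) else None.

Lemma fi_valE x (x0 : x != 0) : fi_val x = Some (fi_of x0).
Proof.
rewrite /fi_val; case: pselect => // x0'; congr Some; exact: fi_eq.
Qed.

Lemma fi_val0 : fi_val 0 = None.
Proof. by rewrite /fi_val; case: pselect => // x0; have := x0; rewrite eqxx. Qed.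

Lemma fi_val_eq0 x : fi_val x = None <-> x = 0.
Proof.
have [->|x0] := eqVneq x 0; first by rewrite fi_val0.
by rewrite (fi_valE x0); split=> // x_eq0; case/eqP: x0.
Qed.

Lemma fi_valM x y (S T : value_oag) : fi_val x = Some S -> fi_val y = Some T ->
  fi_val (x * y) = Some (S + T).
Proof.
have [->|x0] := eqVneq x 0; first by rewrite fi_val0.
have [->|y0] := eqVneq y 0; first by rewrite fi_val0.
rewrite (fi_valE x0) (fi_valE y0) (fi_valE (mulf_neq0 x0 y0)) => -[<-] [<-].
by congr Some; apply: fi_eq; rewrite /= principalM.
Qed.

Lemma fi_valD x y : ole (fi_val x) (fi_val (x + y)) || ole (fi_val y) (fi_val (x + y)).
Proof.
have [->|x0] := eqVneq x 0; first by rewrite add0r; apply/orP; right; case: (fi_val y) => //=.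
have [->|y0] := eqVneq y 0; first by rewrite addr0; apply/orP; left; case: (fi_val x) => //=.
have [->|s0] := eqVneq (x + y) 0; first by rewrite fi_val0; case: (fi_val x).
rewrite (fi_valE x0) (fi_valE y0) (fi_valE s0) /=.
apply/orP; case: (valring_total valO (y / x)) => h; [left|right]; apply/fi_leE.
  by rewrite mulrDl mulfV //; apply: valringD => //; apply: valring1.
rewrite invf_div in h; rewrite mulrDl mulfV //; apply: valringD => //; exact: valring1.
Qed.

Lemma fi_val_surj (S : value_oag) : exists x, fi_val x = Some S.
Proof. by have [a [a0 ->]] := fiP S; exists a; apply: fi_valE. Qed.

Definition valring_valuation : valuation K value_oag :=
  Valuation fi_val_eq0 fi_valM fi_valD fi_val_surj.

Lemma vring_valring_valuation : vring valring_valuation = O.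
Proof.
apply/seteqP; split=> x; rewrite /vring /=.
  have [->|x0] := eqVneq x 0; first by move=> _; apply: valring0.
  by rewrite (fi_valE x0) /= => /fi_leE; rewrite divr1.
have [->|x0] := eqVneq x 0; first by rewrite fi_val0.
by move=> Ox; rewrite (fi_valE x0) /=; apply/fi_leE; rewrite divr1.
Qed.

End ValuationRing.

Definition prevaluation_of K L (v : valuation K L) : prevaluation K L :=
  Prevaluation (vval_eq0 v) (vvalM (v := v)) (vvalD v).

Lemma vring_is_valring K L (v : valuation K L) : is_valring (vring v).
Proof.
have vringE x : vring v x = vle (prevaluation_of v) 0 x by [].
split=> [|x y|x y|x]; rewrite !vringE.
- by rewrite (vle_val _ (pval1 _)).
- exact: vleB.
- by move=> Ox Oy; have := vleM Ox Oy; rewrite addr0.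
- have [->|x0] := eqVneq x 0; first by left; apply: vle0.
  have [a ea] := pvalP (prevaluation_of v) x0.
  rewrite (vle_val _ ea) (vle_val _ (pvalV ea)).
  case: (oag_le_or 0 a) => [|/ltW a0]; [by left|right].
  by apply: (oag_leW a0); zmod.
Qed.

(** * Fixed vertices of the Bruhat-Tits tree *)

Section FixedVertices.
Variables (K : fieldType) (L : orderedAbGroup) (v : valuation K L).
Implicit Types (P B : 'M[K]_2) (A : SL2 K) (M : set 'cV[K]_2).

Local Notation O := (vring v).
Let valO : is_valring O := vring_is_valring v.

Definition integral_mx m p (B : 'M[K]_(m, p)) : Prop := forall i k, O (B i k).

Lemma integral_mulmx m p (B : 'M[K]_(m, 2)) (C : 'M[K]_(2, p)) :
  integral_mx B -> integral_mx C -> integral_mx (B *m C).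
Proof.
by move=> OB OC i k; rewrite mulmx2E; apply: (valringD valO); apply: (valringM valO).
Qed.

Definition lattice_of P : set 'cV[K]_2 := [set P *m a | a in @integral_mx 2 1].

Lemma mulmx_cols m (P : 'M[K]_(m, 2)) (a : 'cV[K]_2) : P *m a = \sum_i a i 0 *: col i P.
Proof. by apply/colP => i; rewrite mulmx2E summxE sum2E !mxE ![P _ _ * _]mulrC. Qed.

Lemma lattice_of_is_lattice P : P \in unitmx -> is_lattice v (lattice_of P).
Proof.
move=> uP; have sumE (c : 'I_2 -> K) : \sum_i c i *: col i P = P *m \col_i c i.
  by rewrite mulmx_cols; apply: eq_bigr => i _; rewrite mxE.
exists (fun i => col i P); split.
- apply/seteqP; split=> [_ [a Oa <-]|_ [c Oc ->]].
    by exists (fun i => a i 0); [move=> i; apply: Oa|rewrite mulmx_cols].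
  by exists (\col_i c i); [move=> i k; rewrite mxE|rewrite sumE].
- move=> c _; rewrite sumE => /(congr1 (mulmx (invmx P))).
  by rewrite mulKmx // mulmx0 => /colP c0 i; have := c0 i; rewrite !mxE.
- move=> x; exists (fun i => (invmx P *m x) i 0); rewrite sumE.
  rewrite (_ : \col_i _ = invmx P *m x) ?mulKVmx //.
  by apply/colP => i; rewrite mxE.
Qed.

Lemma is_latticeP M : is_lattice v M -> exists2 P, P \in unitmx & M = lattice_of P.
Proof.
move=> [e [-> _ span]]; pose P : 'M[K]_2 := \matrix_(i, k) e k i 0.
have eP : forall k, e k = col k P by move=> k; apply/colP => i; rewrite !mxE.
have sumE (c : 'I_2 -> K) : \sum_i c i *: e i = P *m \col_i c i.
  by rewrite mulmx_cols; apply: eq_bigr => i _; rewrite mxE eP.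
have /choice[C CE] := fun k => span (col k 1%:M).
exists P.
  suff /mulmx1_unit[] : P *m (\matrix_(i, k) C k i) = 1%:M by [].
  apply/matrixP => i k; have := CE k; rewrite sumE => /colP/(_ i).
  by rewrite !mulmx2E !mxE => ->.
apply/seteqP; split=> [_ [c Oc ->]|_ [a Oa <-]].
  by exists (\col_i c i); [move=> i k; rewrite mxE|rewrite sumE].
exists (fun i => a i 0); first by move=> i; apply: Oa.
by rewrite sumE; congr (_ *m _); apply/colP => i; rewrite mxE.
Qed.

(** The characteristic polynomial of a matrix stabilising a lattice up to a
    scalar [c] is integral: comparing determinants, [c] is an integral unit. *)
Lemma bt_fixed_trace A (x : bt_vertex v) : bt_act A x = x -> O (\tr A).
Proof.
move=> fixA; have [M latM ex] := bt_classP x.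
have [P uP eM] := is_latticeP latM.
have : homothety_class M (mx_image A M).
  rewrite -ex -fixA; exists M => //; rewrite ex.
  exists 1; first by rewrite oner_neq0.
  by apply/seteqP; split=> [y My|_ [y My <-]]; [exists y|]; rewrite ?scale1r.
case=> c c0; rewrite eM => AM.
have eq_cols (C D : 'M[K]_2) : (forall k, col k C = col k D) -> C = D.
  by move=> h; apply/matrixP => i k; have /colP/(_ i) := h k; rewrite !mxE.
have mulmx_delta (b : 'I_2 -> 'cV[K]_2) k :
    (\matrix_(i, l) b l i 0) *m delta_mx k 0 = b k.
  by rewrite -colE; apply/colP => i; rewrite !mxE.
have int_delta k : integral_mx (delta_mx k 0 : 'cV[K]_2).
  move=> i l; rewrite mxE; case: (_ && _); first exact: (valring1 valO).
  exact: (valring0 valO).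
have mem_delta k : lattice_of P (P *m delta_mx k 0) by exists (delta_mx k 0).
have [B OB AP] : exists2 B : 'M[K]_2, integral_mx B & A *m P = c *: (P *m B).
  have /choice[b bP] : forall k, exists b : 'cV[K]_2,
      integral_mx b /\ A *m (P *m delta_mx k 0) = c *: (P *m b).
    move=> k; have : mx_image A (lattice_of P) (A *m (P *m delta_mx k 0)).
      by exists (P *m delta_mx k 0).
    by rewrite AM => -[_ [b Ob <-] <-]; exists b.
  exists (\matrix_(i, k) b k i 0); first by move=> i k; rewrite mxE; have [] := bP k.
  apply: eq_cols => k; have [_ h] := bP k.
  by rewrite [LHS]colE [RHS]colE -scalemxAl -!mulmxA mulmx_delta h.
have [D OD PD] : exists2 D : 'M[K]_2, integral_mx D & c *: P = A *m (P *m D).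
  have /choice[b bP] : forall k, exists b : 'cV[K]_2,
      integral_mx b /\ c *: (P *m delta_mx k 0) = A *m (P *m b).
    move=> k; have : [set c *: x | x in lattice_of P] (c *: (P *m delta_mx k 0)).
      by exists (P *m delta_mx k 0).
    by rewrite -AM => -[_ [b Ob <-] <-]; exists b.
  exists (\matrix_(i, k) b k i 0); first by move=> i k; rewrite mxE; have [] := bP k.
  apply: eq_cols => k; have [_ h] := bP k.
  by rewrite [LHS]colE [RHS]colE -scalemxAl -!mulmxA mulmx_delta h.
have detP : \det P != 0 by rewrite -unitfE -unitmxE.
have Oc2 : O (c ^+ 2).
  have : c ^+ 2 = \det D.
    apply: (mulfI detP); rewrite mulrC -detZ PD !det_mulmx.
    by rewrite (eqP (sl2_det A)) mul1r.
  move=> ->; rewrite det_mx2E; apply: (valringB valO); exact: (valringM valO).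
have Oc : O c.
  case: (valring_total valO c) => // Oc.
  have -> : c = c ^+ 2 * c^-1 by rewrite expr2 mulfK.
  exact: (valringM valO).
have -> : \tr A = c * \tr B.
  have -> : sl2_mx A = c *: (P *m B) *m invmx P by rewrite -AP mulmxK.
  by rewrite -scalemxAl mxtraceZ mxtrace_mulC mulmxA mulVmx // mul1mx.
apply: (valringM valO) => //; rewrite mxtrace2E; exact: (valringD valO).
Qed.

(** By Cayley-Hamilton, the inverse of a matrix of integral trace maps into
    itself every lattice that the matrix does; such a lattice is then fixed. *)
Lemma bt_stable_fixed A P : P \in unitmx -> O (\tr A) ->
  (exists2 B, integral_mx B & A *m P = P *m B) -> exists x : bt_vertex v, bt_act A x = x.
Proof.
move=> uP OtrA [B OB AP].
exists (BTVertex (ex_intro2 _ _ _ (lattice_of_is_lattice uP) erefl)).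
apply: bt_vertex_eq; rewrite /= mx_image_homothety ?sl2_unitmx //; congr homothety_class.
apply/seteqP; split=> [_ [_ [a Oa <-] <-]|_ [a Oa <-]].
  exists (B *m a); first exact: integral_mulmx.
  by rewrite !mulmxA AP.
have AVP : sl2_mx (A^-1)%g *m P = P *m ((\tr A)%:M - B).
  by rewrite sl2_invE mulmxBl mulmxBr AP scalar_mxC.
exists (sl2_mx (A^-1)%g *m (P *m a)).
  rewrite mulmxA AVP -mulmxA; exists (((\tr A)%:M - B) *m a) => //.
  apply: integral_mulmx => // i k; rewrite !mxE; apply: (valringB valO) => //.
  by case: (i == k); rewrite ?mulr1n // mulr0n; apply: (valring0 valO).
by rewrite mulmxA /= mulmxV ?sl2_unitmx // mul1mx.
Qed.

(** Unless the matrix is diagonal, a standard basis vector is cyclic and the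
    lattice that it generates with its image is stable. *)
Lemma bt_trace_fixed A : O (\tr A) -> exists x : bt_vertex v, bt_act A x = x.
Proof.
move=> OtrA; have detA := sl2_det2E A.
have companion : integral_mx (mx2 0 (-1) 1 (\tr A)).
  move=> i k; case: (ord2P i) => ->; case: (ord2P k) => ->; rewrite mx2E //.
  - exact: (valring0 valO).
  - exact/(valringN valO)/(valring1 valO).
  - exact: (valring1 valO).
have [c0|c0] := eqVneq (A 1 0) 0; last first.
  (* The first basis vector and its image. *)
  apply: (@bt_stable_fixed A (mx2 1 (A 0 0) 0 (A 1 0))) => //.
    by rewrite unitmxE det_mx2E !mx2E mul1r mulr0 subr0 unitfE.
  exists (mx2 0 (-1) 1 (\tr A)) => //; rewrite mxtrace2E.
  apply: mx2P; rewrite !mulmx2E !mx2E; try ring.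
  by apply: (addIr (-1)); rewrite -{2}detA; ring.
have [b0|b0] := eqVneq (A 0 1) 0; last first.
  (* The second basis vector and its image. *)
  apply: (@bt_stable_fixed A (mx2 0 (A 0 1) 1 (A 1 1))) => //.
    by rewrite unitmxE det_mx2E !mx2E mul0r mulr1 sub0r unitfE oppr_eq0.
  exists (mx2 0 (-1) 1 (\tr A)) => //; rewrite mxtrace2E.
  apply: mx2P; rewrite !mulmx2E !mx2E; try ring.
  by apply: (addIr (-1)); rewrite -{2}detA; ring.
apply: (@bt_stable_fixed A 1%:M) => //; first exact: unitmx1.
exists A; last by rewrite mulmx1 mul1mx.
have ad : A 0 0 * A 1 1 = 1 by rewrite -detA b0 mul0r subr0.
have a0 : A 0 0 != 0 by apply/eqP => a0; move/eqP: ad; rewrite a0 mul0r eq_sym oner_eq0.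
have da : A 1 1 = (A 0 0)^-1 by apply: (mulfI a0); rewrite ad mulfV.
have [Oa Od] : O (A 0 0) /\ O (A 1 1).
  rewrite mxtrace2E in OtrA.
  case: (valring_total valO (A 0 0)) => h; split=> //.
  - by rewrite -[A 1 1](addKr (A 0 0)) addrC; apply: (valringB valO).
  - by rewrite -[A 0 0](addrK (A 1 1)); apply: (valringB valO) => //; rewrite da.
  - by rewrite da.
by move=> i k; case: (ord2P i) => ->; case: (ord2P k) => ->; rewrite ?b0 ?c0 //;
  apply: (valring0 valO).
Qed.

End FixedVertices.

(** An element of nonintegral trace is a hyperbolic isometry, hence the name.
    Only the valuation ring occurs: the value group can be rebuilt from it. *)
Definition hyperbolic_rep (G : groupType) : Prop :=
  exists (K : fieldType) (O : set K) (j : {multiplicative G -> SL2 K}),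
    is_valring O /\ forall g, O (\tr (j g)) -> g = 1%g.

Lemma acts_freely_on_BTP (G : groupType) : acts_freely_on_BT G <-> hyperbolic_rep G.
Proof.
split=> [[L [K [v [j free]]]]|[K [R [j [valR hyp]]]]].
  exists K, (vring v), j; split=> [|g /bt_trace_fixed[x fixg]].
    exact: vring_is_valring.
  exact: (free g x).
exists (value_oag valR), K, (valring_valuation valR), j => g x /bt_fixed_trace.
by rewrite vring_valring_valuation; apply: hyp.
Qed.

(** * Ultraproducts of fields *)

Section Ultraproduct.
Variables (K_ : nat -> fieldType) (U : set_system nat).
Hypothesis ultraU : UltraFilter U.

Definition fseq : Type := forall r, K_ r.

Lemma fseq_ext (f g : fseq) : (forall r, f r = g r) -> f = g.
Proof. exact: functional_extensionality_dep. Qed.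

HB.instance Definition _ := gen_eqMixin fseq.
HB.instance Definition _ := gen_choiceMixin fseq.

Definition fseq_zero : fseq := fun=> 0.
Definition fseq_one : fseq := fun=> 1.
Definition fseq_opp (f : fseq) : fseq := fun r => - f r.
Definition fseq_add (f g : fseq) : fseq := fun r => f r + g r.
Definition fseq_mul (f g : fseq) : fseq := fun r => f r * g r.

Lemma fseq_addA : associative fseq_add.
Proof. by move=> f g h; apply: fseq_ext => r; apply: addrA. Qed.
Lemma fseq_addC : commutative fseq_add.
Proof. by move=> f g; apply: fseq_ext => r; apply: addrC. Qed.
Lemma fseq_add0 : left_id fseq_zero fseq_add.
Proof. by move=> f; apply: fseq_ext => r; apply: add0r. Qed.
Lemma fseq_addN : left_inverse fseq_zero fseq_opp fseq_add.
Proof. by move=> f; apply: fseq_ext => r; apply: addNr. Qed.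

HB.instance Definition _ :=
  GRing.isZmodule.Build fseq fseq_addA fseq_addC fseq_add0 fseq_addN.

Lemma fseq_mulA : associative fseq_mul.
Proof. by move=> f g h; apply: fseq_ext => r; apply: mulrA. Qed.
Lemma fseq_mulC : commutative fseq_mul.
Proof. by move=> f g; apply: fseq_ext => r; apply: mulrC. Qed.
Lemma fseq_mul1 : left_id fseq_one fseq_mul.
Proof. by move=> f; apply: fseq_ext => r; apply: mul1r. Qed.
Lemma fseq_mulDl : left_distributive fseq_mul fseq_add.
Proof. by move=> f g h; apply: fseq_ext => r; apply: mulrDl. Qed.
Lemma fseq_one_neq0 : fseq_one != fseq_zero.
Proof.
apply/eqP => /(congr1 (fun f : fseq => f 0%N)) /eqP.
by rewrite /fseq_one /fseq_zero oner_eq0.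
Qed.

HB.instance Definition _ := GRing.Zmodule_isComNzRing.Build fseq
  fseq_mulA fseq_mulC fseq_mul1 fseq_mulDl fseq_one_neq0.

(** The proof is an argument so that the ideal structure can be attached to
    the predicate. *)
Definition unull of UltraFilter U : pred fseq := fun f => `[< U [set r | f r = 0] >].
Local Notation I := (unull ultraU).

Lemma unullP f : reflect (U [set r | f r = 0]) (f \in I).
Proof. exact: asboolP. Qed.

Lemma unull_ideal : idealr_closed I.
Proof.
split.
- by apply/unullP; apply: filterS filterT.
- apply/unullP => /filter_ex[r /= /eqP].
  by rewrite oner_eq0.
- move=> a f g /unullP f0 /unullP g0; apply/unullP.
  apply: filterS2 f0 g0 => r /= fr gr.
  by rewrite [LHS](_ : _ = a r * f r + g r) // fr gr mulr0 addr0.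
Qed.

HB.instance Definition _ := isIdealr.Build fseq I unull_ideal.

Definition uideal : idealr fseq := Idealr.clone fseq I _.

Definition ufield : Type := {ideal_quot uideal}.
HB.instance Definition _ := GRing.ComNzRing.on ufield.

Definition ucls (f : fseq) : ufield := \pi_({ideal_quot uideal})%qT f.

Lemma ucls_eq f g : ucls f = ucls g <-> U [set r | f r = g r].
Proof.
rewrite (_ : [set r | f r = g r] = [set r | (f - g : fseq) r = 0]); last first.
  apply/seteqP; split=> r /= h; last exact: subr0_eq.
  by rewrite [LHS](_ : _ = f r - g r) // h subrr.
split=> [/eqP|h]; first by rewrite -Quotient.idealrBE => /unullP.
by apply/eqP; rewrite -Quotient.idealrBE; apply/unullP.
Qed.

Lemma uclsP (x : ufield) : exists f, x = ucls f.
Proof. by exists (repr x); rewrite /ucls reprK. Qed.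

Lemma uclsD f g : ucls (fseq_add f g) = ucls f + ucls g.
Proof. exact: (raddfD (\pi_({ideal_quot uideal})%qT)). Qed.

Lemma uclsN f : ucls (fseq_opp f) = - ucls f.
Proof. exact: (raddfN (\pi_({ideal_quot uideal})%qT)). Qed.

Lemma uclsM f g : ucls (fseq_mul f g) = ucls f * ucls g.
Proof. exact: (rmorphM (\pi_({ideal_quot uideal})%qT)). Qed.

Lemma ucls0 : ucls fseq_zero = 0.
Proof. exact: (raddf0 (\pi_({ideal_quot uideal})%qT)). Qed.

Lemma ucls1 : ucls fseq_one = 1.
Proof. exact: (rmorph1 (\pi_({ideal_quot uideal})%qT)). Qed.

Definition uinv (x : ufield) : ufield := ucls (fun r => (repr x r)^-1).

Lemma umulVf (x : ufield) : x != 0 -> uinv x * x = 1.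
Proof.
move=> x0; have xE : ucls (repr x) = x by rewrite /ucls reprK.
rewrite -{2}xE /uinv -uclsM -ucls1; apply/ucls_eq.
have [h|h] := in_ultra_setVsetC [set r | repr x r = 0] ultraU.
  by move: x0; rewrite -xE -ucls0; case/eqP; apply/ucls_eq.
by apply: filterS h => r /= /eqP xr; rewrite /fseq_mul mulVf.
Qed.

Lemma uinv0 : uinv 0 = 0.
Proof.
rewrite /uinv -[RHS]ucls0; apply/ucls_eq.
have /ucls_eq h : ucls (repr (0 : ufield)) = ucls fseq_zero by rewrite ucls0 /ucls reprK.
by apply: filterS h => r /= ->; apply: invr0.
Qed.

HB.instance Definition _ := GRing.ComNzRing_isField.Build ufield umulVf uinv0.

Variable O_ : forall r, set (K_ r).
Hypothesis valO_ : forall r, is_valring (@O_ r).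

Definition uvalring : set ufield := [set x | U [set r | O_ (repr x r)]].

Lemma uvalringP f : uvalring (ucls f) <-> U [set r | O_ (f r)].
Proof.
have /ucls_eq h : ucls (repr (ucls f)) = ucls f by rewrite /ucls reprK.
split=> h'; first by apply: filterS2 h h' => r /= ->.
by rewrite /uvalring /=; apply: filterS2 h h' => r /= ->.
Qed.

(** The alternative between an element and its inverse comes from the
    alternative between a set of indices and its complement. *)
Lemma uvalring_is_valring : is_valring uvalring.
Proof.
split.
- rewrite -ucls1; apply/uvalringP; apply: filterS filterT => r _.
  exact: valring1 (valO_ r).
- move=> x y; have [f ->] := uclsP x; have [g ->] := uclsP y.
  move=> /uvalringP Of /uvalringP Og; rewrite -uclsN -uclsD; apply/uvalringP.
  by apply: filterS2 Of Og => r Ofr Ogr; exact: (valringB (valO_ r) Ofr Ogr).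
- move=> x y; have [f ->] := uclsP x; have [g ->] := uclsP y.
  move=> /uvalringP Of /uvalringP Og; rewrite -uclsM; apply/uvalringP.
  by apply: filterS2 Of Og => r Ofr Ogr; exact: (valringM (valO_ r) Ofr Ogr).
- move=> x; have [h|h] := in_ultra_setVsetC [set r | O_ (repr x r)] ultraU; [by left|right].
  have -> : x^-1 = ucls (fun r => (repr x r)^-1) by [].
  apply/uvalringP; apply: filterS h => r /= nO.
  by case: (valring_total (valO_ r) (repr x r)).
Qed.

Section Representation.
Variables (G : groupType) (rho_ : forall r, {multiplicative G -> SL2 (K_ r)}).

Definition urho_mx (u : G) : 'M[ufield]_2 := \matrix_(i, k) ucls (fun r => rho_ r u i k).

Lemma urho_det u : \det (urho_mx u) == 1.
Proof.
rewrite det_mx2E !mxE -!uclsM -uclsN -uclsD -ucls1; apply/eqP/ucls_eq.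
by apply: filterS filterT => r _; apply: sl2_det2E.
Qed.

Definition urho (u : G) : SL2 ufield := MkSL2 (urho_det u).

Lemma urhoM : {morph urho : u v / (u * v)%g}.
Proof.
move=> u v; apply: val_inj; apply/matrixP => i k.
rewrite [RHS]mulmx2E !mxE -!uclsM -uclsD; congr ucls.
by apply: fseq_ext => r; rewrite gmulfM [LHS]mulmx2E.
Qed.

HB.instance Definition _ := isMultiplicative.Build G (SL2 ufield) urho urhoM.

Lemma urho_trace u : uvalring (\tr (urho u)) <-> U [set r | O_ (\tr (rho_ r u))].
Proof.
rewrite mxtrace2E !mxE -uclsD uvalringP.
by under eq_set => r do rewrite /fseq_add -mxtrace2E.
Qed.

Lemma urho_eq1 u : U [set r | rho_ r u = 1%g] -> urho u = 1%g.
Proof.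
move=> h; apply: val_inj; apply/matrixP => i k; rewrite !mxE.
have -> : (i == k)%:R = ucls (fun r => (i == k)%:R).
  by case: (i == k); [exact: esym ucls1|exact: esym ucls0].
by apply/ucls_eq; apply: filterS h => r /= ->; rewrite /= mxE.
Qed.

End Representation.

End Ultraproduct.

(** * Marked groups *)

Section Marked.
Variable n : nat.
Implicit Types (G : marked_group n) (x : mgspace n) (u : free_group n).

Lemma marked_factor G (H : groupType) (rho : {multiplicative free_group n -> H}) :
  (forall u, relations G u -> rho u = 1%g) ->
  exists j : {multiplicative G -> H}, forall u, j (fg_eval (@mg_family n G) u) = rho u.
Proof.
move=> rel1; have /choice[word wordE] := @mg_generate n G.
have rho_eq u v : fg_eval (@mg_family n G) u = fg_eval (@mg_family n G) v -> rho u = rho v.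
  move=> e; have /rel1 : relations G (u * v^-1)%g.
    by rewrite /relations /= fg_eval_morph (multiplicativeV (fg_eval _)) /= e mulgV.
  by rewrite gmulfM multiplicativeV => /divg1_eq.
pose jf g := rho (word g).
have jM : {morph jf : g h / (g * h)%g}.
  by move=> g h; rewrite /jf -gmulfM; apply: rho_eq; rewrite fg_eval_morph !wordE.
pose j : {multiplicative G -> H} := HB.pack jf (isMultiplicative.Build G H jf jM).
by exists j => u; apply: rho_eq; rewrite wordE.
Qed.

Lemma multiplicative_comp_fg_eval G (H : groupType) (j : {multiplicative G -> H}) :
  {morph (fun u => j (fg_eval (@mg_family n G) u)) : u v / (u * v)%g}.
Proof. by move=> u v; rewrite fg_eval_morph gmulfM. Qed.

(** Being a condition on the set of relations alone, this form of membership
    in [BT] passes to limits. *)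
Definition hyperbolic_mark (rel : set (free_group n)) : Prop :=
  exists (K : fieldType) (O : set K) (rho : {multiplicative free_group n -> SL2 K}),
  [/\ is_valring O, forall u, rel u -> rho u = 1%g & forall u, O (\tr (rho u)) -> rel u].

Lemma hyperbolic_mark_rep G : hyperbolic_mark (relations G) -> hyperbolic_rep G.
Proof.
move=> [K [R [rho [valR rel1 hyp]]]]; have [j jE] := marked_factor rel1.
exists K, R, j; split=> // g; have [u <-] := mg_generate g.
by rewrite jE => /hyp.
Qed.

Lemma mgspace_eq (x y : mgspace n) : mg_rel x = mg_rel y -> x = y.
Proof.
case: x y => [R PR] [S PS] /= e; case: _ / e PS => PS.
by congr MgSpace; apply: Prop_irrelevance.
Qed.

Lemma BTP x : BT n x <-> hyperbolic_mark (mg_rel x).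
Proof.
split=> [[G <- /acts_freely_on_BTP[K [R [j [valR hyp]]]]]|].
  pose rho : {multiplicative free_group n -> SL2 K} := HB.pack
    (fun u => j (fg_eval (@mg_family n G) u))
    (isMultiplicative.Build (free_group n) (SL2 K) _ (multiplicative_comp_fg_eval j)).
  exists K, R, rho; split=> // [u|u /hyp//].
  by rewrite /= /relations /rho /= => ->; apply: multiplicative1.
have [G eG] := mg_relP x; rewrite -eG => /hyperbolic_mark_rep hypG.
exists G; last exact/acts_freely_on_BTP.
exact: mgspace_eq.
Qed.

Lemma BT_hyperbolic_rep G : BT n (mg_class G) -> hyperbolic_rep G.
Proof. by move=> /BTP/hyperbolic_mark_rep. Qed.

(** A limit of members of [BT] is realised in an ultraproduct of their fields:
    on each element of the free group, the conditions defining [BT] hold for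
    all but finitely many terms of a sequence converging to the limit. *)
Theorem BT_closed : closed (BT n).
Proof.
move=> x clx.
have /choice[y yP] : forall r : nat, exists y, BT n y /\
    forall u, (size (fg_word u) <= r.+1)%N -> mg_rel y u <-> mg_rel x u.
  move=> r; have [y [BTy yx]] : BT n `&` mg_nbhd r.+1 x !=set0.
    by apply: clx; exists r.+1.
  by exists y.
have hyp r : hyperbolic_mark (mg_rel (y r)) by have [/BTP] := yP r.
pose K_ r := projT1 (cid (hyp r)); have hK r := projT2 (cid (hyp r)).
pose O_ r : set (K_ r) := projT1 (cid (hK r)); have hO r := projT2 (cid (hK r)).
pose rho_ r : {multiplicative free_group n -> SL2 (K_ r)} := projT1 (cid (hO r)).
have rhoP r : [/\ is_valring (O_ r), forall u, mg_rel (y r) u -> rho_ r u = 1%g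
    & forall u, O_ r (\tr (rho_ r u)) -> mg_rel (y r) u] := projT2 (cid (hO r)).
have valO_ r : is_valring (O_ r) by have [] := rhoP r.
have [U [ultraU Uoo]] := ultraFilterLemma eventually_filter.
have near_rel u : U [set r | mg_rel (y r) u <-> mg_rel x u].
  have : U [set r | (size (fg_word u) <= r)%N] by apply: Uoo; apply: nbhs_infty_ge.
  by apply: filterS => r /= ur; have [_] := yP r; apply; apply: leqW.
apply/BTP; exists (ufield K_ ultraU), (uvalring O_), (urho ultraU rho_).
split; first exact: uvalring_is_valring.
- move=> u xu; apply: urho_eq1; apply: filterS (near_rel u) => r [_ /(_ xu) yu].
  by have [_ rel1 _] := rhoP r; apply: rel1.
- move=> u /urho_trace Otr.
  have [r [Or [yx _]]] := filter_ex (filterI Otr (near_rel u)).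
  by apply: yx; have [_ _ hypr] := rhoP r; apply: hypr.
Qed.

End Marked.

(** * Integral spans of monomials *)

(** The additive subgroup generated by [E]. *)
Inductive zspan (V : zmodType) (E : seq V) : V -> Prop :=
| zspan_zero : zspan E 0
| zspan_add e y : e \in E -> zspan E y -> zspan E (y + e)
| zspan_sub e y : e \in E -> zspan E y -> zspan E (y - e).

Section Zspan.
Variable V : zmodType.
Implicit Types (E F : seq V) (x y e : V).

Lemma zspan_mem E e : e \in E -> zspan E e.
Proof. by move=> eE; rewrite -[e]add0r; apply: zspan_add => //; apply: zspan_zero. Qed.

Lemma zspanD E x y : zspan E x -> zspan E y -> zspan E (x + y).
Proof.
move=> Ex; elim=> [|e z eE _ IH|e z eE _ IH]; rewrite ?addr0 // addrA.
  exact: zspan_add.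
exact: zspan_sub.
Qed.

Lemma zspanN E x : zspan E x -> zspan E (- x).
Proof.
elim=> [|e z eE _ IH|e z eE _ IH]; first by rewrite oppr0; apply: zspan_zero.
  by rewrite opprD; apply: zspan_sub.
by rewrite opprB addrC; apply: zspan_add.
Qed.

Lemma zspanMz E x (n : int) : zspan E x -> zspan E (x *~ n).
Proof.
have zspanMn k : zspan E x -> zspan E (x *+ k).
  move=> Ex; elim: k => [|k IH]; first exact: zspan_zero.
  by rewrite mulrS; apply: zspanD.
by case: n => k Ex; rewrite ?NegzE ?mulrNz -pmulrn; [|apply: zspanN]; apply: zspanMn.
Qed.

Lemma zspan_cons e E x : zspan (e :: E) x -> exists n : int, zspan E (x - e *~ n).
Proof.
elim=> [|f z|f z]; first by exists 0; rewrite mulr0z subr0; apply: zspan_zero.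
- rewrite inE => /predU1P[->|fE] _ [n IH].
    by exists (n + 1); rewrite mulrzDr mulr1z opprD addrA addrAC addrK.
  by exists n; rewrite addrAC; apply: zspan_add.
- rewrite inE => /predU1P[->|fE] _ [n IH].
    by exists (n - 1); rewrite mulrzBr mulr1z opprB addrA subrK.
  by exists n; rewrite addrAC; apply: zspan_sub.
Qed.

End Zspan.

Lemma zspanM (K : nzRingType) (E F G : seq K) x y :
  (forall e f, e \in E -> f \in F -> e * f \in G) ->
  zspan E x -> zspan F y -> zspan G (x * y).
Proof.
move=> EFG Ex; elim=> [|f z fF _ IH|f z fF _ IH].
- by rewrite mulr0; apply: zspan_zero.
- rewrite mulrDr; apply: zspanD => //; elim: Ex => [|e t eE _ IH'|e t eE _ IH'].
  + by rewrite mul0r; apply: zspan_zero.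
  + by rewrite mulrDl; apply: zspanD => //; apply/zspan_mem/EFG.
  + by rewrite mulrBl; apply: zspanD => //; apply/zspanN/zspan_mem/EFG.
- rewrite mulrBr; apply: zspanD => //; apply: zspanN.
  elim: Ex => [|e t eE _ IH'|e t eE _ IH'].
  + by rewrite mul0r; apply: zspan_zero.
  + by rewrite mulrDl; apply: zspanD => //; apply/zspan_mem/EFG.
  + by rewrite mulrBl; apply: zspanD => //; apply/zspanN/zspan_mem/EFG.
Qed.

(** Fraction-free Gaussian elimination. Integral coefficients give a treatment
    independent of the characteristic; in return, the nontriviality of the
    relation has to be read in the field. *)
Lemma zspan_dependent (K : fieldType) m (E : seq K) (y : 'I_m.+1 -> K) :
  size E = m -> (forall i, zspan E (y i)) ->
  exists c : 'I_m.+1 -> int,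
    \sum_i y i *~ c i = 0 /\ exists i, (c i)%:~R != 0 :> K.
Proof.
elim: E m y => [|e E IH] [|m] //= y sE Ey.
  exists (fun => 1); split; last by exists 0; rewrite oner_neq0.
  rewrite big_ord_recl big_ord0 addr0 mulr1z.
  by case: (Ey 0).
case: sE => sE.
have /choice[n En] i := zspan_cons (Ey i).
have [[k nk]|n0] := pselect (exists k, (n k)%:~R != 0 :> K).
  pose z i := y (lift k i) *~ n k - y k *~ n (lift k i).
  have /(IH _ _ sE)[c [c0 [i0 ci0]]] : forall i, zspan E (z i).
    move=> i; rewrite /z.
    have -> : y (lift k i) *~ n k - y k *~ n (lift k i) =
        (y (lift k i) - e *~ n (lift k i)) *~ n k - (y k - e *~ n k) *~ n (lift k i).
      by rewrite !mulrzBl -!mulrzA [n k * _]mulrC opprB addrA subrK.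
    by apply: zspanD; [|apply: zspanN]; apply: zspanMz.
  exists (fun j => if unlift k j is Some i then c i * n k
                   else - \sum_i c i * n (lift k i)); split.
    rewrite (bigD1_ord k) //= unlift_none -[RHS]c0.
    rewrite (eq_bigr (fun i => y (lift k i) *~ (c i * n k))); last first.
      by move=> i _; rewrite liftK.
    have -> : \sum_i z i *~ c i =
        \sum_i (y (lift k i) *~ (c i * n k) - y k *~ (c i * n (lift k i))).
      apply: eq_bigr => i _; rewrite /z mulrzBl -!mulrzA.
      by rewrite [n k * _]mulrC [n _ * _]mulrC.
    by rewrite sumrB mulrNz mulrz_sumr addrC.
  by exists (lift k i0); rewrite liftK rmorphM mulf_neq0.
have {}n0 i : (n i)%:~R = 0 :> K.
  by apply/eqP; apply: contrapT => nk; apply: n0; exists i; apply/negP.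
have /(IH _ _ sE)[c [c0 [i0 ci0]]] : forall i, zspan E (y (lift ord0 i)).
  by move=> i; have := En (lift ord0 i); rewrite -mulrzr n0 mulr0 subr0.
exists (fun j => if unlift ord0 j is Some i then c i else 0); split.
  rewrite (bigD1_ord ord0) //= unlift_none mulr0z add0r -[RHS]c0.
  by apply: eq_bigr => i _; rewrite liftK.
by exists (lift ord0 i0); rewrite liftK.
Qed.

Lemma zspan_dependent_fin (K : fieldType) (E : seq K) (I : finType) (y : I -> K) :
  (size E < #|I|)%N -> (forall i, zspan E (y i)) ->
  exists c : I -> int, \sum_i y i *~ c i = 0 /\ exists i, (c i)%:~R != 0 :> K.
Proof.
move=> EI Ey; have h0 : {h : 'I_(size E).+1 -> I | injective h}.
  exists (fun k => enum_val (widen_ord EI k)).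
  by move=> k l /enum_val_inj/(congr1 val)/= /val_inj.
case: h0 => h h_inj.
have [c [c0 [k0 ck0]]] := @zspan_dependent K _ E (y \o h) erefl (fun k => Ey (h k)).
pose c' i := if [pick k | h k == i] is Some k then c k else 0.
have c'h k : c' (h k) = c k.
  rewrite /c'; case: pickP => [l /eqP/h_inj->//|/(_ k)]; by rewrite eqxx.
exists c'; split; last by exists (h k0); rewrite c'h.
rewrite (bigID (mem (h @: 'I_(size E).+1))) /= [X in _ + X]big1 ?addr0 => [|i nh].
  rewrite big_imset /=; last by move=> k l _ _; apply: h_inj.
  by rewrite -[RHS]c0; apply: eq_big => // k _; rewrite c'h.
rewrite /c'; case: pickP => [l /eqP hl|_]; last by rewrite mulr0z.
by move: nh; rewrite -hl imset_f // inE.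
Qed.

Section Monomials.
Variable K : fieldType.
Implicit Types (xs : seq K) (x y e f : K) (D : nat).

Fixpoint monos xs D : seq K :=
  if xs is x :: xs' then [seq x ^+ i * e | i <- iota 0 D.+1, e <- monos xs' D]
  else [:: 1].

Lemma size_monos xs D : size (monos xs D) = (D.+1 ^ size xs)%N.
Proof. by elim: xs => // x xs IH; rewrite size_allpairs size_iota IH expnS. Qed.

Lemma monosP x xs D e : reflect
  (exists i f, [/\ (i <= D)%N, f \in monos xs D & e = x ^+ i * f])
  (e \in monos (x :: xs) D).
Proof.
apply: (iffP allpairsP) => [[[i f] [iD fm ->]]|[i [f [iD fm ->]]]].
  by exists i, f; split=> //; move: iD; rewrite mem_iota.
by exists (i, f); split=> //; rewrite mem_iota.
Qed.

Lemma monosM xs D D' e f :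
  e \in monos xs D -> f \in monos xs D' -> e * f \in monos xs (D + D').
Proof.
elim: xs e f => [|x xs IH] e f; first by rewrite !inE => /eqP-> /eqP->; rewrite mulr1.
move=> /monosP[i [e' [iD e'm ->]]] /monosP[j [f' [jD f'm ->]]].
apply/monosP; exists (i + j)%N, (e' * f'); split; first exact: leq_add.
  exact: IH.
by rewrite mulrACA exprD.
Qed.

Lemma monos1 xs D : 1 \in monos xs D.
Proof.
elim: xs => [|x xs IH]; first by rewrite inE.
by apply/monosP; exists 0%N, 1; rewrite mul1r.
Qed.

Lemma mem_monos xs x : x \in xs -> x \in monos xs 1.
Proof.
elim: xs => // y xs IH; rewrite inE => /predU1P[->|/IH xm].
  by apply/monosP; exists 1%N, 1; rewrite monos1 mulr1.
by apply/monosP; exists 0%N, x; rewrite mul1r.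
Qed.

(** Polynomial expressions in [xs] with integral coefficients and degree at
    most [D] in each variable. *)
Definition polyval xs D y := zspan (monos xs D) y.

Lemma polyvalM xs D D' x y :
  polyval xs D x -> polyval xs D' y -> polyval xs (D + D') (x * y).
Proof. by apply: zspanM => e f; apply: monosM. Qed.

Lemma polyval1 xs D : polyval xs D 1.
Proof. exact/zspan_mem/monos1. Qed.

Lemma polyvalX xs D y k : polyval xs D y -> polyval xs (k * D) (y ^+ k).
Proof.
move=> yD; elim: k => [|k IH]; first exact: polyval1.
by rewrite exprS mulSn; apply: polyvalM.
Qed.

Lemma polyval_prod xs (I : finType) (D : I -> nat) (F : I -> K) :
  (forall i, polyval xs (D i) (F i)) -> polyval xs (\sum_i D i) (\prod_i F i).
Proof.
move=> FD; elim/big_rec2: _ => [|i y d _]; first exact: polyval1.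
exact: polyvalM.
Qed.

(** Membership in the subfield generated by [xs]. *)
Definition gen_frac xs y : Prop := exists D P Q,
  [/\ polyval xs D P, polyval xs D Q, Q != 0 & y = P / Q].

Lemma polyval_gen_frac xs D y : polyval xs D y -> gen_frac xs y.
Proof.
by move=> yD; exists D, y, 1; rewrite divr1 oner_neq0; split=> //; apply: polyval1.
Qed.

Lemma gen_frac_mem xs x : x \in xs -> gen_frac xs x.
Proof. by move=> /mem_monos/zspan_mem/polyval_gen_frac. Qed.

Lemma gen_frac1 xs : gen_frac xs 1.
Proof. exact: (polyval_gen_frac (polyval1 xs 0)). Qed.

Lemma gen_fracB xs x y : gen_frac xs x -> gen_frac xs y -> gen_frac xs (x - y).
Proof.
move=> [D [P [Q [PD QD Q0 ->]]]] [D' [P' [Q' [PD' QD' Q0' ->]]]].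
exists (D + D')%N, (P * Q' - P' * Q), (Q * Q'); split.
- apply: zspanD; first exact: polyvalM.
  by apply: zspanN; rewrite addnC; apply: polyvalM.
- exact: polyvalM.
- by rewrite mulf_neq0.
- by field; rewrite Q0 Q0'.
Qed.

Lemma gen_frac0 xs : gen_frac xs 0.
Proof. by have := gen_fracB (gen_frac1 xs) (gen_frac1 xs); rewrite subrr. Qed.

Lemma gen_fracD xs x y : gen_frac xs x -> gen_frac xs y -> gen_frac xs (x + y).
Proof.
move=> gx gy; have -> : x + y = x - (0 - y) by rewrite sub0r opprK.
apply: gen_fracB => //.
by apply: gen_fracB => //; apply: gen_frac0.
Qed.

Lemma gen_fracM xs x y : gen_frac xs x -> gen_frac xs y -> gen_frac xs (x * y).
Proof.
move=> [D [P [Q [PD QD Q0 ->]]]] [D' [P' [Q' [PD' QD' Q0' ->]]]].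
exists (D + D')%N, (P * P'), (Q * Q'); split; try exact: polyvalM.
- by rewrite mulf_neq0.
- by field; rewrite Q0 Q0'.
Qed.

Lemma gen_fracV xs x : gen_frac xs x -> gen_frac xs x^-1.
Proof.
move=> [D [P [Q [PD QD Q0 ->]]]]; have [->|P0] := eqVneq P 0.
  by rewrite mul0r invr0 -(subrr 1); apply: gen_fracB; apply: gen_frac1.
by exists D, Q, P; split=> //; rewrite invf_div.
Qed.

Lemma common_denominator xs (I : finType) (z : I -> K) : (forall i, gen_frac xs (z i)) ->
  exists D P Q, [/\ forall i, polyval xs D (P i), polyval xs D Q, Q != 0
                 & forall i, z i = P i / Q].
Proof.
move=> /choice[D /choice[P /choice[Q PQ]]].
exists (\sum_i D i)%N, (fun i => P i * \prod_(k | k != i) Q k), (\prod_i Q i).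
have rest i : \prod_i Q i = Q i * \prod_(k | k != i) Q k by rewrite (bigD1 i).
have Q0 : \prod_i Q i != 0 by apply/prodf_neq0 => i _; have [] := PQ i.
split=> //.
- move=> i; rewrite (bigD1 i) //=; have [PD _ _ _] := PQ i; apply: polyvalM => //.
  elim/big_rec2: _ => [|k y d _]; first exact: polyval1.
  by apply: polyvalM; have [] := PQ k.
- by apply: polyval_prod => i; have [] := PQ i.
- move=> i; have [_ _ _ ->] := PQ i; move: Q0; rewrite (rest i) mulf_eq0 negb_or.
  by case/andP=> Qi Qr; field; rewrite Qi Qr.
Qed.

(** Counting: the monomials of degree less than [N] in the [z i] are more
    numerous than the dimension of the space in which they lie, once
    multiplied by a common denominator. *)
Lemma gen_frac_dependent xs (z : 'I_(size xs).+1 -> K) : (forall i, gen_frac xs (z i)) ->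
  exists N (c : {ffun 'I_(size xs).+1 -> 'I_N} -> int),
    \sum_(a : {ffun 'I_(size xs).+1 -> 'I_N}) (\prod_i z i ^+ a i) *~ c a = 0
    /\ exists a, (c a)%:~R != 0 :> K.
Proof.
move=> /common_denominator[D [P [Q [PD QD Q0 zPQ]]]].
(* There are N ^ (m + 1) monomials, in a space of dimension at most (N C) ^ m. *)
set m := size xs; pose C := (m.+1 * D).+1; pose N := (C ^ m).+1.
pose S := (m.+1 * (N * D))%N.
pose t (a : {ffun 'I_m.+1 -> 'I_N}) := \prod_i (P i ^+ a i * Q ^+ (N - a i)).
have tS a : polyval xs S (t a).
  have -> : S = (\sum_(i < m.+1) (a i * D + (N - a i) * D))%N.
    under eq_bigr => i _ do rewrite -mulnDl subnKC ?(ltnW (ltn_ord _)) //.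
    by rewrite sum_nat_const card_ord.
  by apply: polyval_prod => i; apply: polyvalM; apply: polyvalX.
have tE a : t a = Q ^+ (N * m.+1) * \prod_i z i ^+ a i.
  have -> : Q ^+ (N * m.+1) = \prod_(i < m.+1) Q ^+ N.
    by rewrite prodr_const card_ord exprM.
  rewrite -big_split /=; apply: eq_bigr => i _; rewrite zPQ expr_div_n.
  have aN : (a i <= N)%N by apply: ltnW.
  have -> : Q ^+ N = Q ^+ a i * Q ^+ (N - a i) by rewrite -exprD subnKC.
  by field; rewrite expf_neq0.
have [|c [c0 cn]] := @zspan_dependent_fin K (monos xs S) _ t _ tS.
  rewrite size_monos card_ffun !card_ord -/m.
  have SC : (S.+1 <= N * C)%N.
    rewrite /S /C mulnCA mulnS addnC -[X in (X < _)%N]addn0 ltn_add2l.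
    by rewrite /N.
  apply: (@leq_ltn_trans ((N * C) ^ m)); first by case: (m) => // k; rewrite leq_exp2r.
  by rewrite expnMn expnSr ltn_pmul2l // expn_gt0.
exists N, c; split=> //; apply/eqP.
have := c0; under eq_bigr => a _ do rewrite tE -mulrzr -mulrA mulrzr.
rewrite -mulr_sumr => /eqP; rewrite mulf_eq0 expf_eq0 (negPf Q0) andbF /=.
by [].
Qed.

End Monomials.

(** * Rational rank of the value group of a finitely generated field *)

Definition rat_spanning (L : zmodType) r (e : 'I_r -> L) : Prop :=
  forall x, exists (n : int) (c : 'I_r -> int), n != 0 /\ x *~ n = \sum_i e i *~ c i.

Definition rat_free (L : zmodType) r (e : 'I_r -> L) : Prop :=
  forall c : 'I_r -> int, \sum_i e i *~ c i = 0 -> forall i, c i = 0.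

(** A spanning family of minimal size is free, since a relation would allow
    one of its members to be eliminated. *)
Lemma rat_basis_ex (L : zmodType) r (e : 'I_r -> L) : rat_spanning e ->
  exists r' (e' : 'I_r' -> L), [/\ (r' <= r)%N, rat_spanning e' & rat_free e'].
Proof.
move=> span_e.
have ex : exists r', `[< exists e' : 'I_r' -> L, rat_spanning e' >].
  by exists r; apply/asboolP; exists e.
case: (ex_minnP ex) => r' /asboolP[e' span_e'] minr'.
exists r', e'; split=> //; first by apply: minr'; apply/asboolP; exists e.
move=> c c0 k; apply/eqP; apply: contrapT => /negP ck.
case: r' => [|r'] in e' span_e' minr' c c0 k ck *; first by case: k {ck}.
suff : (r'.+1 <= r')%N by rewrite ltnn.
apply: minr'; apply/asboolP; exists (fun i => e' (lift k i)) => x.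
have [n [a [n0 xn]]] := span_e' x.
exists (n * c k), (fun i => a (lift k i) * c k - c (lift k i) * a k).
split; first by rewrite mulf_neq0.
rewrite (bigD1_ord k) //= in c0; rewrite mulrzA xn (bigD1_ord k) //=.
have ek : e' k *~ c k = - \sum_i e' (lift k i) *~ c (lift k i).
  by apply/eqP; rewrite -addr_eq0 c0.
rewrite mulrzDl -mulrzA [a k * _]mulrC mulrzA ek mulNrz !mulrz_suml addrC -sumrB.
by apply: eq_bigr => i _; rewrite mulrzBr !mulrzA.
Qed.

Section Values.
Variables (K : fieldType) (L : orderedAbGroup) (w : prevaluation K L).
Implicit Types (x y z : K) (a b : L).

Lemma pvalD_lt x y a b : w x = Some a -> w y = Some b -> a < b -> w (x + y) = Some a.
Proof.
move=> ex ey ab.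
have va : vle w a (x + y).
  by apply: vleD; rewrite ?(vle_val _ ex) ?(vle_val _ ey) // ltW.
have up c : a < c -> ~~ vle w c (x + y).
  move=> ac; apply/negP => vc.
  have [c' [ac' c'c c'b]] : exists c', [/\ a < c', c' <= c & c' <= b].
    by case: (oag_le_or c b) => [cb|/ltW bc]; [exists c|exists b].
  have : vle w c' (x + y - y) by apply: vleB; [apply: vleW vc|rewrite (vle_val _ ey)].
  by rewrite addrK (vle_val _ ex) => /(lt_le_trans ac'); rewrite ltxx.
move: va; rewrite /vle; case e: (w (x + y)) => [c|] /= h; last first.
  by have := up b ab; rewrite /vle e.
move: h; rewrite le_eqVlt => /predU1P[->//|ac].
by have := up c ac; rewrite /vle e /= lexx.
Qed.

Lemma pvalD_neq x y : x != 0 -> y != 0 -> w x <> w y ->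
  w (x + y) = w x \/ w (x + y) = w y.
Proof.
move=> /(pvalP w)[a ea] /(pvalP w)[b eb]; rewrite ea eb => ab.
case: (oag_le_or a b) => [|ba]; last by right; rewrite addrC; apply: pvalD_lt eb ea ba.
rewrite le_eqVlt => /predU1P[e|lt]; first by case: ab; rewrite e.
by left; apply: pvalD_lt ea eb lt.
Qed.

Lemma val_sum_distinct (I : eqType) (s : seq I) (i0 : I) (F : I -> K) :
  uniq (i0 :: s) -> {in i0 :: s, forall i, F i != 0} ->
  {in i0 :: s &, forall i j, w (F i) = w (F j) -> i = j} ->
  exists2 i, i \in i0 :: s & w (\sum_(i <- i0 :: s) F i) = w (F i).
Proof.
move=> us F0; elim: s i0 us F0 => [|k s IH] i0 us F0 inj.
  by exists i0; rewrite ?mem_head // big_seq1.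
have [|||i ik ei] := IH k.
- by case/andP: us.
- by move=> i ii; apply: F0; rewrite inE ii orbT.
- by move=> i j ii jj; apply: inj; rewrite inE ?ii ?jj orbT.
have i0i : i0 != i by apply: contraTneq us => ->; rewrite cons_uniq ik.
rewrite big_cons.
have S0 : \sum_(j <- k :: s) F j != 0.
  have [|a ea] := @pvalP _ _ w (F i); first by apply: F0; rewrite inE ik orbT.
  by apply/eqP => S0; move: ei; rewrite S0 pval0 ea.
have [|->|->] := @pvalD_neq (F i0) _ (F0 _ (mem_head _ _)) S0.
- rewrite ei => /inj e; move: i0i; rewrite e ?eqxx //; first exact: mem_head.
  by rewrite inE ik orbT.
- by exists i0; rewrite ?mem_head.
- by exists i; rewrite // inE ik orbT.
Qed.

(** Otherwise the nonzero term of least value would dominate the sum. *)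
Lemma val_sum_collision (I : finType) (F : I -> K) i0 :
  \sum_i F i = 0 -> F i0 != 0 ->
  exists i j, [/\ i != j, F i != 0, F j != 0 & w (F i) = w (F j)].
Proof.
move=> S0 Fi0; apply: contrapT => none.
pose r := [seq i <- enum I | F i != 0].
have i0r : i0 \in r by rewrite mem_filter Fi0 mem_enum.
have memr i : i \in i0 :: rem i0 r -> F i != 0.
  by rewrite -(perm_mem (perm_to_rem i0r)) mem_filter => /andP[].
have [|||i ir] := @val_sum_distinct _ (rem i0 r) i0 F.
- by rewrite -(perm_uniq (perm_to_rem i0r)) filter_uniq ?enum_uniq.
- exact: memr.
- move=> i j /memr Fi /memr Fj eij; apply/eqP; apply: contrapT => /negP nij.
  by apply: none; exists i, j.
have [a ->] := pvalP w (memr i ir).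
rewrite -(perm_big _ (perm_to_rem i0r)) big_filter big_enum_cond /=.
suff -> : \sum_(i | F i != 0) F i = 0 by rewrite pval0.
rewrite -[RHS]S0 [RHS](bigID (fun i => F i != 0)) /=.
by rewrite [X in _ = _ + X]big1 ?addr0 // => j /negbNE/eqP.
Qed.

(** The generator is the value of the least natural number [p] of positive
    finite value, if there is one: the remainder of a number of positive value
    in the division by [p] is smaller than [p], hence vanishes in the field.
    This covers every characteristic. *)
Lemma val_intr_cyclic : exists g : L, forall c : int, c%:~R != 0 :> K ->
  exists k : int, w c%:~R = Some (g *~ k).
Proof.
have nat_enough g : (forall n : nat, n%:R != 0 :> K -> exists k : int, w n%:R = Some (g *~ k)) ->
    forall c : int, c%:~R != 0 :> K -> exists k : int, w c%:~R = Some (g *~ k).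
  move=> h [n|n] /=; first by rewrite -pmulrn; apply: h.
  by rewrite NegzE rmorphN /= -pmulrn oppr_eq0 pvalN; apply: h.
have int_ge0 n : vle w 0 n%:R.
  elim: n => [|n IH]; first exact: vle0.
  by rewrite -addn1 natrD; apply: vleD => //; rewrite (vle_val _ (pval1 w)).
have int_val n : n%:R != 0 :> K -> {g | w n%:R = Some g & 0 <= g}.
  move=> n0; have /cid[g eg] := pvalP w n0; exists g => //.
  by have := int_ge0 n; rewrite (vle_val _ eg).
pose pos n := (n%:R != 0 :> K) && ~~ vle w 0 (n%:R)^-1.
have posP n g : w n%:R = Some g -> pos n = (0 < g).
  move=> eg; rewrite /pos (pval_neq0 eg) (vle_val _ (pvalV eg)) /=.
  rewrite -oag_ltNge; apply/idP/idP => h; by apply: (oag_ltW h); zmod.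
have [[p0 posp0]|npos] := pselect (exists n, pos n); last first.
  exists 0; apply: nat_enough => n n0; exists 0; rewrite mulr0z.
  have [g eg g0] := int_val n n0; rewrite eg; congr Some.
  apply/eqP; rewrite eq_le g0 andbT; apply: contrapT => /negP; rewrite -oag_ltNge => gp.
  by apply: npos; exists n; rewrite (posP _ _ eg).
have [p posp minp] := ex_minnP (ex_intro _ p0 posp0).
have p0K : p%:R != 0 :> K by case/andP: posp.
have [g eg g0] := int_val p p0K; exists g; apply: nat_enough.
have gp : 0 < g by rewrite -(posP _ _ eg).
have p_gt0 : (0 < p)%N by rewrite lt0n; apply: contra p0K => /eqP->.
have p_gt1 : (1 < p)%N.
  rewrite ltn_neqAle p_gt0 andbT; apply/eqP => p1.
  by move: eg; rewrite -p1 pval1 => -[e]; rewrite -e ltxx in gp.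
elim/ltn_ind => n IH n0.
have [h eh h0] := int_val n n0.
have [posn|nposn] := boolP (pos n); last first.
  exists 0; rewrite mulr0z eh; congr Some; apply/eqP; rewrite eq_le h0 andbT.
  by move: nposn; rewrite (posP _ _ eh) oag_ltNge negbK.
have hp : 0 < h by rewrite -(posP _ _ eh).
have nE : n%:R = (n %/ p)%:R * p%:R + (n %% p)%:R :> K.
  by rewrite -natrM -natrD -divn_eq.
have r0 : (n %% p)%:R = 0 :> K.
  apply/eqP; apply: contrapT => /negP r0; have [s es _] := int_val _ r0.
  have [b [b0 bh bg]] : exists b, [/\ 0 < b, b <= h & b <= g].
    by case: (oag_le_or h g) => [hg|/ltW gh]; [exists h|exists g].
  have : vle w b (n %% p)%:R.
    have -> : (n %% p)%:R = n%:R - (n %/ p)%:R * p%:R :> K by rewrite nE addrAC subrr add0r.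
    apply: vleB; first by rewrite (vle_val _ eh).
    rewrite -[b]add0r; apply: vleM; first exact: int_ge0.
    by rewrite (vle_val _ eg).
  rewrite (vle_val _ es) => bs; have : pos (n %% p)%N by rewrite (posP _ _ es) (lt_le_trans b0).
  by move/minp; rewrite leqNgt ltn_pmod.
have nq : n%:R = (n %/ p)%:R * p%:R :> K by rewrite nE r0 addr0.
have q0 : (n %/ p)%:R != 0 :> K by apply: contra n0 => /eqP q0; rewrite nq q0 mul0r.
have n_gt0 : (0 < n)%N by rewrite lt0n; apply: contra n0 => /eqP->.
have [k ek] := IH _ (ltn_Pdiv p_gt1 n_gt0) q0.
by exists (k + 1); rewrite nq (pvalM ek eg) mulrzDr mulr1z.
Qed.

Lemma pvalX x a n : w x = Some a -> w (x ^+ n) = Some (a *+ n).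
Proof.
move=> ex; elim: n => [|n IH]; first by rewrite expr0 mulr0n pval1.
by rewrite exprS mulrS (pvalM ex IH).
Qed.

Lemma pval_prod (I : finType) (F : I -> K) (v : I -> L) :
  (forall i, w (F i) = Some (v i)) -> w (\prod_i F i) = Some (\sum_i v i).
Proof.
move=> Fv; elim/big_rec2: _ => [|i a y _ ey]; first exact: pval1.
exact: pvalM.
Qed.

(** Abhyankar's inequality for a field generated by [size xs] elements: a
    polynomial relation between the [z i] has two terms of the same value, and
    these values only differ from combinations of the [v i] by values of
    integers. *)
Lemma gen_frac_value_relation (xs : seq K) (z : 'I_(size xs).+1 -> K)
    (v : 'I_(size xs).+1 -> L) (g : L) :
  (forall c : int, c%:~R != 0 :> K -> exists k : int, w c%:~R = Some (g *~ k)) ->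
  (forall i, gen_frac xs (z i)) -> (forall i, w (z i) = Some (v i)) ->
  exists (a : 'I_(size xs).+1 -> int) (k : int),
    (exists i, a i != 0) /\ \sum_i v i *~ a i = g *~ k.
Proof.
move=> gP zfrac zv; have [N [c [c0 [a0 ca0]]]] := gen_frac_dependent zfrac.
have mon_val (a : {ffun 'I_(size xs).+1 -> 'I_N}) :
    w (\prod_i z i ^+ a i) = Some (\sum_i v i *+ a i).
  by apply: pval_prod => i; apply: pvalX.
have mon_neq0 (a : {ffun 'I_(size xs).+1 -> 'I_N}) := pval_neq0 (mon_val a).
have [|a [b [nab ta tb]]] := @val_sum_collision _ _ a0 c0.
  by rewrite -mulrzr mulf_neq0.
have c_neq0 (a' : {ffun 'I_(size xs).+1 -> 'I_N}) :
    (\prod_i z i ^+ a' i) *~ c a' != 0 -> (c a')%:~R != 0 :> K.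
  by rewrite -mulrzr mulf_eq0 negb_or => /andP[].
have [k ek] := gP _ (c_neq0 _ ta); have [l el] := gP _ (c_neq0 _ tb).
have term_val (a' : {ffun 'I_(size xs).+1 -> 'I_N}) k' : w (c a')%:~R = Some (g *~ k') ->
    w ((\prod_i z i ^+ a' i) *~ c a') = Some (\sum_i v i *+ a' i + g *~ k').
  by move=> ek'; rewrite -mulrzr (pvalM (mon_val a') ek').
rewrite (term_val _ _ ek) (term_val _ _ el) => -[eab].
exists (fun i => (a i)%:Z - (b i)%:Z), (l - k); split.
  have /existsP[i ni] : [exists i, a i != b i].
    rewrite -negb_forall; apply: contra nab => /forallP h; apply/eqP/ffunP => i.
    exact/eqP/h.
  by exists i; rewrite subr_eq0; apply: contra ni => /eqP[/val_inj->].
under eq_bigr => i _ do rewrite mulrzBr -!pmulrn.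
rewrite sumrB mulrzBr; have -> : \sum_i v i *+ a i = \sum_i v i *+ b i + g *~ l - g *~ k.
  by rewrite -eab addrK.
by rewrite -[_ + _ *~ l - _]addrA addrAC subrr add0r.
Qed.

(** A maximal family independent modulo the value [g] of the integers spans
    together with [g]; its size is bounded by the previous relations. *)
Lemma gen_frac_rat_spanning (xs : seq K) :
  (forall y, gen_frac xs y) -> (forall a, exists x, w x = Some a) ->
  exists r (e : 'I_r -> L), (r <= (size xs).+1)%N /\ rat_spanning e.
Proof.
move=> all_frac w_surj; have [g gP] := val_intr_cyclic.
pose dep k := `[< forall v : 'I_k -> L, exists (a : 'I_k -> int) (n : int),
  (exists i, a i != 0) /\ \sum_i v i *~ a i = g *~ n >].
have dep_size : dep (size xs).+1.
  apply/asboolP => v; have /choice[z zv] := fun i => w_surj (v i).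
  exact: gen_frac_value_relation gP (fun i => all_frac (z i)) zv.
have ex_dep : exists k, dep k by exists (size xs).+1.
have [[|k] /asboolP depk mink] := ex_minnP ex_dep.
  by have [a [n [[[]]]]] := depk (fun => 0).
have : ~~ dep k by apply/negP => /mink; rewrite ltnn.
move=> /asboolPn/existsNP[v /forallNP vfree].
exists k.+1, (fun i => if unlift 0 i is Some l then v l else g).
split; first exact: mink.
move=> x; have [a [n [[i ai]]]] := depk (fun i => if unlift 0 i is Some l then v l else x).
rewrite big_ord_recl unlift_none; under eq_bigr => l _ do rewrite liftK.
move=> rel; exists (a 0), (fun i => if unlift 0 i is Some l then - a (lift 0 l) else n).
split.
  apply/eqP => a0; apply: (vfree (fun l => a (lift 0 l))); exists n; split.
    case: (unliftP 0 i) => [l il|i0]; first by exists l; rewrite -il.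
    by rewrite i0 a0 eqxx in ai.
  by rewrite -rel a0 mulr0z add0r.
rewrite big_ord_recl unlift_none -rel; under [X in _ = _ + X]eq_bigr => l _ do rewrite liftK mulrNz.
by rewrite sumrN addrK.
Qed.

End Values.

(** * Embedding ordered rational spaces into lexicographic powers *)

(** The nonnegative vectors of a total order on a rational vector space. *)
Record is_cone (d : nat) (P : 'rV[rat]_d -> Prop) : Prop := IsCone {
  coneD : forall x y, P x -> P y -> P (x + y);
  coneZ : forall (q : rat) x, 0 <= q -> P x -> P (q *: x);
  cone_total : forall x, P x \/ P (- x);
  cone_anti : forall x, P x -> P (- x) -> x = 0
}.

Section Holder.
Variables (R : realType) (d : nat) (P : 'rV[rat]_d -> Prop).
Hypothesis coneP : is_cone P.

Lemma cone0 : P 0.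
Proof. by case: (cone_total coneP 0); rewrite ?oppr0. Qed.

Lemma cone_sum (I : finType) (F : I -> 'rV[rat]_d) :
  (forall i, P (F i)) -> P (\sum_i F i).
Proof. by move=> PF; apply: big_ind => //; [exact: cone0|exact: coneD]. Qed.

(** The sum of the absolute values of the basis vectors is an order unit. *)
Lemma cone_unit : (0 < d)%N ->
  exists u, [/\ P u, u != 0 & forall x, exists n : nat, P (n%:R *: u - x)].
Proof.
move=> d_gt0.
have /choice[a aP] : forall i : 'I_d, exists a,
    P a /\ (a = delta_mx 0 i \/ a = - delta_mx 0 i).
  move=> i; case: (cone_total coneP (delta_mx 0 i)) => h.
    by exists (delta_mx 0 i); split=> //; left.
  by exists (- delta_mx 0 i); split=> //; right.
have aN i : a i != 0.
  have e0 : delta_mx 0 i != 0 :> 'rV[rat]_d.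
    by apply/eqP => /rowP/(_ i)/eqP; rewrite !mxE !eqxx oner_eq0.
  by have [_ [->|->]] := aP i; rewrite ?oppr_eq0.
have rest k : P (\sum_i a i - a k).
  rewrite (bigD1 k) //= addrAC subrr add0r.
  by apply: big_ind => [|x y|i _]; [exact: cone0|exact: coneD|have [] := aP i].
exists (\sum_i a i); split.
- by apply: cone_sum => i; have [] := aP i.
- apply/eqP => u0; have := rest (Ordinal d_gt0); rewrite u0 sub0r => Pn.
  have [Pa _] := aP (Ordinal d_gt0).
  by move: (aN (Ordinal d_gt0)); rewrite (cone_anti coneP Pa Pn) eqxx.
move=> x.
have bound i (q : rat) : exists n : nat, P (n%:R *: a i - q *: delta_mx 0 i).
  have [Pa ea] := aP i.
  have [n qn] : exists n : nat, `|q| <= n%:R.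
    by exists (Num.bound `|q|); apply: ltW; apply: archi_boundP.
  exists n; have [q1 q2] : - n%:R <= q /\ q <= n%:R by apply/andP; rewrite -ler_norml.
  case: ea => ea; rewrite ea in Pa *.
    by rewrite -scalerBl; apply: (coneZ coneP) => //; rewrite subr_ge0.
  rewrite scalerN -opprD -scalerDl -scalerN; apply: (coneZ coneP) => //.
  by rewrite -lerBlDl sub0r.
have /choice[N NP] : forall i, exists n : nat, P (n%:R *: a i - x 0 i *: delta_mx 0 i).
  by move=> i; apply: bound.
exists (\sum_i N i)%N; have -> : (\sum_i N i)%:R *: \sum_i a i - x =
    \sum_i ((\sum_k N k - N i)%N%:R *: a i + ((N i)%:R *: a i - x 0 i *: delta_mx 0 i)).
  rewrite [X in _ - X = _](row_sum_delta x) scaler_sumr -sumrB; apply: eq_bigr => i _.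
  rewrite addrA -scalerDl -natrD subnK //.
  by rewrite (bigD1 i) //= leq_addr.
apply: cone_sum => i; apply: (coneD coneP) => //.
by apply: (coneZ coneP) => //; have [] := aP i.
Qed.

Variable u : 'rV[rat]_d.
Hypotheses (Pu : P u) (u0 : u != 0) (u_unit : forall x, exists n : nat, P (n%:R *: u - x)).

Lemma cone_scale_ge0 (q : rat) : P (q *: u) -> 0 <= q.
Proof.
move=> Pq; rewrite leNgt; apply/negP => q0; case/eqP: u0.
apply: (cone_anti coneP Pu).
have -> : - u = (- q^-1) *: (q *: u) by rewrite scalerA mulNr mulVf ?scaleN1r // lt_eqF.
by apply: (coneZ coneP) => //; rewrite oppr_ge0 invr_le0 ltW.
Qed.

Definition lower_cut x : set R := [set ratr q | q in [set q : rat | P (x - q *: u)]].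

(** Hoelder's map, which compares a vector with the order unit [u]; it is
    additive and monotone, and its kernel consists of the vectors infinitely
    small with respect to [u]. *)
Definition holder x : R := sup (lower_cut x).

Lemma lower_cut_neq0 x : lower_cut x !=set0.
Proof.
have [n Pn] := u_unit (- x); exists (ratr (- n%:R)), (- n%:R) => //=.
by rewrite scaleNr opprK addrC; rewrite opprK in Pn.
Qed.

Lemma lower_cut_ubound x (q : rat) : P (q *: u - x) -> ubound (lower_cut x) (ratr q).
Proof.
move=> Pq _ [q' /= Pq' <-]; rewrite ler_rat -subr_ge0; apply: cone_scale_ge0.
have -> : (q - q') *: u = (q *: u - x) + (x - q' *: u).
  by rewrite scalerBl addrA subrK.
exact: coneD.
Qed.

Lemma lower_cut_sup x : has_sup (lower_cut x).
Proof.
split; first exact: lower_cut_neq0.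
by have [n /lower_cut_ubound h] := u_unit x; exists (ratr n%:R).
Qed.

Lemma holder_ge x (q : rat) : P (x - q *: u) -> ratr q <= holder x.
Proof. by move=> Pq; apply: ub_le_sup; [case: (lower_cut_sup x)|exists q]. Qed.

Lemma holder_le x (q : rat) : P (q *: u - x) -> holder x <= ratr q.
Proof.
by move=> Pq; apply: ge_sup; [exact: lower_cut_neq0|exact: lower_cut_ubound].
Qed.

Lemma holder_ltP x (q : rat) : holder x < ratr q -> P (q *: u - x).
Proof.
move=> h; case: (cone_total coneP (q *: u - x)) => //; rewrite opprB.
by move/holder_ge; rewrite leNgt h.
Qed.

Lemma holder_gtP x (q : rat) : ratr q < holder x -> P (x - q *: u).
Proof.
move=> h; case: (cone_total coneP (x - q *: u)) => //; rewrite opprB.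
by move/holder_le; rewrite leNgt h.
Qed.

Lemma holderD : {morph holder : x y / x + y}.
Proof.
move=> x y; apply/eqP; rewrite eq_le; apply/andP; split; rewrite leNgt; apply/negP => lt.
  pose e := (holder (x + y) - (holder x + holder y)) / 2.
  have e0 : 0 < e by rewrite divr_gt0 // subr_gt0.
  have [q1] := @rat_in_itvoo R (holder x) (holder x + e) (ltac:(by rewrite ltrDl)).
  have [q2] := @rat_in_itvoo R (holder y) (holder y + e) (ltac:(by rewrite ltrDl)).
  rewrite !in_itv /= => /andP[l2 g2] /andP[l1 g1].
  have h := coneD coneP (holder_ltP l1) (holder_ltP l2).
  have /holder_le : P ((q1 + q2) *: u - (x + y)).
    by rewrite scalerDl opprD addrACA.
  rewrite rmorphD /= leNgt => /negP; apply; apply: (lt_le_trans (ltrD g1 g2)).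
  by rewrite /e; lra.
pose e := (holder x + holder y - holder (x + y)) / 2.
have e0 : 0 < e by rewrite divr_gt0 // subr_gt0.
have [q1] := @rat_in_itvoo R (holder x - e) (holder x) (ltac:(by rewrite gtrBl)).
have [q2] := @rat_in_itvoo R (holder y - e) (holder y) (ltac:(by rewrite gtrBl)).
rewrite !in_itv /= => /andP[l2 g2] /andP[l1 g1].
have h := coneD coneP (holder_gtP g1) (holder_gtP g2).
have /holder_ge : P ((x + y) - (q1 + q2) *: u).
  by rewrite scalerDl opprD addrACA.
rewrite rmorphD /= leNgt => /negP; apply; apply: (le_lt_trans _ (ltrD l1 l2)).
by rewrite /e; lra.
Qed.

Lemma holder0 : holder 0 = 0.
Proof. by apply: (addrI (holder 0)); rewrite -holderD !addr0. Qed.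

Lemma holderMn x n : holder (x *+ n) = holder x *+ n.
Proof. by elim: n => [|n IH]; rewrite ?mulr0n ?holder0 // !mulrS holderD IH. Qed.

Lemma holderN x : holder (- x) = - holder x.
Proof. by apply: (addrI (holder x)); rewrite -holderD !subrr holder0. Qed.

Lemma holder_scale_eq0 (q : rat) x : holder x = 0 -> holder (q *: x) = 0.
Proof.
move=> hx; have num_hx (a : int) : holder (x *~ a) = 0.
  by case: a => n; rewrite ?NegzE ?mulrNz ?holderN -pmulrn holderMn hx mul0rn ?oppr0.
have : holder (q *: x) *+ `|denq q| = 0.
  rewrite -holderMn -scaler_nat scalerA mulrC.
  by rewrite rat_num_den scaler_int num_hx.
by move=> /eqP; rewrite mulrn_eq0 absz_eq0 (negPf (denq_neq0 q)) /= => /eqP.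
Qed.

Lemma holder_unit : holder u = 1.
Proof.
apply/eqP; rewrite eq_le; apply/andP; split.
  by have := @holder_le u 1; rewrite scale1r subrr rmorph1; apply; apply: cone0.
by have := @holder_ge u 1; rewrite scale1r subrr rmorph1; apply; apply: cone0.
Qed.

Lemma holder_ge0 x : P x -> 0 <= holder x.
Proof. by have := @holder_ge x 0; rewrite scale0r subr0 rmorph0. Qed.

End Holder.

Lemma cone_preimage d n (P : 'rV[rat]_d -> Prop) (B : 'M[rat]_(n, d)) :
  row_free B -> is_cone P -> is_cone (fun y => P (y *m B)).
Proof.
move=> freeB coneP; split.
- by move=> x y; rewrite mulmxDl; apply: coneD.
- by move=> q x q0; rewrite -scalemxAl; apply: coneZ.
- by move=> x; rewrite mulNmx; apply: cone_total.
- move=> x Px; rewrite mulNmx => PNx; apply/eqP.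
  by rewrite -(mulmx_free_eq0 _ freeB) (cone_anti coneP Px PNx).
Qed.

(** The rows of [B] form a maximal free family in the kernel. They are fewer
    than [d], as [f] would otherwise vanish on all their combinations, in
    particular at [u]. *)
Lemma additive_kernel_basis (R : zmodType) d (f : 'rV[rat]_d -> R) (u : 'rV[rat]_d) :
  {morph f : x y / x + y} -> (forall (q : rat) x, f x = 0 -> f (q *: x) = 0) ->
  f u <> 0 ->
  exists n (B : 'M[rat]_(n, d)),
    [/\ (n < d)%N, row_free B & forall x, f x = 0 -> (x <= B)%MS].
Proof.
move=> fD fZ fu.
pose good n := `[< exists B : 'M[rat]_(n, d), row_free B /\ forall i, f (row i B) = 0 >].
have good_le n : good n -> (n <= d)%N.
  by move=> /asboolP[B [/eqP rkB _]]; rewrite -rkB rank_leq_col.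
have [|n /asboolP[B [freeB fB]] maxn] := ex_maxnP _ good_le.
  by exists 0%N; apply/asboolP; exists 0; split=> [|[]//]; rewrite /row_free mxrank0.
exists n, B; split=> //.
  rewrite ltn_neqAle good_le ?andbT; last by apply/asboolP; exists B.
  apply/eqP => nd; apply: fu; have f0 : f 0 = 0.
    by apply: (addrI (f 0)); rewrite -fD !addr0.
  have fullB : row_full B by rewrite /row_full (eqP freeB) nd.
  have /submxP[y ->] := submx_full u fullB.
  rewrite mulmx_sum_row; apply: (big_ind (fun y => f y = 0)) => // [a b fa fb|i _]; last exact: fZ.
  by rewrite fD fa fb addr0.
move=> x fx; apply: contraT => nxB.
suff : (n + 1 <= n)%N by rewrite addn1 ltnn.
apply: maxn; apply/asboolP.
have lt : (B < B + x)%MS.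
  rewrite ltmxE addsmxSl /=; apply: contra nxB; apply: submx_trans.
  exact: addsmxSr.
have : \rank (col_mx B x) = (n + 1)%N.
  apply/eqP; rewrite eqn_leq rank_leq_row /= -addsmxE [leqLHS]addn1.
  by have := rank_ltmx lt; rewrite (eqP freeB).
move=> rk; exists (col_mx B x); split; first by rewrite /row_free rk.
move=> i; rewrite -(splitK i); case: (fintype.split i) => k /=.
  by rewrite rowKu.
by rewrite rowKd [row k x](_ : _ = x) //; apply/rowP => c; rewrite !mxE ord1.
Qed.

(** Hahn embedding in finite rank: the order unit gives a real valued monotone
    coordinate, whose kernel is embedded by induction on the dimension. *)
Lemma cone_lex_embedding (R : realType) d (P : 'rV[rat]_d -> Prop) d' :
  is_cone P -> (d <= d')%N ->
  exists phi : 'rV[rat]_d -> lexR R d',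
    {morph phi : x y / x + y} /\ forall x, P x -> x <> 0 -> 0 < phi x.
Proof.
elim/ltn_ind: d => d IH in P d' *; move=> coneP dd'.
case: (posnP d) => [d_eq0|d_gt0].
  subst d; by exists (fun => 0); split=> [x y|x _]; [rewrite addr0|rewrite thinmx0].
have [u [Pu u0 uu]] := cone_unit coneP d_gt0.
pose f := @holder R d P u.
have fD : {morph f : x y / x + y} := holderD R coneP Pu u0 uu.
have fu : f u <> 0.
  by rewrite /f holder_unit //; apply/eqP; rewrite oner_eq0.
have [n [B [nd freeB kerB]]] :=
  additive_kernel_basis fD (holder_scale_eq0 coneP Pu u0 uu) fu.
case: d' dd' => [|d'] dd'; first by move: d_gt0; rewrite leqNgt ltnS dd'.
have [|phi [phiD phi_gt0]] := IH n nd _ d' (cone_preimage freeB coneP).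
  by rewrite -ltnS (leq_trans nd).
(* The leading coordinate is Hoelder's map; the others come from the projection
   onto the kernel. *)
pose psi x : lexR R d'.+1 :=
  \row_i if unlift 0 i is Some k then phi (x *m pinvmx B) 0 k else f x.
exists psi; split=> [x y|x Px x0].
  apply/rowP => i; rewrite !mxE; case: (unlift 0 i) => [l|]; last exact: fD.
  by rewrite mulmxDl phiD mxE.
have fx : 0 <= f x by apply: holder_ge0.
have [fx0|fx0] := eqVneq (f x) 0; last first.
  apply/lex_ltP; exists 0 => //.
  by rewrite !mxE unlift_none lt_neqAle eq_sym fx0.
have xB := mulmxKpV (kerB _ fx0).
have /phi_gt0/(_ _)/lex_ltP : P (x *m pinvmx B *m B) by rewrite xB.
case=> [y0|i lti phi_i]; first by apply: x0; rewrite -xB y0 mul0mx.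
apply/lex_ltP; exists (lift 0 i) => [j|]; last by move: phi_i; rewrite !mxE liftK.
rewrite !mxE; case: unliftP => [l ->|-> _]; last by rewrite fx0.
by rewrite !lift0 ltnS => /lti; rewrite mxE.
Qed.

(** * Rational coordinates on an ordered group of finite rank *)

Section Coordinates.
Variables (L : orderedAbGroup) (r : nat) (e : 'I_r -> L).
Hypotheses (e_span : rat_spanning e) (e_free : rat_free e).
Implicit Types (x y : L) (n : int) (c : 'I_r -> int).

Lemma coord_ex x : exists k : 'rV[rat]_r, forall n c,
  n != 0 -> x *~ n = \sum_i e i *~ c i -> forall i, (c i)%:~R = n%:~R * k 0 i.
Proof.
have [n [c [n0 xn]]] := e_span x.
have n0Q : n%:~R != 0 :> rat by rewrite intr_eq0.
exists (\row_i ((c i)%:~R / n%:~R)) => m b m0 xm i; rewrite mxE.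
have /e_free/(_ i)/eqP : \sum_i e i *~ (b i * n - c i * m) = 0.
  under eq_bigr => l _ do rewrite mulrzBr !mulrzA.
  by rewrite sumrB -!mulrz_suml -xm -xn -!mulrzA mulrC subrr.
rewrite subr_eq0 => /eqP/(congr1 (fun k : int => k%:~R : rat)).
by rewrite !rmorphM /= => bn; rewrite mulrA [m%:~R * _]mulrC -bn mulfK.
Qed.

Definition coord x : 'rV[rat]_r := projT1 (cid (coord_ex x)).

Lemma coordP x n c : n != 0 -> x *~ n = \sum_i e i *~ c i ->
  forall i, (c i)%:~R = n%:~R * coord x 0 i.
Proof. exact: (projT2 (cid (coord_ex x))). Qed.

Lemma coordE x n c (q : 'rV[rat]_r) : n != 0 -> x *~ n = \sum_i e i *~ c i ->
  (forall i, (c i)%:~R = n%:~R * q 0 i) -> coord x = q.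
Proof.
move=> n0 xn cq; apply/rowP => i.
by apply: (mulfI (_ : n%:~R != 0)); rewrite ?intr_eq0 // -cq (coordP n0 xn).
Qed.

Lemma coordD : {morph coord : x y / x + y}.
Proof.
move=> x y; have [n [c [n0 xn]]] := e_span x; have [m [b [m0 ym]]] := e_span y.
apply: (@coordE _ (n * m) (fun i => c i * m + b i * n)); first by rewrite mulf_neq0.
  under eq_bigr => i _ do rewrite mulrzDr !mulrzA.
  rewrite big_split /= -!mulrz_suml -xn -ym mulrzDl -!mulrzA.
  by rewrite [m * n]mulrC.
move=> i; rewrite !mxE rmorphD !rmorphM /= (coordP n0 xn) (coordP m0 ym); ring.
Qed.

Lemma coord0 : coord 0 = 0.
Proof. by apply: (addrI (coord 0)); rewrite -coordD !addr0. Qed.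

Lemma coordN x : coord (- x) = - coord x.
Proof. by apply: (addrI (coord x)); rewrite -coordD !subrr coord0. Qed.

Lemma coordMn x k : coord (x *+ k) = k%:R *: coord x.
Proof.
elim: k => [|k IH]; first by rewrite mulr0n coord0 scale0r.
by rewrite mulrS coordD IH -[k.+1]add1n natrD scalerDl scale1r.
Qed.

Lemma coord_sum (c : 'I_r -> int) : coord (\sum_i e i *~ c i) = \row_i (c i)%:~R.
Proof. by apply: (@coordE _ 1 c) => // i; rewrite mxE mul1r. Qed.

Lemma coord_basis i : coord (e i) = delta_mx 0 i.
Proof.
have -> : e i = \sum_k e k *~ (k == i)%:Z.
  by rewrite (bigD1 i) //= eqxx mulr1z big1 ?addr0 // => k /negPf->.
rewrite coord_sum; apply/rowP => k; rewrite !mxE eqxx /=.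
by case: (k == i).
Qed.

Lemma coord_inj x : coord x = 0 -> x = 0.
Proof.
move=> x0; have [n [c [n0 xn]]] := e_span x.
apply: (oag_mulz_eq0 n0); rewrite xn big1 // => i _.
suff -> : c i = 0 by rewrite mulr0z.
by apply/eqP; rewrite -(intr_eq0 rat) (coordP n0 xn) x0 mxE mulr0.
Qed.

(** The coefficients of a combination are unique because the universal
    property, applied to the coordinates, recovers them. *)
Lemma tensQ_basis : has_basis (fun i => tens (e i) 1).
Proof.
have bDl : forall q : rat, {morph (fun x => q *: coord x) : x y / x + y}.
  by move=> q x y; rewrite coordD scalerDr.
have bDr : forall x, {morph (fun q : rat => q *: coord x) : p q / p + q}.
  by move=> x p q; rewrite scalerDl.
have [h [[hD hE] _]] := tens_universal bDl bDr.
have h0 : h 0 = 0 by apply: (addrI (h 0)); rewrite -hD !addr0.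
have tensMz x n q : tens (x *~ n) q = n%:~R *: tens x q.
  have tensMn k : tens (x *+ k) q = k%:R *: tens x q.
    elim: k => [|k IH].
      rewrite mulr0n scale0r; apply: (addrI (tens 0 q)).
      by rewrite -tens_addl !addr0.
    by rewrite mulrS tens_addl IH -[k.+1]add1n natrD scalerDl scale1r.
  case: n => k; first by rewrite -!pmulrn tensMn.
  rewrite NegzE mulrNz rmorphN scaleNr -!pmulrn -tensMn.
  apply: (addrI (tens (x *+ k.+1) q)); rewrite -tens_addl !subrr.
  by apply: (addrI (tens 0 q)); rewrite -tens_addl !addr0.
have tens_sum (I : finType) (F : I -> L) q : tens (\sum_i F i) q = \sum_i tens (F i) q.
  have t0 : tens (0 : L) q = 0 by apply: (addrI (tens 0 q)); rewrite -tens_addl !addr0.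
  by elim/big_rec2: _ => // i y z _ <-; rewrite tens_addl.
move=> x; have hsum (c : {ffun 'I_r -> rat}) :
    h (\sum_i c i *: tens (e i) 1) = \row_i c i.
  rewrite (big_morph h hD h0) [RHS]row_sum_delta; apply: eq_bigr => i _.
  by rewrite tens_scale hE mulr1 coord_basis mxE.
suff [c ec] : exists c : {ffun 'I_r -> rat}, x = \sum_i c i *: tens (e i) 1.
  exists c; split=> // c' ec'; apply/ffunP => i.
  by have := congr1 h (etrans (esym ec) ec'); rewrite !hsum => /rowP/(_ i); rewrite !mxE.
elim/tq_frac_ind: x => x d d0; have [n [c [n0 xn]]] := e_span x.
have n0Q : n%:~R != 0 :> rat by rewrite intr_eq0.
exists [ffun i => (c i)%:~R / n%:~R / d%:R].
rewrite tq_frac_tens //.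
have -> : tens x d%:R^-1 = (n%:~R)^-1 *: tens (x *~ n) d%:R^-1.
  by rewrite tensMz scalerA mulVf // scale1r.
rewrite xn tens_sum scaler_sumr; apply: eq_bigr => i _.
rewrite ffunE tensMz !tens_scale mulr1; congr tens.
by rewrite mulrA [n%:~R^-1 * _]mulrC.
Qed.

(** The order of [L] carried to the coordinate space, where positive multiples
    absorb the denominators. *)
Definition coord_cone (q : 'rV[rat]_r) : Prop := exists (k : nat) x,
  [/\ (0 < k)%N, 0 <= x & coord x = k%:R *: q].

Lemma oag_muln_ge0 x k : 0 <= x -> 0 <= x *+ k.
Proof.
move=> x0; elim: k => // k IH; rewrite mulrS.
by have := oag_leD2 x0 IH; rewrite addr0.
Qed.

Lemma int_multiple (q : 'rV[rat]_r) : exists (k : nat) (c : 'I_r -> int),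
  (0 < k)%N /\ forall i, k%:R * q 0 i = (c i)%:~R.
Proof.
exists (\prod_i `|denq (q ord0 i)|)%N.
have /choice[c cE] : forall i, exists c : int, (\prod_i `|denq (q ord0 i)|)%N%:R * q 0 i = c%:~R.
  move=> i; exists ((\prod_(l | l != i) `|denq (q ord0 l)|)%N%:Z * numq (q 0 i)).
  rewrite (bigD1 i) //= intrM -rat_num_den natrM -pmulrn; ring.
exists c; split=> //; rewrite prodn_cond_gt0 // => i _.
exact: absz_den_gt0.
Qed.

Lemma coord_coneP : is_cone coord_cone.
Proof.
split.
- move=> q q' [k [x [k0 x0 ex]]] [k' [x' [k0' x0' ex']]].
  exists (k * k')%N, (x *+ k' + x' *+ k); split; first by rewrite muln_gt0 k0.
    have := oag_leD2 (oag_muln_ge0 k' x0) (oag_muln_ge0 k x0').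
    by rewrite addr0.
  by rewrite coordD !coordMn ex ex' !scalerA scalerDr natrM [k'%:R * _]mulrC.
- move=> s q s0 [k [x [k0 x0 ex]]].
  exists (k * `|denq s|)%N, (x *+ `|numq s|); split.
  + by rewrite muln_gt0 k0 absz_den_gt0.
  + exact: oag_muln_ge0.
  + rewrite coordMn ex !scalerA; congr (_ *: _).
    rewrite natrM -mulrA [_ * s]mulrC rat_num_den mulrC; congr (_ * _).
    by rewrite pmulrn gez0_abs // numq_ge0.
- move=> q; have [k [c [k0 kq]]] := int_multiple q.
  have ex : coord (\sum_i e i *~ c i) = k%:R *: q.
    by rewrite coord_sum; apply/rowP => i; rewrite !mxE kq.
  case: (oag_le_or 0 (\sum_i e i *~ c i)) => [x0|/ltW x0]; [left|right].
    by exists k, (\sum_i e i *~ c i).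
  exists k, (- \sum_i e i *~ c i); split=> //; last by rewrite coordN ex scalerN.
  by apply: (oag_leW x0); zmod.
- move=> q [k [x [k0 x0 ex]]] [k' [x' [k0' x0' ex']]].
  have /coord_inj xx' : coord (x *+ k' + x' *+ k) = 0.
    by rewrite coordD !coordMn ex ex' !scalerA scalerN mulrC subrr.
  have xk0 : x *+ k' = 0.
    apply/eqP; rewrite eq_le oag_muln_ge0 // andbT.
    have := oag_muln_ge0 k x0'; move/(oag_leW); apply; rewrite subr0 sub0r.
    by apply/eqP; rewrite eq_sym -addr_eq0 addrC xx'.
  have x_eq0 : x = 0 by apply: (@oag_muln_eq0 _ _ k'.-1); rewrite prednK.
  apply/eqP; have /eqP := ex; rewrite x_eq0 coord0 eq_sym scaler_eq0 pnatr_eq0.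
  by rewrite -leqn0 leqNgt k0.
Qed.

Lemma oag_lex_embedding (R : realType) d : (r <= d)%N ->
  exists phi : L -> lexR R d,
    {morph phi : x y / x + y} /\ forall x, 0 < x -> 0 < phi x.
Proof.
move=> rd; have [phi [phiD phi_gt0]] := cone_lex_embedding R coord_coneP rd.
exists (phi \o coord); split=> [x y|x x0] /=; first by rewrite coordD phiD.
apply: phi_gt0; first by exists 1%N, x; split=> //; [apply: ltW|rewrite scale1r].
by move/coord_inj => x_eq0; rewrite x_eq0 ltxx in x0.
Qed.

End Coordinates.

(** * The subfield generated by a finite family *)

Section Subfield.
Variables (K : fieldType) (xs : seq K).

Definition gen_pred : pred K := fun y => `[< gen_frac xs y >].

Lemma gen_predP y : reflect (gen_frac xs y) (y \in gen_pred).
Proof. exact: asboolP. Qed.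

Lemma gen_divring_closed : divring_closed gen_pred.
Proof.
split; first by apply/gen_predP/gen_frac1.
  by move=> x y /gen_predP gx /gen_predP gy; apply/gen_predP/gen_fracB.
by move=> x y /gen_predP gx /gen_predP gy; apply/gen_predP/gen_fracM/gen_fracV.
Qed.

HB.instance Definition _ := GRing.isDivringClosed.Build K gen_pred gen_divring_closed.

Record gen_field : predArgType := GenField { gf_val :> K; gf_valP : gf_val \in gen_pred }.

HB.instance Definition _ := [isSub for gf_val].
HB.instance Definition _ := [Choice of gen_field by <:].
HB.instance Definition _ := [SubChoice_isSubIntegralDomain of gen_field by <:].
HB.instance Definition _ := [SubIntegralDomain_isSubField of gen_field by <:].

End Subfield.

(** * Reduction to finitely generated fields *)

Section FinitelyGenerated.
Variables (K : fieldType) (xs : seq K).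
Local Notation F := (gen_field xs).

Definition gen_lift (x : K) : F := insubd 0 x.

Lemma gen_liftK x : gen_frac xs x -> val (gen_lift x) = x.
Proof. by move=> gx; rewrite /gen_lift insubdK //; apply/gen_predP. Qed.

Definition gen_seq : seq F := map gen_lift xs.

Lemma val_gen_seq : map val gen_seq = xs.
Proof.
rewrite -map_comp -[RHS]map_id; apply/eq_in_map => x xxs /=.
exact/gen_liftK/gen_frac_mem.
Qed.

Lemma polyval_lift D y : polyval xs D y ->
  exists2 z : F, val z = y & polyval gen_seq D z.
Proof.
have mono_lift e : e \in monos xs D -> exists2 f : F, val f = e & f \in monos gen_seq D.
  rewrite -{1}val_gen_seq; elim: gen_seq e => [|x s IH] e.
    by rewrite inE => /eqP->; exists 1; rewrite ?inE // rmorph1.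
  move=> /monosP[i [f [iD /IH[f' <- f'm] ->]]]; exists (x ^+ i * f').
    by rewrite rmorphM rmorphXn.
  by apply/monosP; exists i, f'.
elim=> [|e z /mono_lift[f <- fm] _ [t <- tD]|e z /mono_lift[f <- fm] _ [t <- tD]].
- by exists 0; [exact: rmorph0|exact: zspan_zero].
- by exists (t + f); [exact: rmorphD|exact: zspan_add].
- by exists (t - f); [exact: rmorphB|exact: zspan_sub].
Qed.

(** Seen from inside, the generated field is generated by the same elements,
    so the bound on the rational rank applies to it. *)
Lemma gen_field_frac (y : F) : gen_frac gen_seq y.
Proof.
have /gen_predP[D [P [Q [PD QD Q0 yPQ]]]] := gf_valP y.
have [P' eP PD'] := polyval_lift PD; have [Q' eQ QD'] := polyval_lift QD.
exists D, P', Q'; split=> //; first by apply: contraNneq Q0 => Q0; rewrite -eQ Q0 rmorph0.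
by apply: val_inj; rewrite fmorph_div /= -[LHS]/(gf_val y) yPQ -eP -eQ.
Qed.

Definition entries_in (A : SL2 K) : Prop := forall i k, gen_frac xs (A i k).

Lemma entries_inM A B : entries_in A -> entries_in B -> entries_in (A * B)%g.
Proof. by move=> gA gB i k; rewrite mulmx2E; apply: gen_fracD; apply: gen_fracM. Qed.

Lemma entries_inV A : entries_in A -> entries_in (A^-1)%g.
Proof.
move=> gA i k; rewrite sl2_invE !mxE; apply: gen_fracB => //.
case: (i == k); rewrite ?mulr1n ?mulr0n; last exact: gen_frac0.
by rewrite mxtrace2E; apply: gen_fracD.
Qed.

Lemma entries_in1 : entries_in 1%g.
Proof. by move=> i k; rewrite mxE; case: (i == k); [apply: gen_frac1|apply: gen_frac0]. Qed.

Section Descent.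
Variables (G : groupType) (j : {multiplicative G -> SL2 K}).
Hypothesis entries_j : forall g, entries_in (j g).

Definition descent_mx (g : G) : 'M[F]_2 := \matrix_(i, k) gen_lift (j g i k).

Lemma val_descent_mx g i k : gf_val (descent_mx g i k) = j g i k.
Proof. by rewrite -[LHS]/(val _) mxE gen_liftK //; apply: entries_j. Qed.

Lemma descent_det g : \det (descent_mx g) == 1.
Proof.
apply/eqP/val_inj; rewrite det_mx2E rmorphB !rmorphM rmorph1 /= !val_descent_mx.
exact: sl2_det2E.
Qed.

Definition descent (g : G) : SL2 F := MkSL2 (descent_det g).

Lemma descentM : {morph descent : g h / (g * h)%g}.
Proof.
move=> g h; apply: val_inj; apply/matrixP => i k; apply: val_inj.
rewrite [RHS](congr1 val (mulmx2E _ _ _ _)) rmorphD !rmorphM /= !val_descent_mx.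
by rewrite gmulfM [LHS]mulmx2E.
Qed.

HB.instance Definition _ := isMultiplicative.Build G (SL2 F) descent descentM.

Lemma val_descent_trace g : val (\tr (descent g)) = \tr (j g).
Proof. by rewrite !mxtrace2E rmorphD /= !val_descent_mx. Qed.

End Descent.

Lemma gen_valring (O : set K) : is_valring O -> is_valring [set x : F | O (val x)].
Proof.
move=> valO; split=> [|x y Ox Oy|x y Ox Oy|x]; rewrite /mkset.
- by rewrite rmorph1; apply: valring1 valO.
- by rewrite rmorphB; apply: (valringB valO).
- by rewrite rmorphM; apply: (valringM valO).
- by rewrite fmorphV; apply: (valring_total valO).
Qed.

End FinitelyGenerated.

(** These entries generate the field of all the entries of [A]: the fourth one
    is determined by the determinant, provided that the entry by which one
    divides does not vanish. The last entry of the second list is repeated for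
    the length to be always 3. *)
Definition three_entries (K : fieldType) (A : SL2 K) : seq K :=
  if A 0 0 != 0 then [:: A 0 0; A 0 1; A 1 0] else [:: A 0 1; A 1 1; A 1 1].

Lemma three_entriesP (K : fieldType) (xs : seq K) (A : SL2 K) :
  {subset three_entries A <= xs} -> entries_in xs A.
Proof.
rewrite /three_entries; have detA := sl2_det2E A.
have [a0|a0] := eqVneq (A 0 0) 0 => /= sub.
  have gb : gen_frac xs (A 0 1) by apply/gen_frac_mem/sub; rewrite !inE eqxx.
  have gd : gen_frac xs (A 1 1) by apply/gen_frac_mem/sub; rewrite !inE eqxx /= ?orbT.
  have bc : A 0 1 * A 1 0 = - 1 by rewrite -detA a0; ring.
  have b0 : A 0 1 != 0.
    by apply/eqP => b0; move/eqP: bc; rewrite b0 mul0r eq_sym oppr_eq0 oner_eq0.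
  have cE : A 1 0 = (0 - 1) / A 0 1 by rewrite sub0r -bc mulrAC mulfV ?mul1r.
  have g0 := gen_frac0 xs.
  move=> i k; case: (ord2P i) => ->; case: (ord2P k) => ->; rewrite ?a0 //.
  by rewrite cE; apply/gen_fracM/gen_fracV => //; apply: gen_fracB => //; apply: gen_frac1.
have ga : gen_frac xs (A 0 0) by apply/gen_frac_mem/sub; rewrite !inE eqxx.
have gb : gen_frac xs (A 0 1) by apply/gen_frac_mem/sub; rewrite !inE eqxx /= ?orbT.
have gc : gen_frac xs (A 1 0) by apply/gen_frac_mem/sub; rewrite !inE eqxx /= ?orbT.
have dE : A 1 1 = (1 + A 0 1 * A 1 0) / A 0 0.
  by rewrite -detA subrK mulrAC mulfV ?mul1r.
move=> i k; case: (ord2P i) => ->; case: (ord2P k) => -> //.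
rewrite dE; apply/gen_fracM/gen_fracV => //; apply: gen_fracD; first exact: gen_frac1.
exact: gen_fracM.
Qed.

(** The representation is defined over the field generated by the entries of
    the images of the generators. *)
Lemma hyperbolic_rep_fg n (G : marked_group n) : hyperbolic_rep G ->
  exists (K : fieldType) (xs : seq K) (O : set K) (j : {multiplicative G -> SL2 K}),
  [/\ size xs = (3 * n)%N, forall y, gen_frac xs y, is_valring O
    & forall g, O (\tr (j g)) -> g = 1%g].
Proof.
move=> [K [R [j [valR hyp]]]].
pose xs := flatten [seq three_entries (j (@mg_family n G i)) | i <- enum 'I_n].
have size_xs : size xs = (3 * n)%N.
  rewrite size_flatten /shape -map_comp -[in RHS](size_enum_ord n).
  elim: (enum 'I_n) => //= i s ->; rewrite /three_entries mulnS.
  by case: ifP.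
have entries_j g : entries_in xs (j g).
  have [u <-] := mg_generate g; rewrite /fg_eval.
  elim: (fg_word u) => [|l s IH].
    by rewrite big_nil multiplicative1; apply: entries_in1.
  rewrite big_cons gmulfM; apply: entries_inM => //.
  have gen_l : entries_in xs (j (@mg_family n G l.1)).
    apply: three_entriesP => x xl; apply/flattenP.
    exists (three_entries (j (@mg_family n G l.1))) => //.
    by apply/mapP; exists l.1; rewrite ?mem_enum.
  by rewrite /letter_val; case: l.2; rewrite ?multiplicativeV //; apply: entries_inV.
exists (gen_field xs), (gen_seq xs), [set x | R (val x)], (descent entries_j).
split=> [||| g] /=; first by rewrite size_map.
- exact: gen_field_frac.
- exact: gen_valring.
- by rewrite /mkset (val_descent_trace entries_j); apply: hyp.
Qed.

(** * Free actions of marked groups on trees *)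

Theorem theorem3p3 (n : nat) (n_gt0 : (0 < n)%N) :
  [/\ closed (BT n),
      forall G : marked_group n, BT n (mg_class G) ->
        exists L : orderedAbGroup,
          dimQ_le (tensQ L) (3 * n + 1)%N /\
          exists T : lambda_tree L, acts_freely_on G T
    & forall (R : realType) (G : marked_group n), BT n (mg_class G) ->
        exists T : lambda_tree (lexR_oag R (3 * n + 1)%N), acts_freely_on G T].
Proof.
have fg (G : marked_group n) : BT n (mg_class G) ->
    exists (K : fieldType) (L : orderedAbGroup) (w : prevaluation K L)
      (j : {multiplicative G -> SL2 K}) r (e : 'I_r -> L),
    [/\ forall g, vle w 0 (\tr (j g)) -> g = 1%g, (r <= 3 * n + 1)%N,
        rat_spanning e & rat_free e].
  move=> /BT_hyperbolic_rep/hyperbolic_rep_fg[K [xs [V [j [size_xs gen valV hyp]]]]].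
  pose w := prevaluation_of (valring_valuation valV).
  have [r0 [e0 [r0_le span0]]] :=
    gen_frac_rat_spanning (w := w) gen (vval_surj (valring_valuation valV)).
  have [r [e [r_le span_e free_e]]] := rat_basis_ex span0.
  exists K, (value_oag valV), w, j, r, e; split=> //.
    move=> g Otr; apply: hyp; rewrite -(vring_valring_valuation valV).
    exact: Otr.
  by rewrite (leq_trans r_le) // addn1 -size_xs.
split; first exact: BT_closed.
- move=> G /fg[K [L [w [j [r [e [free rn span_e free_e]]]]]]].
  exists L; split; last by exists (val_tree w); apply: val_tree_free free.
  by exists r, (fun i => tens (e i) 1); split=> //; apply: tensQ_basis.
- move=> R G /fg[K [L [w [j [r [e [free rn span_e free_e]]]]]]].
  have [phi [phiD phi_gt0]] := oag_lex_embedding span_e free_e R rn.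
  pose wR := @transport K L (lexR_oag R (3 * n + 1)) w phi phiD phi_gt0.
  exists (val_tree wR); apply: (val_tree_free (j := j)) => g.
  by move/transport_vle0/free.
Qed.
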